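(* Let $\mathcal R$ be any ergodic equivalence relation on a standard probability space $(X,\mu)$. Assume that $\mathcal R$ either preserves $\mu$ or is of type ${\rm III}$. Then the following assertions are equivalent: (i) $\mathcal R$ is strongly ergodic. (ii) There exist a constant $\kappa>0$ and a finite family $\theta_1,\dots,\theta_n$ of $\mu$-bounded elements in $[\mathcal R]$ such that $$\forall f\in L^2(X,\mu),\quad \|f-\mu(f)\|_2^2\le \kappa\sum_{k=1}^n\|\theta_k(f)-f\|_2^2 .$$
   Context: Sets and functions are considered up to null sets. An equivalence relation $\mathcal R$ on $X$ is always assumed to be measurable as a subset of $X\times X$, to have countable classes, and to be nonsingular (the $\mathcal R$-saturation of a null set is null). The full group $[\mathcal R]$ is the group of nonsingular automorphisms $\theta$ of $X$ with $(x,\theta(x))\in\mathcal R$ for a.e. $x$. For a function $f$ on $X$, $\theta(f)=f\circ\theta^{-1}$, and $\mu(f)=\int_X f\,d\mu$. $\mathcal R$ preserves $\mu$ if every $\theta\in[\mathcal R]$ preserves $\mu$. $\mathcal R$ is ergodic if every $f\in L^\infty(X)$ with $\theta(f)=f$ for all $\theta\in[\mathcal R]$ is constant. $\mathcal R$ is strongly ergodic if for every sequence of measurable subsets $A_n\subset X$ with $\lim_n\mu(A_n\triangle\theta(A_n))=0$ for every $\theta\in[\mathcal R]$, one has $\lim_n\mu(A_n)(1-\mu(A_n))=0$. An ergodic $\mathcal R$ is of type ${\rm III}$ if it does not consist of a single class up to measure zero and there is no $\sigma$-finite $\mathcal R$-invariant measure (finite or infinite) in the measure class of $X$. A nonsingular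 automorphism $\theta$ of $(X,\mu)$ is $\mu$-bounded if $\log\left(\frac{d(\mu\circ\theta)}{d\mu}\right)$ is a bounded function. *)

(* Defs.v *)
From HB Require Import structures.
From mathcomp Require Import all_boot all_order all_algebra.
From mathcomp Require Import all_classical all_reals all_analysis.
From mathcomp Require Import complex.

Set Implicit Arguments.
Unset Strict Implicit.
Unset Printing Implicit Defensive.

Import Order.TTheory GRing.Theory Num.Theory.
Import numFieldNormedType.Exports.

Local Open Scope classical_set_scope.
Local Open Scope charge_scope.
Local Open Scope ring_scope.
Local Open Scope complex_scope.

(* X is a standard Borel space: its sigma-algebra is, up to a bijection, the
   Borel sigma-algebra of a Polish space (a separable Hausdorff complete
   pseudometric space). *)
Definition standard_borel (R : realType) (d : measure_display)
    (X : measurableType d) : Prop :=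
  exists (P : completePseudoMetricType R) (g : X -> P),
    [/\ hausdorff_space P,
        exists2 D : set P, countable D & dense D,
        bijective g
      & forall A : set X,
          measurable A <-> <<s [set U : set P | open U] >> (g @` A)].

(* Everything is considered up to null sets, so an automorphism of (X, mu) is
   represented by a measurable map together with a measurable inverse modulo
   null sets; it is nonsingular when both maps pull null sets back to null
   sets. *)
Record nonsingular_aut (R : realType) (d : measure_display)
    (X : measurableType d) (mu : probability X R) := NonsingularAut {
  aut_fun : {mfun X >-> X} ;
  aut_inv : {mfun X >-> X} ;
  aut_funK : {ae mu, forall x, aut_inv (aut_fun x) = x} ;
  aut_invK : {ae mu, forall x, aut_fun (aut_inv x) = x} ;
  aut_fun_null : forall N : set X,
    mu.-negligible N -> mu.-negligible (aut_fun @^-1` N) ;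
  aut_inv_null : forall N : set X,
    mu.-negligible N -> mu.-negligible (aut_inv @^-1` N)
}.

Section equivalence_relations.
Context (R : realType) (d : measure_display) (X : measurableType d).
Variable mu : probability X R.

Implicit Types (th : nonsingular_aut mu) (E : set (X * X)) (f : X -> R[i]).

Definition act_fun th f : X -> R[i] := f \o aut_inv th.

(* theta(A), as the preimage of A under the inverse of theta: it is measurable
   and coincides with the direct image modulo null sets. *)
Definition act_set th (A : set X) : set X := aut_inv th @^-1` A.

Definition nonsingular_equivalence E : Prop :=
  [/\ RelationClasses.Equivalence (fun x y => E (x, y)),
      measurable E,
      forall x, countable [set y | E (x, y)]
    & forall N : set X, mu.-negligible N ->
        mu.-negligible [set y | exists2 x, N x & E (x, y)]].

Definition full_group E : set (nonsingular_aut mu) :=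
  [set th | {ae mu, forall x, E (x, aut_fun th x)}].

(* The full group is that of (X, mu), whereas nu may be another measure in the
   measure class of mu. *)
Definition preserves E (nu : set X -> \bar R) : Prop :=
  forall th, full_group E th ->
  forall A : set X, measurable A -> nu (act_set th A) = nu A.

Definition cmeasurable f : Prop :=
  measurable_fun [set: X] (@complex.Re R \o f) /\
  measurable_fun [set: X] (@complex.Im R \o f).

Definition cLnorm (p : \bar R) f : \bar R :=
  Lnorm mu p (fun x => (Normc.normc (f x))%:E).

Definition in_L (p : \bar R) f : Prop :=
  cmeasurable f /\ (cLnorm p f < +oo)%E.

Definition mean f : R[i] :=
  Rintegral mu [set: X] (@complex.Re R \o f) +i*
  Rintegral mu [set: X] (@complex.Im R \o f).

Definition ergodic E : Prop :=
  forall f, in_L +oo%E f ->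
    (forall th, full_group E th -> act_fun th f = f %[ae mu]) ->
    exists c : R[i], f = cst c %[ae mu].

Definition strongly_ergodic E : Prop :=
  forall A : nat -> set X,
    (forall n, measurable (A n)) ->
    (forall th, full_group E th ->
       mu (A n `+` act_set th (A n)) @[n --> \oo] --> 0%E) ->
    (mu (A n) * (1 - mu (A n)))%E @[n --> \oo] --> 0%E.

Definition type_III E : Prop :=
  [/\ ergodic E,
      ~ (exists x, {ae mu, forall y, E (x, y)})
    & ~ (exists nu : {measure set X -> \bar R},
          [/\ sigma_finite [set: X] nu, nu `<< mu, mu `<< nu
            & preserves E nu])].

(* [distribution mu (aut_inv th)] is the measure mu \o theta, since it sends A
   to mu (act_set th A). *)
Definition mu_bounded th : Prop :=
  exists C : R, {ae mu, forall x,
    (`| lne (('d (charge_of_finite_measure (distribution mu (aut_inv th)))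
                '/d mu) x) | <= C%:E)%E}.

End equivalence_relations.

(* Main.v *)
(* If (ii) holds, its inequality for indicator functions reads
   [mu(A) (1 - mu(A)) <= kappa \sum_k mu(A + theta_k(A))], with [+] the symmetric
   difference, which gives (i).

   Conversely, up to null sets the full group is generated by countably many
   bounded measurable involutions [i_m], and the logarithms [h_m] of their
   Radon-Nikodym derivatives form the height cocycle.  By strong ergodicity,
   almost invariance under finitely many of the [i_m] forces [A] to be almost
   trivial.  One shows that for some height [c] every non-null set [W] is carried
   onto a definite proportion of [X] by those [i_m] with [|h_m| <= c]: this is
   clear if [mu] is preserved, and otherwise sets [W] that violate it for larger
   and larger [c] produce a primitive of the height cocycle, that is, an
   invariant measure, against type III.  Hence if [mu(Y) >= 3/4], then finitely
   many bounded involutions move a copy of [Y] onto the rest of [X].  An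
   exhaustion argument now yields finitely many bounded involutions that expand
   every set of measure at most 1/2 by a fixed factor: given almost invariant
   sets of measure at most 1/2, a maximal set of measure at most 1/4 almost
   invariant under the [i_m] could be enlarged.  Cheeger's inequality turns
   expansion into the spectral gap: apply the co-area formula to the squares of
   the positive and negative parts of [f] minus a median. *)
Require Import Defs.
From HB Require Import structures.
From mathcomp Require Import all_boot all_order all_algebra.
From mathcomp Require Import all_classical all_reals all_analysis.
From mathcomp Require Import complex measurable_realfun.
From mathcomp Require Import lra ring.

Set Implicit Arguments.
Unset Strict Implicit.
Unset Printing Implicit Defensive.

Import Order.TTheory GRing.Theory Num.Theory.
Import numFieldNormedType.Exports.

Local Open Scope classical_set_scope.
Local Open Scope ring_scope.
Local Open Scope complex_scope.

(** * Real-valued calculus of the probability measure *)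

Section pr.
Context (R : realType) (d : measure_display) (X : measurableType d).
Variable mu : probability X R.
Implicit Types A B : set X.

(** Strong ergodicity quantifies over sequences and over the whole full group, the spectral gap over
    finitely many bounded elements. The bridge is a countable family of involutions whose graphs
    cover the relation almost everywhere: off a small set an automorphism takes the values of
    finitely many of them. Since null sets are ignored, the family comes from exhausting the
    relation by disjoint graphs over sets of definite measure; countability of the classes enters
    through a Cantor scheme, and no measurable selection is made.

    The finitely many involutions given by strong ergodicity need not expand small sets: they only
    force almost invariant sets to be nearly null or nearly full, with an error that does not scale
    with the set. To scale it, a small set must be compared with its trace on a large set [Y] by
    finitely many bounded maps. Bounded maps only join points at bounded height, and this is where a
    type III relation could fail; such a failure would make the height cocycle a coboundary. *)

Definition Pr A : R := fine (mu A).
Local Notation pr := Pr.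

Lemma prE A : measurable A -> mu A = (pr A)%:E.
Proof. by move=> mA; rewrite /Pr fineK// fin_num_measure. Qed.

Lemma pr_ge0 A : 0 <= pr A.
Proof. by rewrite /Pr fine_ge0. Qed.

Lemma pr_le1 A : measurable A -> pr A <= 1.
Proof. by move=> mA; rewrite -lee_fin -prE// probability_le1. Qed.

Lemma prS A B : measurable A -> measurable B -> A `<=` B -> pr A <= pr B.
Proof.
by move=> mA mB AB; rewrite -lee_fin -!prE// le_measure ?inE.
Qed.

Lemma pr0 : pr set0 = 0.
Proof. by rewrite /Pr measure0. Qed.

Lemma prT : pr setT = 1.
Proof. by rewrite /Pr probability_setT. Qed.

Lemma prC A : measurable A -> pr (~` A) = 1 - pr A.
Proof.
move=> mA; apply: EFin_inj; rewrite -prE; last exact: measurableC.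
by rewrite probability_setC// prE.
Qed.

Lemma prUD A B : measurable A -> measurable B -> A `&` B = set0 ->
  pr (A `|` B) = pr A + pr B.
Proof.
move=> mA mB AB; apply: EFin_inj; rewrite EFinD -!prE//; last exact: measurableU.
by rewrite measureU.
Qed.

Lemma prD A B : measurable A -> measurable B -> pr (A `\` B) = pr A - pr (A `&` B).
Proof.
move=> mA mB; have : pr ((A `\` B) `|` (A `&` B)) = pr (A `\` B) + pr (A `&` B).
  apply: prUD; [exact: measurableD|exact: measurableI|].
  by apply/seteqP; split => x //= [[_ nB] [_ /nB]].
have -> : (A `\` B) `|` (A `&` B) = A.
  by apply/seteqP; split=> [x [[]|[]]//|x Ax]; have [Bx|nBx] := pselect (B x); [right|left].
lra.
Qed.

Lemma prU A B : measurable A -> measurable B -> pr (A `|` B) <= pr A + pr B.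
Proof.
move=> mA mB; have -> : A `|` B = A `|` (B `\` A) by rewrite setUDr setDv setD0.
have mBA := measurableD mB mA; rewrite prUD ?lerD2l ?prS//.
by apply/seteqP; split=> x //= [Ax []].
Qed.

Lemma pr_bigsetU (F : nat -> set X) n : (forall i, measurable (F i)) ->
  pr (\big[setU/set0]_(i < n) F i) <= \sum_(i < n) pr (F i).
Proof.
move=> mF; elim: n => [|n IH]; first by rewrite !big_ord0 pr0.
rewrite !big_ord_recr/=; apply: (le_trans (prU _ _)) => //.
  exact: bigsetU_measurable.
by rewrite lerD2r.
Qed.

Lemma pr_bigcup_lim (F : nat -> set X) e : (forall i, measurable (F i)) ->
  nondecreasing_seq F -> 0 < e -> exists n, pr (\bigcup_i F i) - e < pr (F n).
Proof.
move=> mF ndF e0.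
have mU : measurable (\bigcup_i F i) by exact: bigcup_measurable.
have : mu \o F @ \oo --> mu (\bigcup_i F i) by exact: nondecreasing_cvg_mu.
rewrite (prE mU) => /fine_cvgP[_ /cvgr_dist_lt] /(_ e e0)[n _ /(_ n (leqnn n))/= h].
exists n; move: h; rewrite ltr_norml -/(pr _) => /andP[_]; lra.
Qed.

Lemma pr_bigcup_le (F : nat -> set X) c : (forall i, measurable (F i)) ->
  (forall i, pr (F i) <= c / 2 ^+ i) -> pr (\bigcup_i F i) <= 2 * c.
Proof.
move=> mF Fc; apply/ler_addgt0Pr => e e0.
pose G n := \big[setU/set0]_(i < n.+1) F i.
have GF : \bigcup_i F i = \bigcup_i G i by rewrite -bigcup_bigsetU_bigcup.
have mG i : measurable (G i) by exact: bigsetU_measurable.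
have ndG : nondecreasing_seq G.
  by apply/nondecreasing_seqP => n; rewrite /G [in X in (_ <= X)%O]big_ord_recr; exact/subsetPset/subsetUl.
have [n] := pr_bigcup_lim mG ndG e0.
have c0 : 0 <= c by have := Fc 0%N; rewrite expr0 divr1; apply: le_trans; exact: pr_ge0.
rewrite -GF => h; have : pr (G n) <= 2 * c; last lra.
apply: (le_trans (pr_bigsetU n.+1 mF)).
have -> : 2 * c = c * 2 by rewrite mulrC.
apply: (@le_trans _ _ (\sum_(i < n.+1) c / 2 ^+ i)); first exact: ler_sum.
rewrite -mulr_sumr ler_wpM2l//.
move: n.+1 {h} => {}n; have : \sum_(i < n) (2 ^+ i)^-1 = 2 - 2 / 2 ^+ n :> R.
  elim: n => [|n IH]; first by rewrite big_ord0 expr0; field.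
  by rewrite big_ord_recr/= IH exprS; field; rewrite ?expf_neq0.
move=> ->; have : 0 <= 2 / 2 ^+ n :> R by rewrite divr_ge0// exprn_ge0.
lra.
Qed.

Lemma pr0_bigcup (F : nat -> set X) : (forall i, measurable (F i)) ->
  (forall i, pr (F i) = 0) -> pr (\bigcup_i F i) = 0.
Proof.
move=> mF F0; apply/le_anti; rewrite pr_ge0 andbT.
have := @pr_bigcup_le F 0 mF; rewrite mulr0; apply => i.
by rewrite F0 mul0r.
Qed.

Lemma pr_bigcap_lim (F : nat -> set X) e : (forall i, measurable (F i)) ->
  nonincreasing_seq F -> \bigcap_i F i = set0 -> 0 < e -> exists n, pr (F n) < e.
Proof.
move=> mF niF F0 e0.
have mC i : measurable (~` F i) by exact: measurableC.
have ndC : nondecreasing_seq (fun i => ~` F i).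
  by move=> m n mn; apply/subsetPset/subsetC/subsetPset/niF.
have [n] := pr_bigcup_lim mC ndC e0.
by rewrite -setC_bigcap F0 setC0 prT prC// => h; exists n; lra.
Qed.

Lemma pr0_ae A : measurable A -> pr A = 0 -> {ae mu, forall x, ~ A x}.
Proof. by move=> mA A0; exists A; split => //; [rewrite prE// A0|move=> x /= /contrapT].
Qed.

Lemma ae_pr0 A : measurable A -> {ae mu, forall x, ~ A x} -> pr A = 0.
Proof.
move=> mA h; apply: EFin_inj; rewrite -prE//; apply/negligibleP => //.
by apply: negligibleS h => x Ax /= /(_ Ax).
Qed.

Lemma pr_ae_le A B : measurable A -> measurable B ->
  {ae mu, forall x, A x -> B x} -> pr A <= pr B.
Proof.
move=> mA mB AB; have mD := measurableD mA mB.
have /ae_pr0 : {ae mu, forall x, ~ (A `\` B) x}.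
  by apply: filterS AB => x h [/h].
rewrite prD// => /(_ mD) h.
have := @prS (A `&` B) B (measurableI _ _ mA mB) mB (@subIsetr _ _ _); lra.
Qed.

Lemma integral_cst_pr A (c : R) : measurable A ->
  (\int[mu]_(x in A) (cst c%:E) x)%E = (c * pr A)%:E.
Proof. by move=> mA; rewrite EFinM -prE//; exact: integral_cst. Qed.

Lemma pr0_mu A : measurable A -> pr A = 0 -> mu A = 0%E.
Proof. by move=> mA A0; rewrite prE// A0. Qed.

Lemma preim_measurable d' (Y : measurableType d') (f : X -> Y) (A : set Y) :
  measurable_fun setT f -> measurable A -> measurable (f @^-1` A).
Proof. by move=> mf mA; rewrite -[_ @^-1` _]setTI; exact: mf. Qed.

Lemma boolset_measurable (b : X -> bool) : measurable_fun setT b ->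
  measurable [set x | b x].
Proof.
move=> mb; have -> : [set x | b x] = b @^-1` [set true] by [].
exact: preim_measurable.
Qed.

End pr.

(** * Coding of standard Borel equivalence relations *)

Lemma countable_enum (T : Type) (A : set T) (a : T) : countable A -> A a ->
  exists q : nat -> T, (forall n, A (q n)) /\ forall x, A x -> exists n, q n = x.
Proof.
move=> /countable_injP[f finj] Aa.
have h n : exists y, A y /\ ((exists x, A x /\ f x = n) -> f y = n).
  have [[x [Ax fx]]|nx] := pselect (exists x, A x /\ f x = n).
    by exists x; split.
  by exists a; split => // /nx.
have [q hq] := choice h; exists q; split=> [n|x Ax]; first by have [] := hq n.
exists (f x); have [Aq fq] := hq (f x).
by apply: finj; rewrite ?inE//; apply: fq; exists x.
Qed.

Lemma near_ex (Q : nat -> Prop) : (\forall n \near \oo, Q n) -> exists n, Q n.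
Proof. by case=> N _ /(_ N (leqnn N)); exists N. Qed.

(** [w] is one more than the least index of a set containing the point, and 0 codes the absence of
    such a set. It packs a countable family of sets into a single countably valued test. *)
Lemma first_index d (T : measurableType d) (F : nat -> set T) :
  (forall k, measurable (F k)) ->
  exists w : T -> nat, [/\ forall k, measurable (w @^-1` [set k]),
    forall y, w y = 0%N -> forall k, ~ F k y &
    forall y k, w y = k.+1 -> F k y].
Proof.
move=> mF.
pose w y := if pselect (exists k, `[< F k y >]) is left h then (ex_minn h).+1 else 0%N.
have w0 y : w y = 0%N -> forall k, ~ F k y.
  rewrite /w; case: pselect => // h _ k Fk; apply: h; exists k; exact/asboolP.
have wS y k : w y = k.+1 -> F k y /\ forall j, (j < k)%N -> ~ F j y.
  rewrite /w; case: pselect => // h [<-]; case: ex_minnP => m /asboolP Fm hm.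
  split=> // j jm Fj; have /hm : `[< F j y >] by exact/asboolP.
  by rewrite leqNgt jm.
exists w; split => // [k|y k /wS[]//].
have -> : w @^-1` [set k] = if k is k'.+1 then F k' `\` \bigcup_(j < k') F j
    else ~` \bigcup_j F j.
  case: k => [|k]; apply/seteqP; split=> y /=.
  - by move=> /w0 h [j _ /h].
  - case E: (w y) => [//|k] h; have [Fk _] := wS _ _ E.
    by exfalso; apply: h; exists k.
  - by move=> /wS[Fk h]; split => // -[j /= jk]; exact: h.
  - move=> [Fk h]; case E: (w y) => [|m]; first by have := w0 _ E k.
    have [Fm hm] := wS _ _ E.
    have [mk|km|-> //] := ltngtP m k; last by have := hm _ km Fk.
    by exfalso; apply: h; exists m.
case: k => [|k]; first by apply/measurableC/bigcup_measurable.
by apply: measurableD => //; exact: bigcup_measurable.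
Qed.

Section coding.
Context (R : realType) (d : measure_display) (X : measurableType d).
Variables (P : completePseudoMetricType R) (g : X -> P).
Hypotheses (hausP : hausdorff_space P) (gbij : bijective g).
Hypothesis gmeas : forall A : set X,
  measurable A <-> <<s [set U : set P | open U] >> (g @` A).
Variable q : nat -> P.
Hypothesis qdense : forall O : set P, O !=set0 -> open O -> exists n, O (q n).

Lemma open_preimage (V : set P) : open V -> measurable (g @^-1` V).
Proof.
move=> oV; apply/gmeas; apply: sub_sigma_algebra => /=.
suff -> : g @` (g @^-1` V) = V by [].
have [f fK gK] := gbij; apply/seteqP; split=> [_ [x Vx <-]//|y Vy].
by exists (f y); rewrite /= gK.
Qed.

Definition test_family (C : set (X * X -> nat)) :=
  countable C /\ forall c, C c -> forall k, measurable (c @^-1` [set k]).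

Definition eventually_const (C : set (X * X -> nat)) x (z : nat -> X) :=
  forall c, C c -> exists k, \forall n \near \oo, c (x, z n) = k.

(* The tests in [C] decide membership in [S] continuously: a sequence of points
   on which every test stabilizes eventually agrees with its limit about [S].
   This replaces the refinement of the topology of [X * X] that makes [S]
   clopen. *)
Definition decided (S : set (X * X)) := measurable S /\
  exists2 C, test_family C & forall x z w, eventually_const C x z ->
    g \o z @ \oo --> g w -> \forall n \near \oo, S (x, z n) <-> S (x, w).

Lemma decidedC S : decided S -> decided (~` S).
Proof.
move=> [mS [C tC h]]; split; first exact: measurableC.
exists C => // x z w Cz zw; apply: filterS (h x z w Cz zw) => n /= SE; tauto.
Qed.

(** Each [F k] is settled from some time on, but that time depends on [k]. The first-index test [w]
    supplies the uniformity: a final value [k+1] keeps the sequence in [F k], and the final value 0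
    keeps it out of every [F k], hence its limit too. *)
Lemma decided_bigcup (F : nat -> set (X * X)) :
  (forall k, decided (F k)) -> decided (\bigcup_k F k).
Proof.
move=> dF; have mF k : measurable (F k) by have [] := dF k.
split; first exact: bigcup_measurable.
have /choice[C hC] : forall k, exists C, test_family C /\
    forall x z w, eventually_const C x z -> g \o z @ \oo --> g w ->
    \forall n \near \oo, F k (x, z n) <-> F k (x, w).
  by move=> k; have [_ [C ? ?]] := dF k; exists C.
have [w [mw w0 wS]] := first_index mF.
exists ([set w] `|` \bigcup_k C k).
  split=> [|c [-> //|[k _ Ck]]]; last by have [[_ +] _] := hC k; apply.
  rewrite -bigcup2E; apply: bigcup_countable => // -[|[|k]] _ //=.
  by apply: bigcup_countable => // k _; have [[]] := hC k.
move=> x z y Cz zy.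
have hk k : \forall n \near \oo, F k (x, z n) <-> F k (x, y).
  have [_] := hC k; apply => // c Cc; apply: Cz; right; exists k => //.
have [|k] := Cz w; first by left.
case: k => [|k] wk.
  apply: filterS (wk) => n wn; split=> [[k _ /(w0 _ wn)]//|[k _ Fky]].
  have [m [wm /(_ Fky) Fm]] : exists m, w (x, z m) = 0%N /\ (F k (x, y) -> F k (x, z m)).
    by apply: near_ex; apply: filterS2 wk (hk k) => m ? [].
  by have := w0 _ wm k.
apply: filterS2 wk (hk k) => n /wS Fk [h _].
by split=> _; exists k => //; exact: h.
Qed.

Lemma decided_sigma_algebra : sigma_algebra setT decided.
Proof.
split; [split; first exact: measurable0| |exact: decided_bigcup].
  exists set0 => [|x z w _ _]; last by apply: nearW.
  by split=> [|c []]; exact: countable0.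
by move=> A dA; rewrite setTD; exact: decidedC.
Qed.

Lemma interior_ball (p : P) (e : R) : 0 < e -> (ball p e)^° p.
Proof. by move=> e0; exact: nbhsx_ballx. Qed.

(** An open set is a countable union of closed sets, here the complements of the [O k]. A sequence
    staying in one of these closed sets keeps its limit there, and a sequence staying out of [V]
    cannot converge into it; the first-index test tells the two cases apart. *)
Lemma decided_open (V : set P) : open V -> decided (setT `*` (g @^-1` V)).
Proof.
move=> oV; split; first by apply: measurableX => //; exact: open_preimage.
pose O k := \bigcup_(p in ~` V) (ball p (k.+1%:R^-1 : R))^°.
have oO k : open (O k) by apply: bigcup_open => p _; exact: open_interior.
have VO : V = \bigcup_k ~` O k.
  apply/seteqP; split=> [v Vv|v [k _ h]]; last first.
    apply: contrapT => nV; apply: h; exists v => //; exact: interior_ball.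
  have : nbhs v V by exact: open_nbhs_nbhs.
  rewrite -nbhs_ballE => -[e /= e0 eV]; have [k ke] := ltr_add_invr e0.
  exists k => // -[p nVp /interior_subset /ball_sym pv]; apply: nVp; apply: eV.
  by apply: le_ball pv; move: ke; rewrite add0r => /ltW.
have mF k : measurable (setT `*` (g @^-1` (~` O k)) : set (X * X)).
  apply: measurableX => //; rewrite preimage_setC.
  by apply: measurableC; exact: (open_preimage (oO k)).
have [w [mw w0 wS]] := first_index mF.
exists [set w]; first by split=> [|c -> //]; exact: countable1.
move=> x z y /(_ w erefl)[k wk] zy.
case: k wk => [|k] wk.
  have nV : \forall n \near \oo, ~ V (g (z n)).
    by apply: filterS wk => n /w0 h; rewrite VO => -[k _ hk]; exact: (h k).
  have nVy : ~ V (g y).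
    move=> Vy; have : \forall n \near \oo, V (g (z n)).
      by apply: (zy V); exact: open_nbhs_nbhs.
    by move=> h; have [n []] := near_ex (filterI nV h).
  by apply: filterS nV => n nVn; split=> -[_ /=].
have cl : \forall n \near \oo, ~ O k (g (z n)) by apply: filterS wk => n /wS[].
have nOy : ~ O k (g y).
  move=> Oy; have hO : \forall n \near \oo, O k (g (z n)).
    by apply: (zy (O k)); exact: open_nbhs_nbhs.
  by have [n []] := near_ex (filterI hO cl).
apply: filterS cl => n nO; split=> _; split=> //=; rewrite VO; by exists k.
Qed.

Lemma decided_snd (B : set X) : measurable B -> decided (setT `*` B).
Proof.
move=> /gmeas mB; have : decided (setT `*` (g @^-1` (g @` B))).
  have [d0 dC dU] := decided_sigma_algebra.
  suff : [set V | decided (setT `*` (g @^-1` V))] (g @` B) by [].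
  move: mB; apply: smallest_sub; last by move=> V; exact: decided_open.
  split=> /=.
  - by rewrite preimage_set0 setX0.
  - move=> A /dC; rewrite !setTD; congr decided.
    by apply/seteqP; split=> -[x y] /=; tauto.
  - move=> F /dU; congr decided; apply/seteqP; split=> -[x y] /=.
      by move=> [k _ [_ ?]]; split => //; exists k.
    by move=> [_ [k _ ?]]; exists k.
congr decided; congr setX; apply/seteqP; split=> [x [y By /(bij_inj gbij) <-]//|x Bx].
by exists x.
Qed.

(** Decided sets form a sigma-algebra, so rectangles suffice; the first coordinate is fixed along
    the sequence, and only the second factor needs tests. *)
Lemma measurable_decided (S : set (X * X)) : measurable S -> decided S.
Proof.
rewrite measurable_prod_measurableType.
apply: smallest_sub; first exact: decided_sigma_algebra.
move=> _ [A mA [B mB <-]]; have [_ [C tC h]] := decided_snd mB.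
split; first exact: measurableX.
exists C => // x z w Cz zw; apply: filterS (h x z w Cz zw) => n [h1 h2].
split=> -[Ax Bz]; split=> //; [by have [] := h1|by have [] := h2].
Qed.

(** The [n]-th test names a ball of radius [1/(n+1)] around a dense point. Once it stabilizes, the
    sequence stays in one such ball, so stabilization for all [n] makes it Cauchy. The value 0
    cannot occur, because these balls cover the space. *)
Lemma convergence_tests : exists2 C, test_family C &
  forall x z, eventually_const C x z -> exists w, g \o z @ \oo --> g w.
Proof.
have mF (n k : nat) : measurable (setT `*` (g @^-1` (ball (q k) (n.+1%:R^-1 : R))^°) : set (X * X)).
  by apply: measurableX => //; apply: open_preimage; exact: open_interior.
have /choice[w hw] := fun n => first_index (mF n).
exists (range w).
  split=> [|_ [n _ <-] k]; first exact: (card_le_trans (card_image_le _ _)).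
  by have [] := hw n.
move=> x z Cz.
have : cauchy (g \o z @ \oo).
  apply: cauchy_exP => e e0; have [n ne] := ltr_add_invr e0.
  have [k wk] := Cz (w n) (ex_intro2 _ _ n I erefl).
  have [_ w0 wS] := hw n.
  case: k wk => [|k] wk.
    exfalso; have [N /w0 h] := near_ex wk; pose p := g (z N).
    pose B := (ball p (n.+1%:R^-1 / 2 : R))^°.
    have [k Bk] : exists k, B (q k).
      apply: qdense; last exact: open_interior.
      by exists p; apply: interior_ball; rewrite divr_gt0 ?invr_gt0.
    apply: (h k); split => //=; rewrite -/p.
    apply: (@filterS _ (nbhs p) _ (ball p (n.+1%:R^-1 / 2 : R))); last first.
      by apply: nbhsx_ballx; rewrite divr_gt0 ?invr_gt0.
    move: Bk => /interior_subset/ball_sym qp y py.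
    by rewrite [X in ball _ X](splitr (n.+1%:R^-1 : R)); exact: ball_triangle qp py.
  exists (q k); apply: filterS wk => m /wS[_ /interior_subset /=].
  by apply: le_ball; move: ne; rewrite add0r => /ltW.
move=> /cauchy_cvg /cvg_ex[p zp]; have [f fK gK] := gbij.
by exists (f p); rewrite gK.
Qed.


Definition basic_set (kn : nat * nat) : set X :=
  g @^-1` (ball (q kn.1) (kn.2.+1%:R^-1 : R))^°.

Lemma basic_set_open (V : set P) x : open V -> V (g x) ->
  exists2 kn, basic_set kn x & basic_set kn `<=` g @^-1` V.
Proof.
move=> oV Vx; have : nbhs (g x) V by exact: open_nbhs_nbhs.
rewrite -nbhs_ballE => -[e /= e0 eV].
have [|n ne] := @ltr_add_invr _ 0 (e / 2); first by rewrite divr_gt0.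
pose r : R := n.+1%:R^-1; have r0 : 0 < r by rewrite invr_gt0.
have [k Bk] : exists k, (ball (g x) (r / 2))^° (q k).
  apply: qdense; last exact: open_interior.
  by exists (g x); apply: interior_ball; rewrite divr_gt0.
move: Bk => /interior_subset qx; exists (k, n); rewrite /basic_set /= -/r.
  apply: (@filterS _ (nbhs (g x)) _ (ball (g x) (r / 2))); last first.
    by apply: nbhsx_ballx; rewrite divr_gt0.
  move=> y xy; rewrite [X in ball _ X](splitr r).
  by apply: (ball_triangle (ball_sym qx)).
move=> y /interior_subset ky; apply: eV; rewrite (splitr e).
have rle : r <= e / 2 by move: ne; rewrite add0r => /ltW.
apply: (ball_triangle (y := q k)); last exact: le_ball ky.
apply: le_ball qx; lra.
Qed.

Lemma basic_set_measurable kn : measurable (basic_set kn).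
Proof. by apply: (open_preimage (open_interior _)). Qed.

Lemma basic_set_separates x y : x <> y -> exists2 kn, basic_set kn x & ~ basic_set kn y.
Proof.
move=> xy; have /eqP gxy : g x <> g y by move=> /(bij_inj gbij).
have [V [oV /set_mem Vx /set_mem Vy]] := hausdorff_accessible hausP gxy.
by have [kn knx knV] := basic_set_open oV Vx; exists kn => // /knV.
Qed.

Lemma basic_set_generates (G : set (set X)) :
  sigma_algebra setT G -> (forall kn, G (basic_set kn)) -> measurable `<=` G.
Proof.
move=> [G0 GC GU] Gb A /gmeas mA.
suff : G (g @^-1` (g @` A)).
  congr G; apply/seteqP; split=> [x [y Ay /(bij_inj gbij) <-]//|x Ax].
  by exists x.
move: mA; suff : <<s [set U : set P | open U] >> `<=` [set V | G (g @^-1` V)].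
  by apply.
apply: smallest_sub; first split=> /=.
- by rewrite preimage_set0.
- by move=> V /GC; rewrite !setTD preimage_setC.
- by move=> F /GU; rewrite preimage_bigcup.
move=> V oV /=.
pose F n := if unpickle n is Some kn then
  if pselect (basic_set kn `<=` g @^-1` V) then basic_set kn else set0 else set0.
have -> : g @^-1` V = \bigcup_n F n.
  apply/seteqP; split=> [x Vx|x [n _]].
    have [kn knx knV] := basic_set_open oV Vx.
    by exists (pickle kn) => //; rewrite /F pickleK; case: pselect.
  by rewrite /F; case: unpickle => // kn; case: pselect => // h /h.
apply: GU => n; rewrite /F; case: (unpickle n) => [kn|]; last exact: G0.
by case: (pselect (basic_set kn `<=` g @^-1` V)) => sV; [exact: Gb|exact: G0].
Qed.

End coding.

(** This is all that is used later of the Polish structure. The last clause is a completeness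
    property: inside one class, stabilization of all codes produces a limit in the same class, and
    the sets [S i] see that limit. *)
Lemma standard_borel_coding (R : realType) d (X : measurableType d)
    (E : set (X * X)) (x0 : X) : standard_borel R X -> measurable E ->
  exists (c : nat -> X * X -> nat) (S : nat -> set X),
  [/\ (forall i k, measurable (c i @^-1` [set k])) /\ (forall i, measurable (S i)),
      forall x y, x <> y -> exists i, S i x /\ ~ S i y,
      forall G : set (set X), sigma_algebra setT G -> (forall i, G (S i)) ->
        measurable `<=` G,
      forall i x y z, c i (x, y) = c i (x, z) -> S i y <-> S i z
    & forall x z, (forall n, E (x, z n)) ->
        (forall i, exists k, \forall n \near \oo, c i (x, z n) = k) ->
        exists w, E (x, w) /\ forall i, \forall n \near \oo, S i (z n) <-> S i w].
Proof.
move=> [P [g [hP [D cD dD] gb gm]]] mE.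
have [a Da] : exists a, D a.
  have [|y [_ Dy]] := dD setT _ openT; last by exists y.
  by exists (g x0).
have [q [Dq qD]] := countable_enum cD Da.
have qdense (O : set P) : O !=set0 -> open O -> exists n, O (q n).
  by move=> O0 oO; have [y [Oy /qD[n nq]]] := dD O O0 oO; exists n; rewrite nq.
pose S i := if unpickle i is Some kn then basic_set g q kn else setT.
have mS i : measurable (S i).
  by rewrite /S; case: unpickle => // kn; exact: (basic_set_measurable gb gm).
have bS kn : basic_set g q kn = S (pickle kn) by rewrite /S pickleK.
have [C0 tC0 hC0] := convergence_tests gb gm qdense.
have [_ [CE tCE hCE]] := measurable_decided gb gm mE.
have /choice[CS hCS] : forall i, exists C, test_family C /\
    forall x z w, eventually_const C x z -> g \o z @ \oo --> g w ->
    \forall n \near \oo, (setT `*` S i) (x, z n) <-> (setT `*` S i) (x, w).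
  by move=> i; have [_ [C ? ?]] := decided_snd gb gm (mS i); exists C.
(* The constant test only makes [C] inhabited, so that it can be enumerated. *)
pose C := C0 `|` CE `|` \bigcup_i CS i `|` [set cst 0%N].
have tC : test_family C.
  split; last first.
    move=> c [[[/tC0.2//|/tCE.2//]|[i _ Cc]]|-> k]; first by have [[_ +] _] := hCS i; apply.
    by rewrite preimage_cst; case: ifP.
  have cU (A B : set (X * X -> nat)) : countable A -> countable B -> countable (A `|` B).
    by move=> cA cB; rewrite -bigcup2E; apply: bigcup_countable => // -[|[|k]] _ /=.
  apply: (cU) => //; apply: (cU); first by apply: (cU); [exact: tC0.1|exact: tCE.1].
  by apply: bigcup_countable => // i _; have [[]] := hCS i.
have [c [Cc cC]] := countable_enum tC.1 (or_intror erefl : C (cst 0%N)).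
(* The parity bit records membership in [S i], so that equal codes imply equal membership. *)
pose c' i (y : X * X) := ((c i y).*2 + `[< S i y.2 >])%N.
have c'E i x y z : c' i (x, y) = c' i (x, z) -> c i (x, y) = c i (x, z) /\ (S i y <-> S i z).
  rewrite /c' /= => h.
  have odd_h : `[< S i y >] = `[< S i z >].
    by have := congr1 odd h; rewrite !oddD !odd_double !oddb.
  split; last by split=> /asboolP Sy; apply/asboolP; [rewrite -odd_h|rewrite odd_h].
  by move: h; rewrite odd_h => /addIn /(congr1 half); rewrite !doubleK.
exists c', S; split.
- split=> // i k.
  have mc := tC.2 _ (Cc i) k./2.
  have -> : c' i @^-1` [set k] = (c i @^-1` [set k./2]) `&`
     (if odd k then setT `*` S i else setT `*` ~` S i).
    apply/seteqP; split=> -[x y] /=; rewrite /c' /=.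
      move=> <-; rewrite addnC half_bit_double; split => //.
      rewrite oddD odd_double addbF oddb; case: asboolP => //=.
    case: ifPn => ok [ck [_ /= Sy]]; rewrite ck.
      by rewrite (asboolT Sy) addnC -[RHS]odd_double_half ok.
    by rewrite (asboolF Sy) addnC -[RHS]odd_double_half (negbTE ok).
  apply: measurableI => //; case: ifP => _; apply: measurableX => //.
  exact: measurableC.
- move=> x y /(basic_set_separates hP gb qdense)[kn knx kny].
  by exists (pickle kn); rewrite -bS.
- move=> G sG GS; apply: (basic_set_generates gb gm qdense sG) => kn.
  by rewrite bS.
- by move=> i x y z /c'E[].
move=> x z Ez cz.
have Cz : eventually_const C x z.
  move=> _ /cC[i <-]; have [k hk] := cz i.
  have [N hN] := near_ex hk; exists (c i (x, z N)).
  by apply: filterS hk => n; rewrite -hN => /c'E[].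
have [w zw] : exists w, g \o z @ \oo --> g w.
  by apply: (hC0 x) => b bC; apply: Cz; left; left; left.
have ECw : \forall n \near \oo, E (x, z n) <-> E (x, w).
  by apply: hCE zw => b bC; apply: Cz; left; left; right.
exists w; split; first by have [n [h _]] := near_ex ECw; exact: h.
move=> i; have [_ /(_ x z w _ zw)h] := hCS i.
have /h : eventually_const (CS i) x z.
  by move=> b bC; apply: Cz; left; right; exists i.
by apply: filterS => n /= [h1 h2]; split=> Sz; [have [] := h1 (conj I Sz)|have [] := h2 (conj I Sz)].
Qed.

(** * Separability of the measure algebra *)

Section approximation.
Context (R : realType) (d : measure_display) (X : measurableType d).
Variable mu : probability X R.
Local Notation pr := (Pr mu).

Lemma measurableY (A B : set X) : measurable A -> measurable B -> measurable (A `+` B).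
Proof. by move=> mA mB; apply: measurableU; exact: measurableD. Qed.

Lemma prY_triangle (A B C : set X) : measurable A -> measurable B -> measurable C ->
  pr (A `+` C) <= pr (A `+` B) + pr (B `+` C).
Proof.
move=> mA mB mC; have mAB := measurableY mA mB; have mBC := measurableY mB mC.
apply: le_trans (prU _ mAB mBC); apply: prS => //.
- exact: measurableY.
- exact: measurableU.
by move=> x; rewrite /setY /=; have [Bx|nBx] := pselect (B x); tauto.
Qed.

(** The algebra generated by the [S i] is countable, and the sets that it approximates in measure
    form a sigma-algebra containing every [S i]. *)
Lemma approx_dense (S : nat -> set X) : (forall i, measurable (S i)) ->
  (forall G : set (set X), sigma_algebra setT G -> (forall i, G (S i)) ->
    measurable `<=` G) ->
  exists a : nat -> set X, (forall n, measurable (a n)) /\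
    forall A, measurable A -> forall e, 0 < e -> exists n, pr (A `+` a n) < e.
Proof.
move=> mS genS.
pose step (Q : set (set X)) := Q `|` [set ~` A | A in Q] `|`
  [set A.1 `|` A.2 | A in Q `*` Q].
pose Q n := iter n step (range S).
have QS n : Q n `<=` Q n.+1 by move=> A QA; left; left.
have Qle m n : (m <= n)%N -> Q m `<=` Q n.
  by move=> /subnK <-; elim: (n - m)%N => // k IH A /IH; exact: QS.
have mQ n A : Q n A -> measurable A.
  elim: n A => [|n IH] A; first by move=> [i _ <-].
  move=> [[/IH//|[B /IH mB <-]]|[[B C] [/IH mB /IH mC] <-]]; first exact: measurableC.
  exact: measurableU.
have cQ n : countable (Q n).
  elim: n => [|n IH]; first exact: (card_le_trans (card_image_le _ _)).
  have cU (A B : set (set X)) : countable A -> countable B -> countable (A `|` B).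
    by move=> cA cB; rewrite -bigcup2E; apply: bigcup_countable => // -[|[|k]] _ /=.
  apply: (cU); first apply: (cU) => //.
    exact: (card_le_trans (card_image_le _ _)).
  apply: (card_le_trans (card_image_le _ _)); exact: countableX.
have cA : countable (\bigcup_n Q n) by exact: bigcup_countable.
have [a [Qa aQ]] := countable_enum cA (ex_intro2 _ _ 0%N I (ex_intro2 _ _ 0%N I erefl)).
have ma n : measurable (a n) by have [m _ /mQ] := Qa n.
exists a; split => // A mA.
pose D := [set A | measurable A /\ forall e, 0 < e -> exists n, pr (A `+` a n) < e].
suff : D A by case.
have DU B C : D B -> D C -> D (B `|` C).
  move=> [mB hB] [mC hC]; split=> [|e e0]; first exact: measurableU.
  have e20 : 0 < e / 2 by rewrite divr_gt0.
  have [[n hn] [m hm]] := (hB _ e20, hC _ e20).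
  have [j aj] : exists j, a j = a n `|` a m.
    apply: aQ; have [[k _ kn] [l _ lm]] := (Qa n, Qa m).
    exists (maxn k l).+1 => //; right; exists (a n, a m) => //; split => /=.
      by apply: Qle kn; rewrite leq_maxl.
    by apply: Qle lm; rewrite leq_maxr.
  have mn := measurableY mB (ma n); have mm := measurableY mC (ma m).
  exists j; rewrite (@le_lt_trans _ _ (pr ((B `+` a n) `|` (C `+` a m))))//.
    apply: prS; [|exact: measurableU|].
      by apply: measurableY => //; exact: measurableU.
    by rewrite aj /setY => x /=; tauto.
  by apply: (le_lt_trans (prU _ mn mm)); lra.
have DC B : D B -> D (~` B).
  move=> [mB hB]; split=> [|e /hB[n hn]]; first exact: measurableC.
  have [j aj] : exists j, a j = ~` a n.
    by apply: aQ; have [k _ kn] := Qa n; exists k.+1 => //; left; right; exists (a n).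
  exists j; congr (_ < _): hn; congr (pr _); rewrite aj.
  by apply/seteqP; split=> x; rewrite /setY /=; have [|] := pselect (B x); have [|] := pselect (a n x); tauto.
have DS i : D (S i).
  split => // e e0; have [|n an] := aQ (S i); first by exists 0%N => //; exists i.
  by exists n; rewrite an setYK pr0.
have D0 : D set0.
  rewrite -(setICr (S 0%N)) -[X in D X]setCK setCI.
  by apply: (DC); apply: (DU); apply: (DC) => //; exact: (DC).
apply: (genS D) => //; split=> [//|B /DC|F DF]; first by rewrite setTD.
have mF n : measurable (F n) by have [] := DF n.
split=> [|e e0]; first exact: bigcup_measurable.
pose G n := \big[setU/set0]_(i < n.+1) F i.
have DG n : D (G n) by rewrite /G; elim/big_ind : _ => //; exact: DU.
have mG n : measurable (G n) by have [] := DG n.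
have FG : \bigcup_i F i = \bigcup_i G i by rewrite -bigcup_bigsetU_bigcup.
have ndG : nondecreasing_seq G.
  by apply/nondecreasing_seqP => n; rewrite /G [in X in (_ <= X)%O]big_ord_recr; exact/subsetPset/subsetUl.
have e20 : 0 < e / 2 by rewrite divr_gt0.
have [n hn] := pr_bigcup_lim mu mG ndG e20.
have mU : measurable (\bigcup_i G i) by exact: bigcup_measurable.
have [_ /(_ _ e20)[m hm]] := DG n.
exists m; rewrite FG; apply: (le_lt_trans (prY_triangle mU (mG n) (ma m))).
have -> : \bigcup_i G i `+` G n = \bigcup_i G i `\` G n.
  apply/seteqP; split=> x; last by left.
  by move=> [//|[Gx nGx]]; exfalso; apply: nGx; exists n.
rewrite prD//; have -> : \bigcup_i G i `&` G n = G n by rewrite setIC setIidl// => x; exists n.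
lra.
Qed.

End approximation.

(** * Covering the relation by countably many involutions *)

Lemma dependent_choice_ex (T : Type) (r : T -> T -> Prop) :
  (forall x, exists y, r x y) ->
  forall x0, exists f : nat -> T, f 0%N = x0 /\ forall n, r (f n) (f n.+1).
Proof.
move=> h x0; have [f [f0 fS]] := dependent_choice (fun x => cid (h x)) x0.
by exists f.
Qed.

Lemma logn2_hits (a L : nat) : exists b, (L <= b)%N /\ (0 < b)%N /\ logn 2 b = a.
Proof.
exists (2 ^ a * L.*2.+1)%N; split; last split.
- by rewrite (@leq_trans L.*2.+1)// ?leq_pmull ?expn_gt0// -addnn ltnW// ltnS leq_addr.
- by rewrite muln_gt0 expn_gt0.
- by rewrite lognM ?expn_gt0// pfactorK// lognE /= dvdn2 /= odd_double /= addn0.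
Qed.

(* A Cantor scheme with the numbers as nodes and [logn 2 N] as the parent of
   [N > 0], so that every node has infinitely many children.  Following a branch
   that avoids the [n]-th point of a given enumeration at step [n] produces a
   point of [F] outside the enumeration. *)
Lemma cantor_scheme_uncountable (T : Type) (F : set T) (c : nat -> T -> nat)
    (S : nat -> set T) (y : nat -> T) (M : nat -> nat) :
  (forall i u v, c i u = c i v -> S i u <-> S i v) ->
  (forall z : nat -> T, (forall n, F (z n)) ->
     (forall i, exists k, \forall n \near \oo, c i (z n) = k) ->
     exists w, F w /\ forall i, \forall n \near \oo, S i (z n) <-> S i w) ->
  (forall N, F (y N)) ->
  {homo M : m n / (m <= n)%N} -> (forall N, N <= M N)%N ->
  (forall N i, (0 < N)%N -> (i < M N)%N -> c i (y N) = c i (y (logn 2 N))) ->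
  (forall i j N, (i < j)%N -> (j < N)%N ->
     exists2 k, (k < M N)%N & ~ (S k (y i) <-> S k (y j))) ->
  ~ countable F.
Proof.
move=> cS lim Fy Mle MN par sep cF; have [e [_ eF]] := countable_enum cF (Fy 0%N).
pose St : Type := nat * nat * nat.
(* A state holds the number of enumerated points already avoided, the current node and a lower bound
   for the next node. Nodes from [L'] on inherit the first [M L'] codes of [a'], so what separates
   [a'] from [e n] persists along the branch. *)
pose step (s s' : St) := let: (n, a, L) := s in let: (n', a', L') := s' in
  [/\ n' = n.+1, logn 2 a' = a, (0 < a')%N, (L <= a' < L')%N
    & exists2 k, (k < M L')%N & ~ (S k (y a') <-> S k (e n))].
have step_ex : forall s : St, exists s', step s s'.
  move=> [[n a] L]; have [b1 [Lb1 [b10 b1a]]] := logn2_hits a L.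
  have [b2 [b12 [b20 b2a]]] := logn2_hits a b1.+1.
  have [k kM kS] := sep _ _ _ b12 (ltnSn b2).
  (* The set [S k] separates the two children, so at least one of them is separated from [e n] by
     it. *)
  have [h|h] := pselect (S k (y b1) <-> S k (e n)).
    exists (n.+1, b2, b2.+1); split => //; first by rewrite ltnSn (leq_trans Lb1)// ltnW.
    by exists k => //; tauto.
  exists (n.+1, b1, b2.+1); split => //; last by exists k.
  by rewrite Lb1 ltnS ltnW.
have [f [f0 fS]] := dependent_choice_ex step_ex (0%N, 0%N, 0%N).
pose a m := (f m).1.2; pose L m := (f m).2.
have fn m : (f m).1.1 = m.
  elim: m => [|m IH]; first by rewrite f0.
  move: (fS m) IH; rewrite /step; case: (f m) => -[n b] l; case: (f m.+1) => -[n' b'] l' /=.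
  by case=> -> _ _ _ _ ->.
have aS m : [/\ logn 2 (a m.+1) = a m, (0 < a m.+1)%N, (L m <= a m.+1 < L m.+1)%N
    & exists2 k, (k < M (L m.+1))%N & ~ (S k (y (a m.+1)) <-> S k (e m))].
  move: (fS m) (fn m); rewrite /a /L /step.
  by case: (f m) => -[n b] l; case: (f m.+1) => -[n' b'] l' /= [_ ? ? ? ?] <-.
have LM m n : (m <= n)%N -> (L m <= L n)%N.
  move=> /subnK <-; elim: (n - m)%N => // k IH; apply: (leq_trans IH).
  by rewrite addSn; have [_ _ /andP[h1 h2] _] := aS (k + m)%N; rewrite ltnW// (leq_ltn_trans h1).
have Lge m : (m <= L m)%N.
  elim: m => // m IH; have [_ _ /andP[h1 h2] _] := aS m.
  by rewrite (leq_ltn_trans _ h2)// (leq_trans IH).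
have stable m k n : (k < M (L m))%N -> (m <= n)%N -> c k (y (a n)) = c k (y (a m)).
  move=> kM /subnK <-; elim: (n - m)%N => // j IH; rewrite -IH addSn.
  have [<- a0 /andP[La _] _] := aS (j + m)%N; apply: par => //.
  apply: (leq_trans kM); apply: Mle; apply: leq_trans La; apply: LM.
  exact: leq_addl.
have [//||w [Fw hw]] := lim (fun m => y (a m)).
  move=> i; exists (c i (y (a i.+1))); exists i.+1 => // n /= im; apply: stable => //.
  exact: leq_trans (Lge _) (MN _).
have [n en] := eF w Fw; have [_ _ _ [k kM kS]] := aS n.
have [N hN] := near_ex (filterI (hw k) (nbhs_infty_ge n.+1)).
move: hN => [SN nN]; apply: kS; rewrite en.
by rewrite -SN; apply: cS; rewrite (stable n.+1).
Qed.

Section lusin_novikov.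
Context (R : realType) (d : measure_display) (X : measurableType d).
Variables (mu : probability X R) (E : set (X * X)).
Variables (c : nat -> X * X -> nat) (S : nat -> set X).
Hypothesis mc : forall i k, measurable (c i @^-1` [set k]).
Hypothesis mS : forall i, measurable (S i).
Hypothesis S_sep : forall x y, x <> y -> exists i, S i x /\ ~ S i y.
Hypothesis cS : forall i x y z, c i (x, y) = c i (x, z) -> S i y <-> S i z.
Hypothesis E_lim : forall x z, (forall n, E (x, z n)) ->
  (forall i, exists k, \forall n \near \oo, c i (x, z n) = k) ->
  exists w, E (x, w) /\ forall i, \forall n \near \oo, S i (z n) <-> S i w.
Hypothesis E_countable : forall x, countable [set y | E (x, y)].
Variable a : nat -> set X.
Hypothesis ma : forall n, measurable (a n).
Hypothesis a_dense : forall A, measurable A -> forall e : R, 0 < e ->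
  exists n, Pr mu (A `+` a n) < e.
Local Notation pr := (Pr mu).

Lemma measurable_fun_neq (f g : X -> X) : measurable_fun setT f ->
  measurable_fun setT g -> measurable [set x | f x <> g x].
Proof.
move=> mf mg; have -> : [set x | f x <> g x] =
    \bigcup_i (f @^-1` S i `&` ~` (g @^-1` S i)).
  apply/seteqP; split=> x /= => [/S_sep[i [? ?]]|[i _ [Sf Sg] fg]]; first by exists i.
  by apply: Sg; rewrite /= -fg.
apply: bigcup_measurable => i _; apply: measurableI; last apply: measurableC;
  exact: preim_measurable.
Qed.

Definition level_measurable (v : X -> nat) := forall k, measurable (v @^-1` [set k]).

Lemma measurable_neq_level v w : level_measurable v -> level_measurable w ->
  measurable [set x | v x <> w x].
Proof.
move=> mv mw; have -> : [set x | v x <> w x] =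
    \bigcup_k (v @^-1` [set k] `&` ~` (w @^-1` [set k])).
  apply/seteqP; split=> x /= => [vw|[k _ [<- vw] h]]; last exact: vw.
  by exists (v x) => //; split => //= /esym.
by apply: bigcup_measurable => i _; apply: measurableI => //; exact: measurableC.
Qed.

(** Countably valued measurable functions form a separable space for convergence in measure: cut off
    the tail of values beyond some [K] and approximate the first [K] level sets by members of [a].
    Two functions sharing the approximants lose [e/2] in the tail and twice [e/4] over the
    levels. *)
Lemma level_code (e : R) : 0 < e -> exists code : (X -> nat) -> seq nat,
  forall v w, level_measurable v -> level_measurable w -> code v = code w ->
    pr [set x | v x <> w x] <= e.
Proof.
move=> e0.
pose tail v K := [set x : X | (K <= v x)%N].
have mtail v K : level_measurable v -> measurable (tail v K).
  move=> mv; have -> : tail v K = ~` \bigcup_(k < K) (v @^-1` [set k]).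
    apply/seteqP; split=> x /=; first by move=> h [k /= kK vk]; move: h; rewrite /tail /= vk leqNgt kK.
    by move=> h; rewrite /tail /= leqNgt; apply/negP => vK; apply: h; exists (v x).
  by apply: measurableC; exact: bigcup_measurable.
have /choice[code hc] : forall v, exists s, level_measurable v ->
    pr (tail v (size s)) <= e / 2 /\ forall k, (k < size s)%N ->
      pr (v @^-1` [set k] `+` a (nth 0%N s k)) <= e / 4 / (size s)%:R.
  move=> v; have [mv|] := pselect (level_measurable v); last by exists [::].
  have [K hK] : exists K, pr (tail v K) < e / 2.
    apply: (pr_bigcap_lim mu) => //; last by rewrite divr_gt0.
    - by move=> K; exact: mtail.
    - by move=> m n mn; apply/subsetPset => x; exact: leq_trans.
    - by rewrite -subset0 => x /(_ (v x).+1 I); rewrite /tail /= ltnn.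
  have /choice[l hl] : forall k, exists n, (0 < K)%N ->
      pr (v @^-1` [set k] `+` a n) < e / 4 / K%:R.
    move=> k; have [K0|] := boolP (0 < K)%N; last by exists 0%N.
    have [|n hn] := a_dense (mv k) (e := e / 4 / K%:R); last by exists n.
    by rewrite !divr_gt0// ltr0n.
  exists (mkseq l K) => _; rewrite size_mkseq; split=> [|k kK]; first exact: ltW.
  by rewrite nth_mkseq// ltW// hl// (leq_ltn_trans _ kK).
exists code => v w mv mw vw; set s := code v in vw.
have [h1 h2] := hc v mv; have [h3 h4] := hc w mw; rewrite -/s in h1 h2; rewrite -vw in h3 h4.
pose D k := v @^-1` [set k] `+` w @^-1` [set k].
have mD k : measurable (D k) by exact: measurableY.
apply: (@le_trans _ _ (pr (tail v (size s) `|` \big[setU/set0]_(k < size s) D k))).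
  apply: prS; [exact: measurable_neq_level|apply: measurableU; [exact: mtail|exact: bigsetU_measurable]|].
  move=> x /= vwx; have [h|h] := leqP (size s) (v x); [by left|right].
  rewrite -bigcup_mkord; exists (v x) => //; left; split => //= wv; exact: vwx.
apply: le_trans (prU _ (mtail _ _ mv) (bigsetU_measurable _ _)) _ => //.
rewrite [leRHS](splitr e); apply: lerD => //; apply: le_trans (pr_bigsetU _ _ mD) _.
apply: (@le_trans _ _ (\sum_(k < size s) e / 2 / (size s)%:R)).
  apply: ler_sum => k _.
  apply: (le_trans (prY_triangle mu (mv k) (ma (nth 0%N s k)) (mw k))).
  have := h2 k (ltn_ord k); have := h4 k (ltn_ord k); rewrite [X in pr X]setYC.
  have -> : e / 2 / (size s)%:R = e / 4 / (size s)%:R + e / 4 / (size s)%:R by rewrite -mulrDl; congr (_ / _); lra.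
  by move=> ? ?; rewrite lerD.
rewrite sumr_const card_ord; have [->|s0] := eqVneq (size s) 0%N; first by rewrite mulr0n divr_ge0// ltW.
by rewrite -[leLHS]mulr_natr divfK// pnatr_eq0.
Qed.


Definition piece : Type := ((X -> X) * set X)%type.

Definition good_piece (t : piece) := [/\ measurable_fun setT t.1,
  forall x, E (x, t.1 x) & measurable t.2].

(** The value 0 is kept for points off the domain: agreeing with a positive coordinate therefore
    forces membership in the domain. *)
Definition coord (t : piece) (i : nat) (x : X) : nat :=
  if `[< t.2 x >] then (c i (x, t.1 x)).+1 else 0%N.

Lemma coordE t i x : t.2 x -> coord t i x = (c i (x, t.1 x)).+1.
Proof. by move=> tx; rewrite /coord asboolT. Qed.

Lemma coord_gt0 t i x : coord t i x <> 0%N -> t.2 x.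
Proof. by rewrite /coord; case: asboolP. Qed.

Lemma coord_measurable t i : good_piece t -> level_measurable (coord t i).
Proof.
move=> [mt _ mB] k.
have -> : coord t i @^-1` [set k] = if k is k'.+1 then
    t.2 `&` (fun x => (x, t.1 x)) @^-1` (c i @^-1` [set k']) else ~` t.2.
  case: k => [|k]; apply/seteqP; split=> x; rewrite /= /coord; case: asboolP => //=.
    by move=> tx [<-].
  - by move=> tx [_ ->].
  - by move=> ntx [].
case: k => [|k]; first exact: measurableC.
apply: measurableI => //; apply: preim_measurable => //.
exact: measurable_fun_pair.
Qed.

Lemma piece_code : exists code : nat -> piece -> seq (seq nat),
  forall m s t, good_piece s -> good_piece t -> code m s = code m t ->
  pr (\bigcup_(i < m) [set x | coord s i x <> coord t i x]) <= (2 ^+ m)^-1.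
Proof.
have e0 m : 0 < (2 ^+ m)^-1 / m.+1%:R :> R by rewrite divr_gt0// invr_gt0 exprn_gt0.
have /choice[code hc] := fun m => level_code (e0 m).
exists (fun m t => mkseq (fun i => code m (coord t i)) m) => m s t gs gt st.
have ms i := coord_measurable i gs; have mt i := coord_measurable i gt.
have mD i : measurable [set x | coord s i x <> coord t i x] by exact: measurable_neq_level.
rewrite bigcup_mkord; apply: (le_trans (pr_bigsetU _ _ mD)).
apply: (@le_trans _ _ (\sum_(i < m) (2 ^+ m)^-1 / m.+1%:R)).
  apply: ler_sum => i _; apply: hc => //.
  by have := congr1 (nth [::] ^~ i) st; rewrite !nth_mkseq.
rewrite sumr_const card_ord -[leLHS]mulr_natr -mulrA ler_piMr ?invr_ge0 ?exprn_ge0//.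
by rewrite mulrC ler_pdivrMr// mul1r ler_nat.
Qed.

Definition separated (F : set piece) := forall s t, F s -> F t -> s <> t ->
  forall x, s.2 x -> t.2 x -> s.1 x <> t.1 x.

(* Otherwise some member would be a condensation point of condensation points
   for the codes, and a Cantor scheme of members would exist whose domains all
   contain a common point [x]; the class of [x] would then be uncountable. *)
Lemma separated_countable (F : set piece) (e : R) : 0 < e ->
  (forall t, F t -> good_piece t /\ e <= pr t.2) -> separated F -> countable F.
Proof.
move=> e0 FP sepF; apply: contrapT => ncF.
have gF t : F t -> good_piece t by move=> /FP[].
have [code hcode] := piece_code.
have cU (T : Type) (A B : set T) : countable A -> countable B -> countable (A `|` B).
  by move=> cA cB; rewrite -bigcup2E; apply: bigcup_countable => // -[|[|k]] _ /=.
pose fiber m s := [set t | F t /\ code m t = s].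
(* There are countably many codes, so discarding all members with a countable fibre costs countably
   many. Each remaining member shares each of its codes with uncountably many remaining ones. *)
pose bad := \bigcup_m \bigcup_(s in [set s | countable (fiber m s)]) fiber m s.
have cbad : countable bad.
  by apply: bigcup_countable => // m _; apply: bigcup_countable => // s.
pose Fs := F `\` bad.
have Fs_next t m U : Fs t -> countable U -> exists t', [/\ Fs t', ~ U t' & code m t' = code m t].
  move=> [Ft nbt] cU'; apply: contrapT => h; apply: nbt; exists m => //.
  exists (code m t) => //=; apply: (sub_countable _ (cU _ _ _ cU' cbad)).
  apply: subset_card_le => t' [Ft' tt']; have [Ut|nUt] := pselect (U t'); [by left|right].
  by apply: contrapT => nb; apply: h; exists t'.
have [t0 Ft0] : exists t, Fs t.
  apply: contrapT => h; apply: ncF; apply: (sub_countable _ cbad).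
  by apply: subset_card_le => t Ft; apply: contrapT => nb; apply: h; exists t.
(* Budget for the exceptional sets: [B1] and [B2] below will each have total measure at most
   [2 / 2^k0], and must not exhaust a domain of measure at least [e]. *)
have [k0 hk0] : exists k0, 4 / 2 ^+ k0 < e :> R.
  have e40 : 0 < e / 4 by rewrite divr_gt0.
  have [k hk] := ltr_add_invr e40; exists k; move: hk; rewrite add0r => hk.
  have : (2 ^+ k)^-1 < e / 4; last lra.
  apply: le_lt_trans hk; rewrite lef_pV2 ?posrE ?ltr0n ?exprn_gt0//.
  by rewrite -natrX ler_nat ltn_expl.
(* Common domain points whose two images are not told apart by the first [M] sets [S k]. For
   distinct members of a separated family these sets decrease to the empty set as [M] grows. *)
pose indist (f : nat -> piece) i j M := (f i).2 `&` (f j).2 `&`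
  \bigcap_(k < M) ~` ((f i).1 @^-1` S k `+` (f j).1 @^-1` S k).
pose Ind f n M := \bigcup_(j < n) \bigcup_(i < j) indist f i j M.
(* The first [n] values of [f] are the nodes built so far; [M] is a depth at which they are told
   apart off a set of measure at most [2^-(n+k0)], and at which the next node will copy the code of
   its parent. *)
pose inv (s : (nat -> piece) * nat * nat) := let: (f, n, M) := s in
  [/\ (0 < n)%N, forall i, (i < n)%N -> Fs (f i), (n + k0 <= M)%N,
      forall i j, (i < j)%N -> (j < n)%N -> f i <> f j &
      pr (Ind f n M) <= (2 ^+ (n + k0))^-1].
have mInd f n M : (forall i, (i < n)%N -> Fs (f i)) -> measurable (Ind f n M).
  move=> Ff; apply: bigcup_measurable => j /= jn; apply: bigcup_measurable => i /= ij.
  have [mi _ mBi] := gF _ (Ff i (ltn_trans ij jn)).1; have [mj _ mBj] := gF _ (Ff j jn).1.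
  apply: measurableI; first exact: measurableI.
  have [->|M0] := eqVneq M 0%N; first by rewrite bigcap_mkord big_ord0.
  apply: bigcap_measurable; first by exists 0%N; rewrite /= lt0n.
  move=> k _; apply: measurableC; apply: measurableY; exact: preim_measurable.
have indM f n : (forall i, (i < n)%N -> Fs (f i)) ->
    (forall i j, (i < j)%N -> (j < n)%N -> f i <> f j) ->
    forall M0, exists2 M, (M0 <= M)%N & pr (Ind f n M) <= (2 ^+ (n + k0))^-1.
  move=> Ff finj M0.
  have niI : nonincreasing_seq (fun M => Ind f n M).
    move=> M M' MM; apply/subsetPset => x [j jn [i ij [Bij h]]].
    exists j => //; exists i => //; split=> // k /= kM; apply: h => /=.
    exact: leq_trans kM MM.
  have [||M hM] := @pr_bigcap_lim _ _ _ mu (fun M => Ind f n M) (2 ^+ (n + k0))^-1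
      (fun M => mInd f n M Ff) niI.
  - rewrite -subset0 => x h; have [j jn [i ij _]] := h 0%N I.
    have key j' i' : (i' < j')%N -> (j' < n)%N -> exists M, ~ indist f i' j' M x.
      move=> ij' jn'; have [[Bi Bj]|nB] := pselect ((f i').2 x /\ (f j').2 x); last first.
        by exists 0%N => -[[]] ? ? _; apply: nB.
      have [k [Si Sj]] := S_sep (sepF _ _ (Ff i' (ltn_trans ij' jn')).1 (Ff j' jn').1
        (finj _ _ ij' jn') _ Bi Bj).
      exists k.+1 => -[_ /(_ k (ltnSn k))]; apply; by left.
    have /choice[Mf hMf] : forall p : nat * nat, exists M, (p.2 < p.1)%N -> (p.1 < n)%N ->
        ~ indist f p.2 p.1 M x.
      move=> [j' i'] /=; have [/andP[p1 p2]|np] := boolP ((i' < j')%N && (j' < n)%N).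
        by have [M hM] := key _ _ p1 p2; exists M.
      by exists 0%N => p1 p2; move: np; rewrite p1 p2.
    (* The sum serves as a common upper bound of finitely many thresholds. *)
    pose Mx := (\sum_(j' < n) \sum_(i' < n) Mf (val j', val i'))%N.
    have [j' /= jn' [i' /= ij' [Bij hk]]] := h Mx I.
    apply: (hMf (j', i')) => //; split=> // k /= kM; apply: hk => /=.
    apply: (leq_trans kM); rewrite /Mx (bigD1 (Ordinal jn'))//=.
    rewrite (bigD1 (Ordinal (ltn_trans ij' jn')))//= -addnA.
    exact: leq_addr.
  - by rewrite invr_gt0 exprn_gt0.
  exists (maxn M0 M); first exact: leq_maxl.
  apply: le_trans (ltW hM); apply: prS; [exact: mInd|exact: mInd|].
  by apply/subsetPset; apply: niI; exact: leq_maxr.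
pose step (s s' : (nat -> piece) * nat * nat) := inv s -> inv s' /\
  let: (f, n, M) := s in let: (f', n', M') := s' in
  [/\ n' = n.+1, (forall i, (i < n)%N -> f' i = f i), (M <= M')%N
    & code M (f' n) = code M (f (logn 2 n))].
have step_ex s : exists s', step s s'.
  have [invs|] := pselect (inv s); last by exists s.
  move: s invs => [[f n] M] [n0 Ff nM finj fInd].
  have [|t [Ft nt ct]] := @Fs_next (f (logn 2 n)) M [set f i | i in `I_n] _
      (card_le_trans (card_image_le _ _) (countableP _)).
    by apply: Ff; exact: ltn_logl.
  pose f' i := if i == n then t else f i.
  have f'n i : (i < n)%N -> f' i = f i by move=> iin; rewrite /f' ltn_eqF.
  have Ff' i : (i < n.+1)%N -> Fs (f' i).
    by rewrite ltnS leq_eqVlt => /predU1P[->|iin]; [rewrite /f' eqxx|rewrite f'n//; exact: Ff].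
  have f'inj i j : (i < j)%N -> (j < n.+1)%N -> f' i <> f' j.
    move=> ij; rewrite ltnS leq_eqVlt => /predU1P[jn|jn]; last by rewrite !f'n// ?(ltn_trans ij)//; exact: finj.
    rewrite {2}/f' jn eqxx f'n -?jn// => fit; apply: nt.
    by exists i => //=; rewrite -jn.
  have [M' MM' hM'] := indM f' n.+1 Ff' f'inj (maxn M (n.+1 + k0)).
  exists (f', n.+1, M') => _; split; split=> //.
  - by rewrite (leq_trans _ MM')// leq_maxr.
  - by rewrite (leq_trans _ MM')// leq_maxl.
  - by rewrite /f' eqxx.
have [M1 hM1 hI1] := indM (fun=> t0) 1%N (fun _ _ => Ft0)
  (fun i j ij => ltac:(by rewrite ltnS leqn0 => /eqP j0; rewrite j0 in ij)) (1 + k0)%N.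
have [s [s0 sS]] := dependent_choice_ex step_ex (fun=> t0, 1%N, M1).
have invs n : inv (s n).
  elim: n => [|n IH]; last by have [] := sS n IH.
  rewrite s0; split=> // i j ij; rewrite ltnS leqn0 => /eqP j0.
  by rewrite j0 in ij.
pose f n := (s n).1.1; pose M n := (s n).2.
have sn n : (s n).1.2 = n.+1.
  elim: n => [|n IH]; first by rewrite s0.
  have [_] := sS n (invs n); move: IH; case: (s n) => -[g m] K /= ->.
  by case: (s n.+1) => -[g' m'] K' [->].
have sE n : s n = (f n, n.+1, M n).
  by rewrite /f /M -(sn n); case: (s n) => -[].
have iE n := invs n; have hE n := (sS n (invs n)).2.
have {}iE n : [/\ forall i, (i < n.+1)%N -> Fs (f n i), (n.+1 + k0 <= M n)%N &
    pr (Ind (f n) n.+1 (M n)) <= (2 ^+ (n.+1 + k0))^-1].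
  by have := invs n; rewrite sE => -[].
have {}hE n : [/\ forall i, (i < n.+1)%N -> f n.+1 i = f n i, (M n <= M n.+1)%N
    & code (M n) (f n.+1 n.+1) = code (M n) (f n (logn 2 n.+1))].
  by have := hE n; rewrite !sE => -[].
pose t n := f n n.
have ft n i : (i <= n)%N -> f n i = t i.
  elim: n => [|n IH]; first by rewrite leqn0 => /eqP ->.
  rewrite leq_eqVlt => /predU1P[->//|]; rewrite ltnS => iin.
  by have [h _ _] := hE n; rewrite (h i iin); exact: IH.
have Ft n : Fs (t n) by have [h _ _] := iE n; exact: (h n (ltnSn n)).
have gt n := gF _ (Ft n).1.
have ctn n : code (M n) (t n.+1) = code (M n) (t (logn 2 n.+1)).
  by have [_ _ ] := hE n; rewrite [f n _]ft// -ltnS ltn_logl.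
(* [B1 n] is where node [n+1] departs from its parent, and [B2 n] is where two of the first [n+1]
   nodes are still confused. Off all of them, the images of one point form a Cantor scheme. *)
pose B1 n := \bigcup_(i < M n) [set x | coord (t n.+1) i x <> coord (t (logn 2 n.+1)) i x].
pose B2 n := Ind (f n) n.+1 (M n).
have mB1 n : measurable (B1 n).
  apply: bigcup_measurable => i _; apply: measurable_neq_level; exact: coord_measurable.
have mB2 n : measurable (B2 n) by have [h _ _] := iE n; exact: mInd.
have pow n : (2 ^+ (M n))^-1 <= (2 ^+ k0)^-1 / 2 ^+ n :> R.
  rewrite -invfM -exprD lef_pV2 ?posrE ?exprn_gt0// ler_weXn2l ?ler1n//.
  by have [_ + _] := iE n; apply: leq_trans; rewrite addnC leq_add2r.
have pB1 : pr (\bigcup_n B1 n) <= 2 / 2 ^+ k0.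
  apply: pr_bigcup_le => // n; apply: le_trans (pow n); exact: hcode.
have pB2 : pr (\bigcup_n B2 n) <= 2 / 2 ^+ k0.
  apply: pr_bigcup_le => // n; have [_ _ h] := iE n; apply: (le_trans h).
  rewrite -invfM -exprD lef_pV2 ?posrE ?exprn_gt0// ler_weXn2l ?ler1n//.
  by rewrite addnC leq_add2r.
have mU1 : measurable (\bigcup_n B1 n) by exact: bigcup_measurable.
have mU2 : measurable (\bigcup_n B2 n) by exact: bigcup_measurable.
have [x [tx nB]] : exists x, (t 0%N).2 x /\ ~ (\bigcup_n B1 n `|` \bigcup_n B2 n) x.
  apply: contrapT => h; have [_ et0] := FP _ (Ft 0%N).1.
  have : pr (t 0%N).2 <= pr (\bigcup_n B1 n `|` \bigcup_n B2 n).
    apply: prS; [by have [] := gt 0%N|exact: measurableU|].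
    by move=> x tx; apply: contrapT => nB; apply: h; exists x.
  have := prU mu mU1 mU2; lra.
have par N i : (0 < N)%N -> (i < M N.-1)%N -> coord (t N) i x = coord (t (logn 2 N)) i x.
  case: N => // n _ iM; apply: contrapT => h; apply: nB; left; exists n => //.
  by exists i.
have Mpos n : (0 < M n)%N by have [_ + _] := iE n; apply: leq_trans; rewrite addSn.
(* Domain membership descends the tree from the root [t 0]: coordinate 0 of a node equals that of
   its parent, which is positive. *)
have tBx N : (t N).2 x.
  elim/ltn_ind: N => -[//|N] IH; have /IH : (logn 2 N.+1 < N.+1)%N by exact: ltn_logl.
  move=> h; apply: (@coord_gt0 _ 0%N); rewrite par ?Mpos//= coordE//.
have Mmono m n : (m <= n)%N -> (M m <= M n)%N.
  move=> /subnK <-; elim: (n - m)%N => // k IH; apply: (leq_trans IH).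
  by rewrite addSn; have [_ ->] := hE (k + m)%N.
have cE i u v : c i (x, u) = c i (x, v) -> S i u <-> S i v by exact: cS.
(* The depth is shifted by one because node [N] was chosen when the depth was [M (N-1)]. *)
apply: (@cantor_scheme_uncountable _ [set y | E (x, y)] (fun i y => c i (x, y)) S
   (fun N => (t N).1 x) (fun N => M N.-1) cE).
- by move=> z; exact: E_lim.
- by move=> N; have [_ h _] := gt N; exact: h.
- move=> m n mn; by apply: Mmono; case: m n mn => [|m] [|n].
- move=> [//|N] /=; have [_ + _] := iE N; apply: leq_trans; exact: leq_addr.
- by move=> N i N0 iM; have := par N i N0 iM; rewrite !coordE// => -[].
- move=> i j [//|N] ij; rewrite ltnS => jN; apply: contrapT => h; apply: nB; right.
  exists N => //; exists j; first by rewrite /= ltnS.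
  exists i => //; rewrite /indist !ft ?(leq_trans (ltnW ij))//.
  split; first by split; exact: tBx.
  move=> k /= kM; rewrite /setY /= => Sk; apply: h; exists k => //=; tauto.
- exact: E_countable.
Qed.


(** For each [k] take a maximal separated family of restrictions of maps of [G] to sets of measure
    at least [1/(k+1)]; it is countable. If [f] differed from all the maps obtained on a non-null
    set [N], then [(f, N)] would enlarge the family for some [k]. The class [G] is kept general so
    that the covering maps stay inside it. *)
Lemma maps_cover (G : set (X -> X)) (i0 : X -> X) : G i0 ->
  (forall f, G f -> measurable_fun setT f /\ forall x, E (x, f x)) ->
  exists i_ : nat -> X -> X, (forall n, G (i_ n)) /\
    forall f, G f -> {ae mu, forall x, exists n, f x = i_ n x}.
Proof.
move=> Gi0 GP.
pose P (k : nat) (F : set piece) := (forall t, F t -> [/\ G t.1, measurable t.2 &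
  k.+1%:R^-1 <= pr t.2]) /\ separated F.
have /choice[F hF] : forall k, exists F, P k F /\ forall F', F `<` F' -> ~ P k F'.
  move=> k; apply: Zorn_bigcup => C CP totC; split.
    by move=> t [F /CP[h _]]; exact: h.
  move=> s t [F CF Fs] [F' CF' Ft] st.
  have [/(_ _ Fs) F's|/(_ _ Ft) Ft'] := totC _ _ CF CF'.
    by have [_] := CP _ CF'; apply.
  by have [_] := CP _ CF; apply.
have cF k : countable (F k).
  have [[h sep] _] := hF k; apply: (@separated_countable _ k.+1%:R^-1) => //.
  by move=> t /h[/GP[? ?] ? ?].
pose I := i0 |` \bigcup_k [set t.1 | t in F k].
have cI : countable I.
  rewrite /I -bigcup2E; apply: bigcup_countable => // -[|[|k]] _ //=.
  apply: bigcup_countable => // k _; apply: (card_le_trans (card_image_le _ _)); exact: cF.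
have [i_ [Ii iI]] := countable_enum cI (or_introl erefl).
have Gi n : G (i_ n).
  by have [->//|[k _ [t Ft <-]]] := Ii n; have [[h _] _] := hF k; have [] := h _ Ft.
exists i_; split=> // f Gf.
pose N := \bigcap_n [set x | f x <> i_ n x].
have mN : measurable N.
  apply: bigcapT_measurable => n; apply: measurable_fun_neq; first by have [] := GP _ Gf.
  by have [] := GP _ (Gi n).
have N0 : pr N = 0.
  apply: contrapT => /eqP Nn0; have N0 : 0 < pr N by rewrite lt_neqAle eq_sym Nn0 pr_ge0.
  have [k hk] := ltr_add_invr N0; rewrite add0r in hk.
  have [[h sep] maxF] := hF k.
  have fN t x : F k t -> t.2 x -> N x -> f x <> t.1 x.
    move=> Ft _ Nx; have [|n <-] := iI t.1; last exact: Nx.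
    by right; exists k => //; exists t.
  apply: (maxF ((f, N) |` F k)).
    split; first by move=> t; right.
    move=> /(_ _ (or_introl erefl)) FfN; have N_ : N = set0.
      by rewrite -subset0 => x Nx; exact: (fN _ _ FfN Nx Nx).
    by move: N0; rewrite N_ pr0 ltxx.
  split=> [t [->|/h//]|s t]; first by split => //; exact: ltW.
  move=> [->|Fs] [->|Ft] st //= x; last exact: sep.
    by move=> Nx tx; exact: fN Ft tx Nx.
  by move=> sx Nx; apply/nesym; exact: fN Fs sx Nx.
have := pr0_ae mN N0; apply: filterS => x nN; apply: contrapT => h; apply: nN => n _ /= fi.
by apply: h; exists n.
Qed.

End lusin_novikov.

Definition involution_in d (X : measurableType d) (E : set (X * X)) (i : X -> X) :=
  [/\ measurable_fun setT i, forall x, i (i x) = x & forall x, E (x, i x)].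

Lemma glue_maps d (X : measurableType d) (Q : nat -> set X) (f : nat -> X -> X) :
  (forall n, measurable (Q n)) -> (forall n, measurable_fun setT (f n)) ->
  (forall m n x, Q m x -> Q n x -> m = n) ->
  exists s : X -> X, [/\ measurable_fun setT s, forall n x, Q n x -> s x = f n x
    & forall x, (forall n, ~ Q n x) -> s x = x].
Proof.
move=> mQ mf dQ.
have /choice[s hs] : forall x, exists y, (forall n, Q n x -> y = f n x) /\
    ((forall n, ~ Q n x) -> y = x).
  move=> x; have [[n Qn]|h] := pselect (exists n, Q n x).
    by exists (f n x); split=> [m Qm|/(_ _ Qn)//]; rewrite (dQ _ _ _ Qn Qm).
  by exists x; split=> // n Qn; exfalso; apply: h; exists n.
exists s; split=> [_ A mA|n x Qx|x nQ]; [|by have [+ _] := hs x; apply|by have [_] := hs x; apply].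
rewrite setTI; have -> : s @^-1` A = (\bigcup_n (Q n `&` f n @^-1` A)) `|`
    (~` (\bigcup_n Q n) `&` A).
  apply/seteqP; split=> [x /= Asx|x [[n _ [Qx]]|[nQ]]]; last 2 first.
  - by have [h _] := hs x; rewrite /= (h _ Qx).
  - by have [_ /= ->] := hs x => // n Qn; apply: nQ; exists n.
  have [[n Qn]|h] := pselect (exists n, Q n x).
    by left; exists n => //; split=> //=; have [<-] := hs x.
  have nQ n : ~ Q n x by move=> Qn; apply: h; exists n.
  by right; split=> [[n _ /nQ]//|]; have [_ <-] := hs x.
apply: measurableU.
  by apply: bigcup_measurable => n _; apply: measurableI => //; exact: preim_measurable.
by apply: measurableI => //; apply: measurableC; exact: bigcup_measurable.
Qed.

Lemma glue_involutions d (X : measurableType d) (E : set (X * X)) (Q : nat -> set X)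
    (f : nat -> X -> X) :
  (forall n, measurable (Q n)) -> (forall n, involution_in E (f n)) ->
  (forall m n x, Q m x -> Q n x -> m = n) -> (forall n x, Q n x -> Q n (f n x)) ->
  (forall x, E (x, x)) ->
  exists s, [/\ involution_in E s, forall n x, Q n x -> s x = f n x
    & forall x, (forall n, ~ Q n x) -> s x = x].
Proof.
move=> mQ If dQ fQ Exx.
have [|s [ms sQ sN]] := glue_maps mQ _ dQ (f := f); first by move=> n; have [] := If n.
exists s; split=> //; split=> // x; (have [[n Qn]|h] := pselect (exists n, Q n x);
  last have nQ n : ~ Q n x by move=> Qn; apply: h; exists n).
- by rewrite (sQ _ _ Qn) (sQ _ _ (fQ _ _ Qn)); have [_ ->] := If n.
- by rewrite !sN.
- by rewrite (sQ _ _ Qn); have [_ _] := If n.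
- by rewrite sN.
Qed.

(* Every partial automorphism is cut, along the sets [S j] and [~` S j], into
   pieces that are exchanged with their images by an involution. *)
Theorem involutions_cover (R : realType) d (X : measurableType d)
    (mu : probability X R) (E : set (X * X)) :
  standard_borel R X -> nonsingular_equivalence mu E ->
  exists i_ : nat -> X -> X, [/\ forall n, involution_in E (i_ n),
    forall f g : X -> X, measurable_fun setT f -> measurable_fun setT g ->
      {ae mu, forall x, g (f x) = x /\ E (x, f x)} ->
      {ae mu, forall x, exists n, f x = i_ n x}
    & forall f g : X -> X, measurable_fun setT f -> measurable_fun setT g ->
      measurable [set x | f x <> g x]].
Proof.
move=> sX [[Er Es Et] mE cE nsE].
have [x0 _] : exists x : X, True.
  apply: contrapT => nX; have : mu setT = 0%E.
    have -> : [set: X] = set0 by rewrite -subset0 => x _; apply: nX; exists x.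
    by rewrite measure0.
  by rewrite probability_setT => /eqP; rewrite onee_eq0.
have [c [S [[mc mS] Ssep genS cS lim]]] := standard_borel_coding x0 sX mE.
have [a [ma a_dense]] := approx_dense mu mS genS.
have Iid : involution_in E id by split=> // x; exact: Er.
have [i_ [Ii i_cov]] := maps_cover mc mS Ssep cS lim cE ma a_dense (G := involution_in E) Iid
   (fun f If => let: And3 mf _ Ef := If in conj mf Ef).
have mneq := measurable_fun_neq mS Ssep.
exists i_; split=> // f g mf mg fg.
have mpair (u v : X -> X) : measurable_fun setT u -> measurable_fun setT v ->
    measurable [set x | E (u x, v x)].
  by move=> mu' mv; apply: (preim_measurable (f := fun x => (u x, v x))) => //; exact: measurable_fun_pair.
have mgf : measurable_fun setT (g \o f) by exact: measurableT_comp.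
have mfg : measurable_fun setT (f \o g) by exact: measurableT_comp.
pose Q0 j := S j `&` ~` (f @^-1` S j) `&` ~` [set x | (g \o f) x <> id x] `&` [set x | E (x, f x)].
pose Q1 j := ~` S j `&` (g @^-1` S j) `&` ~` [set x | (f \o g) x <> id x] `&` [set x | E (g x, x)].
have mQ0 j : measurable (Q0 j).
  apply: measurableI; last exact: (mpair id).
  apply: measurableI; last by apply: measurableC; exact: mneq.
  by apply: measurableI => //; apply: measurableC; exact: preim_measurable.
have mQ1 j : measurable (Q1 j).
  apply: measurableI; last exact: (mpair _ id).
  apply: measurableI; last by apply: measurableC; exact: mneq.
  by apply: measurableI => //; [exact: measurableC|exact: preim_measurable].
have Q01 j x : Q0 j x -> Q1 j (f x) /\ g (f x) = x.
  move=> [[[Sx nSf] /contrapT/= gfx] Ef]; split=> //.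
  by split; rewrite /= gfx//; split=> //=; split=> //=; rewrite gfx.
have Q10 j x : Q1 j x -> Q0 j (g x) /\ f (g x) = x.
  move=> [[[Sx nSf] /contrapT/= gfx] Ef]; split=> //.
  by split; rewrite /= gfx//; split=> //=; split=> //=; rewrite gfx.
have /choice[s hs] : forall j, exists s, involution_in E s /\ forall x, Q0 j x -> s x = f x.
  move=> j; pose Q n := if n is 0 then Q0 j else if n is 1 then Q1 j else set0.
  pose h n := if n is 0 then f else g.
  have [|||s [ms sQ sN]] := @glue_maps _ _ Q h.
  - by move=> [|[|n]] /=.
  - by case.
  - by move=> [|[|m]] [|[|n]]//= x [[[? ?] ?] ?] [[[? ?] ?] ?].
  exists s; split; last by move=> x /(sQ 0%N).
  split=> // x; have [Q0x|nQ0] := pselect (Q0 j x).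
  - by have [Q1x gf] := Q01 _ _ Q0x; rewrite (sQ 0%N _ Q0x) (sQ 1%N _ Q1x).
  - have [Q1x|nQ1] := pselect (Q1 j x).
      by have [Q0x gf] := Q10 _ _ Q1x; rewrite (sQ 1%N _ Q1x) (sQ 0%N _ Q0x).
    by rewrite !sN//; case=> [|[|n]].
  - by rewrite (sQ 0%N _ Q0x); have [] := Q0x.
  - have [Q1x|nQ1] := pselect (Q1 j x).
      by rewrite (sQ 1%N _ Q1x); have [_ ?] := Q1x; exact: Es.
    by rewrite sN//; case=> [|[|n]].
have h1 : {ae mu, forall x, forall j, exists n, s j x = i_ n x}.
  by apply/ae_foralln => j; apply: i_cov; have [] := hs j.
have h2 := i_cov id Iid.
apply: filterS3 fg h1 h2 => x [gfx Efx] h1x [n2 h2x].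
(* Fixed points of [f] are covered through the identity; a moved point is separated from its image
   by some [S j], so the swap [s j] agrees with [f] there. *)
have [fx|/nesym/Ssep[j [Sx nSf]]] := pselect (f x = x); first by exists n2; rewrite fx.
have [n hn] := h1x j; exists n; rewrite -hn; symmetry; have [_] := hs j; apply.
by split=> //; split=> //=.
Qed.

(** * Densities of involutions *)

Section density.
Context (R : realType) (d : measure_display) (X : measurableType d).
Variables (mu : probability X R) (E : set (X * X)).
Hypothesis nsE : nonsingular_equivalence mu E.
Local Notation pr := (Pr mu).

Lemma involution_ae i (P : X -> Prop) : involution_in E i ->
  {ae mu, forall x, P x} -> {ae mu, forall x, P (i x)}.
Proof.
move=> [_ _ Ei]; have [[_ Es _] _ _ ns] := nsE; rewrite /almost_everywhere /=.
move=> /ns; apply: negligibleS => x /= nP; exists (i x) => //.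
exact: Es.
Qed.

Lemma involution_density i : involution_in E i -> exists D : X -> R,
  [/\ measurable_fun setT D, forall x, 0 < D x &
    forall (A : set X) (f : X -> \bar R), measurable A -> measurable_fun setT f ->
      (forall x, 0 <= f x)%E ->
      (\int[mu]_(x in i @^-1` A) f x = \int[mu]_(x in A) (f (i x) * (D x)%:E))%E].
Proof.
move=> Ii; have [mi ii Ei] := Ii.
pose im : {mfun X >-> X} := HB.pack i (isMeasurableFun.Build _ _ _ _ _ mi).
pose nu : {finite_measure set X -> \bar R} := distribution mu im.
have numu : nu `<< mu.
  apply/null_content_dominatesP => A mA A0.
  have miA : measurable (i @^-1` A) by exact: preim_measurable.
  have /(involution_ae Ii) : {ae mu, forall x, ~ A x} by apply: pr0_ae => //; rewrite /Pr A0.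
  by move=> /(ae_pr0 miA) h; change (mu (i @^-1` A) = 0%E); rewrite (prE mu miA) h.
pose g := Radon_Nikodym_SigmaFinite.f nu mu.
have g0 := Radon_Nikodym_SigmaFinite.f_ge0 numu.
have gfin := Radon_Nikodym_SigmaFinite.f_fin_num numu.
have mg : measurable_fun setT g.
  exact: measurable_int (Radon_Nikodym_SigmaFinite.f_integrable numu).
have change A f : measurable A -> measurable_fun setT f -> (forall x, 0 <= f x)%E ->
    (\int[mu]_(x in i @^-1` A) f x = \int[mu]_(x in A) (f (i x) * g x))%E.
  move=> mA mf f0; have mfi : measurable_fun setT (f \o i) by exact: measurableT_comp.
  rewrite (Radon_Nikodym_SigmaFinite.change_of_variables numu (f := f \o i))//; last 2 first.
    by move=> x; exact: f0.
    exact: measurable_funTS.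
  rewrite [RHS]ge0_integral_pushforward//; last 2 first.
    exact: measurable_funTS.
    by move=> x _ /=; exact: f0.
  by apply: eq_integral => x _ /=; rewrite ii.
(* Integrating 1 shows that the preimage of [N] is null; the involution respects null sets, so [N]
   is null too. *)
pose N := [set x | g x = 0%E].
have mN : measurable N by have := mg measurableT [set 0%E] (emeasurable_set1 _); rewrite setTI.
have N0 : {ae mu, forall x, ~ N x}.
  have := change N (cst 1%E) mN (measurable_cst _) (fun=> lee01).
  rewrite [RHS]integral0_eq; last by move=> x; rewrite /N /= => ->; rewrite mule0.
  have miN : measurable (i @^-1` N) by exact: preim_measurable.
  rewrite integral_cst// mul1e => iN0.
  have : {ae mu, forall x, ~ (i @^-1` N) x} by apply: pr0_ae => //; rewrite /Pr iN0.
  by move=> /(involution_ae Ii); apply: filterS => x /=; rewrite ii.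
(* The value 1 on the null set [N] makes the density positive everywhere, so that its logarithm can
   be taken. *)
pose D x := if g x == 0%E then 1 else fine (g x).
have mD : measurable_fun setT D.
  apply: measurable_fun_ifT => //; last exact: measurableT_comp.
  apply: (measurable_fun_bool true); rewrite setTI.
  have -> : (fun x => g x == 0%E) @^-1` [set true] = N by apply/seteqP; split=> x /= /eqP.
  exact: mN.
exists D; split=> // [x|A f mA mf f0].
  rewrite /D; case: eqVneq => // gx0; rewrite fine_gt0//.
  by rewrite lt0e gx0 g0 /= ltey_eq gfin.
rewrite change//; apply: ge0_ae_eq_integral => //.
- apply: emeasurable_funM; last exact: measurable_funTS.
  by apply: measurable_funTS; exact: measurableT_comp.
- apply: emeasurable_funM; first by apply: measurable_funTS; exact: measurableT_comp.
  by apply: measurable_funTS; exact/measurable_EFinP.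
- by move=> x _; rewrite mule_ge0.
- move=> x _; rewrite mule_ge0// lee_fin /D; case: ifP => // _.
  by rewrite fine_ge0.
apply: filterS N0 => x Nx _; rewrite /D ifF; last by apply/eqP.
by rewrite fineK.
Qed.

Lemma density_pr i (D : X -> R) : involution_in E i ->
  (forall (A : set X) (f : X -> \bar R), measurable A -> measurable_fun setT f ->
      (forall x, 0 <= f x)%E ->
      (\int[mu]_(x in i @^-1` A) f x = \int[mu]_(x in A) (f (i x) * (D x)%:E))%E) ->
  forall A : set X, measurable A -> (\int[mu]_(x in A) (D x)%:E = (pr (i @^-1` A))%:E)%E.
Proof.
move=> [mi _ _] change A mA.
have := change A (cst 1%E) mA (measurable_cst _) (fun=> lee01).
have miA : measurable (i @^-1` A) by exact: preim_measurable.
rewrite integral_cst// mul1e => h; rewrite -(prE mu miA); symmetry; apply: (etrans h).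
by apply: eq_integral => x _; rewrite mul1e.
Qed.

Lemma density_le i (D : X -> R) (C : R) : measurable_fun setT D -> (forall x, 0 < D x) ->
  (forall A : set X, measurable A -> (\int[mu]_(x in A) (D x)%:E = (pr (i @^-1` A))%:E)%E) ->
  forall A : set X, measurable A -> (forall x, A x -> D x <= C) ->
  pr (i @^-1` A) <= C * pr A.
Proof.
move=> mD D0 prD A mA AC; rewrite -lee_fin -prD// EFinM -prE// -integral_cst//.
apply: ge0_le_integral => //.
- by move=> x _; rewrite lee_fin ltW.
- by apply: measurable_funTS; exact/measurable_EFinP.
Qed.

Lemma integral_ub_ae (D : X -> R) (C : R) : measurable_fun setT D -> (forall x, 0 <= D x) ->
  (forall A : set X, measurable A -> (\int[mu]_(x in A) (D x)%:E <= (C * pr A)%:E)%E) ->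
  {ae mu, forall x, D x <= C}.
Proof.
move=> mD D0 hC.
pose F k := [set x | C + k.+1%:R^-1 <= D x].
have mF k : measurable (F k).
  apply: (boolset_measurable (b := fun x => C + k.+1%:R^-1 <= D x)).
  exact: measurable_fun_ler.
have F0 k : pr (F k) = 0.
  have k0 : 0 < k.+1%:R^-1 :> R by rewrite invr_gt0.
  have : (C + k.+1%:R^-1) * pr (F k) <= C * pr (F k).
    rewrite -lee_fin; apply: le_trans (hC _ (mF k)); rewrite -integral_cst_pr//.
    have [C0|C0] := leP 0 (C + k.+1%:R^-1).
      by apply: ge0_le_integral => //; apply: measurable_funTS; exact/measurable_EFinP.
    rewrite integral_cst_pr//; apply: (@le_trans _ _ 0%E).
      by rewrite lee_fin; apply: mulr_le0_ge0; [exact: ltW|exact: pr_ge0].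
    by apply: integral_ge0 => x _; rewrite lee_fin.
  rewrite mulrDl gerDl => h; apply/le_anti; rewrite pr_ge0 andbT.
  by rewrite -(pmulr_rle0 _ k0).
have : {ae mu, forall x, forall k, ~ F k x}.
  by apply/ae_foralln => k; exact: pr0_ae.
apply: filterS => x nF; rewrite leNgt; apply/negP => Ch.
have : 0 < D x - C by rewrite subr_gt0.
move=> /ltr_add_invr[k]; rewrite add0r ltrBrDl => /ltW hk; exact: (nF k).
Qed.

Lemma integral_lb_ae (D : X -> R) (c : R) : measurable_fun setT D -> (forall x, 0 <= D x) ->
  (forall A : set X, measurable A -> ((c * pr A)%:E <= \int[mu]_(x in A) (D x)%:E)%E) ->
  {ae mu, forall x, c <= D x}.
Proof.
move=> mD D0 hc.
pose F k := [set x | D x <= c - k.+1%:R^-1].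
have mF k : measurable (F k).
  apply: (boolset_measurable (b := fun x => D x <= c - k.+1%:R^-1)).
  exact: measurable_fun_ler.
have F0 k : pr (F k) = 0.
  have k0 : 0 < k.+1%:R^-1 :> R by rewrite invr_gt0.
  have : c * pr (F k) <= (c - k.+1%:R^-1) * pr (F k).
    rewrite -lee_fin; apply: le_trans (hc _ (mF k)) _; rewrite -integral_cst_pr//.
    apply: ge0_le_integral => //; do ?[by apply: measurable_funTS; exact/measurable_EFinP].
    by move=> x Fx; rewrite lee_fin.
  rewrite mulrBl lerBrDl gerDr => h; apply/le_anti; rewrite pr_ge0 andbT.
  by rewrite -(pmulr_rle0 _ k0).
have : {ae mu, forall x, forall k, ~ F k x}.
  by apply/ae_foralln => k; exact: pr0_ae.
apply: filterS => x nF; rewrite leNgt; apply/negP => Ch.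
have : 0 < c - D x by rewrite subr_gt0.
move=> /ltr_add_invr[k]; rewrite add0r => /ltW hk; apply: (nF k).
by rewrite /F /= lerBrDr addrC -lerBrDr.
Qed.

(** The pieces are disjoint and invariant, so their bounds add up to [C]; the extra 1 accounts for
    the points that [s] leaves fixed. *)
Lemma glue_bounded (Q : nat -> set X) (f : nat -> X -> X) (s : X -> X) (C : R) : 0 <= C ->
  (forall n, measurable (Q n)) -> (forall n, involution_in E (f n)) ->
  (forall m n x, Q m x -> Q n x -> m = n) -> (forall n x, Q n x -> Q n (f n x)) ->
  involution_in E s -> (forall n x, Q n x -> s x = f n x) ->
  (forall x, (forall n, ~ Q n x) -> s x = x) ->
  (forall n (A : set X), measurable A -> A `<=` Q n -> pr (f n @^-1` A) <= C * pr A) ->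
  forall A : set X, measurable A -> pr (s @^-1` A) <= (C + 1) * pr A.
Proof.
move=> C0 mQ If dQ fQ [ms _ _] sQ sN fC A mA.
have mQA n : measurable (Q n `&` A) by exact: measurableI.
have mfQA n : measurable (f n @^-1` (Q n `&` A)).
  by apply: preim_measurable => //; have [] := If n.
pose U := \bigcup_n f n @^-1` (Q n `&` A).
have mU : measurable U by exact: bigcup_measurable.
have sub : s @^-1` A `<=` U `|` A.
  move=> x /= Asx; have [[n Qn]|h] := pselect (exists n, Q n x).
    by left; exists n => //; split; [exact: fQ|rewrite -(sQ _ _ Qn)].
  by right; rewrite -(sN x)// => n Qn; apply: h; exists n.
apply: le_trans (prS mu (preim_measurable ms mA) (measurableU _ _ mU mA) sub) _.
rewrite mulrDl mul1r; apply: le_trans (prU mu mU mA) _; rewrite lerD2r.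
rewrite -lee_fin EFinM -!prE// /U.
have fQ' n x : Q n (f n x) -> Q n x by move=> /fQ; have [_ -> _] := If n.
rewrite measure_semi_bigcup//; last first.
  by move=> m n _ _ [x /= [[/fQ' Qm _] [/fQ' Qn _]]]; exact: dQ Qm Qn.
apply: (@le_trans _ _ (\sum_(0 <= n <oo) (C%:E * mu (Q n `&` A))))%E.
  apply: lee_nneseries => n _ //.
  by have := fC n _ (mQA n) (@subIsetl _ _ _); rewrite -lee_fin EFinM -!prE.
rewrite nneseriesZl//.
rewrite lee_wpmul2l ?lee_fin//.
rewrite -measure_semi_bigcup//; last 2 first.
- by move=> m n _ _ [x [[Qm _] [Qn _]]]; exact: dQ Qm Qn.
- exact: bigcup_measurable.
apply: le_measure; rewrite ?inE//; first exact: bigcup_measurable.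
by move=> x [n _ []].
Qed.

End density.

(* [height n] is the logarithmic Radon-Nikodym derivative of [mu \o ivl n]. *)
Record involution_system (R : realType) d (X : measurableType d)
    (mu : probability X R) (E : set (X * X)) := InvolutionSystem {
  ivl : nat -> X -> X;
  height : nat -> X -> R;
  ivl_bound : nat -> R;
  ivlP : forall n, involution_in E (ivl n);
  height_measurable : forall n, measurable_fun setT (height n);
  ivl_bound_ge1 : forall n, 1 <= ivl_bound n;
  ivl_bounded : forall n (A : set X), measurable A ->
    Pr mu (ivl n @^-1` A) <= ivl_bound n * Pr mu A;
  ivl_change : forall n (A : set X) (f : X -> \bar R), measurable A ->
    measurable_fun setT f -> (forall x, 0 <= f x)%E ->
    (\int[mu]_(x in ivl n @^-1` A) f x =
     \int[mu]_(x in A) (f (ivl n x) * (expR (height n x))%:E))%E;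
  ivl_cover : forall f g : X -> X, measurable_fun setT f -> measurable_fun setT g ->
    {ae mu, forall x, g (f x) = x /\ E (x, f x)} ->
    {ae mu, forall x, exists n, f x = ivl n x};
  neq_measurable : forall f g : X -> X, measurable_fun setT f ->
    measurable_fun setT g -> measurable [set x | f x <> g x]
}.

(** A covering involution need not be bounded. The set [Q n k], where its density lies in
    [[1/(k+1), k+1]] both at [x] and at the image of [x], is invariant; restricting to it and fixing
    the other points gives a bounded involution. The sets [Q n k] exhaust [X] as [k] varies, so
    covering survives. *)
Lemma involution_system_exists (R : realType) d (X : measurableType d)
    (mu : probability X R) (E : set (X * X)) :
  standard_borel R X -> nonsingular_equivalence mu E ->
  exists s : involution_system mu E, True.
Proof.
move=> sX nsE; have [[Er Es Et] mE cE _] := nsE.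
have [i_ [Ii i_cov mneq]] := involutions_cover sX nsE.
have /choice[D hD] := fun n => involution_density nsE (Ii n).
pose Q n k := [set x | (k.+1%:R^-1 <= D n x <= k.+1%:R) /\
  (k.+1%:R^-1 <= D n (i_ n x) <= k.+1%:R)].
have mQ n k : measurable (Q n k).
  have [mi _ _] := Ii n; have [mD _ _] := hD n.
  have mI : measurable (D n @^-1` `[k.+1%:R^-1, k.+1%:R]%classic) by exact: preim_measurable.
  have -> : Q n k = (D n @^-1` `[k.+1%:R^-1, k.+1%:R]%classic) `&`
      i_ n @^-1` (D n @^-1` `[k.+1%:R^-1, k.+1%:R]%classic).
    by apply/seteqP; split=> x; rewrite /Q /= !in_itv.
  by apply: measurableI => //; exact: preim_measurable.
have Qi n k x : Q n k x -> Q n k (i_ n x).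
  by have [_ ii _] := Ii n; move=> [h1 h2]; split; rewrite ?ii.
have QT n x : exists k, Q n k x.
  have [_ D0 _] := hD n; have bd y : exists k, forall j, (k <= j)%N -> j.+1%:R^-1 <= D n y <= j.+1%:R.
    have [k1 hk1] := ltr_add_invr (D0 y); rewrite add0r in hk1.
    exists (maxn k1 (Num.trunc (D n y))) => j; rewrite geq_max => /andP[k1j kj].
    apply/andP; split.
      apply: le_trans (ltW hk1); rewrite lef_pV2 ?posrE ?ltr0n// ler_nat.
      by rewrite ltnS.
    have : D n y < (Num.trunc (D n y)).+1%:R by rewrite truncnS_gt.
    by move=> /ltW /le_trans; apply; rewrite ler_nat ltnS.
  have [k1 h1] := bd x; have [k2 h2] := bd (i_ n x).
  by exists (maxn k1 k2); split; [apply: h1; exact: leq_maxl|apply: h2; exact: leq_maxr].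
have /choice[t ht] : forall nk : nat * nat, exists s, [/\ involution_in E s,
    forall x, Q nk.1 nk.2 x -> s x = i_ nk.1 x &
    forall A : set X, measurable A -> Pr mu (s @^-1` A) <= (nk.2.+1%:R + 1) * Pr mu A].
  move=> [n k] /=; pose Q' m := if m is 0 then Q n k else set0.
  have mQ' m : measurable (Q' m) by case: m => //=.
  have dQ' m m' x : Q' m x -> Q' m' x -> m = m' by case: m m' => [|m] [|m'].
  have fQ' m x : Q' m x -> Q' m (i_ n x) by case: m => //=; exact: Qi.
  have [s [Is sQ sN]] := glue_involutions mQ' (fun=> Ii n) dQ' fQ' Er.
  exists s; split => //; first by move=> x Qx; exact: (sQ 0%N).
  apply: (glue_bounded (C := k.+1%:R) _ mQ' (fun=> Ii n) dQ' fQ' Is sQ sN) => // m A mA.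
  case: m => [/= AQ|m]; last by rewrite subset0 => ->; rewrite preimage_set0 pr0 mulr0.
  have [mD D0 ch] := hD n; apply: (density_le mD) => //.
    exact: (density_pr (Ii n) ch).
  by move=> x /AQ[/andP[]].
(* Numbers that code no pair merely repeat the involution of the pair [(0, 0)]. *)
pose dec m := odflt (0%N, 0%N) (unpickle m : option (nat * nat)).
pose j_ m := t (dec m).
have Ij m : involution_in E (j_ m) by have [] := ht (dec m).
have /choice[F hF] := fun m => involution_density nsE (Ij m).
have lnF m x : expR (ln (F m x)) = F m x by rewrite lnK// posrE; have [_ ->] := hF m.
unshelve eexists (@InvolutionSystem _ _ _ mu E j_ (fun m x => ln (F m x))
  (fun m => (dec m).2.+1%:R + 1) Ij _ _ _ _ _ mneq) => //.
- by move=> m; apply: measurableT_comp => //; have [] := hF m.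
- by move=> m; rewrite lerDr.
- by move=> m A mA; have [_ _ ] := ht (dec m); apply.
- move=> m A f mA mf f0; have [_ _ ->//] := hF m.
  by apply: eq_integral => x _; rewrite lnF.
- move=> f g mf mg /(i_cov _ _ mf mg); apply: filterS => x [n fx].
  have [k Qk] := QT n x; exists (pickle (n, k)).
  by rewrite /j_ /dec pickleK /=; have [_ -> //] := ht (n, k).
Qed.

(** * The height cocycle and strong ergodicity *)

Section quantile.
Context (R : realType) (d : measure_display) (X : measurableType d).
Variables (mu : probability X R) (g : X -> R).
Hypothesis mg : measurable_fun setT g.
Local Notation pr := (Pr mu).

Lemma gt_measurable t : measurable [set x | t < g x].
Proof.
by apply: (boolset_measurable (b := fun x => t < g x)); exact: measurable_fun_ltr.
Qed.

Lemma ge_measurable t : measurable [set x | t <= g x].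
Proof.
by apply: (boolset_measurable (b := fun x => t <= g x)); exact: measurable_fun_ler.
Qed.

Let gt_sub t u : t <= u -> [set x | u < g x] `<=` [set x | t < g x].
Proof. by move=> tu x; exact: le_lt_trans. Qed.

Lemma pr_gt_sup (a k : R) : (forall t, k < t -> pr [set x | t < g x] <= a) ->
  pr [set x | k < g x] <= a.
Proof.
move=> h.
have -> : [set x | k < g x] = \bigcup_n [set x | k + n.+1%:R^-1 < g x].
  apply/seteqP; split=> x /=.
    by move=> /ltr_add_invr[n hn]; exists n.
  by move=> [n _ /=]; apply: lt_trans; rewrite ltrDl invr_gt0.
apply/ler_addgt0Pr => r r0.
have [||n hn] := @pr_bigcup_lim _ _ _ mu (fun n => [set x | k + n.+1%:R^-1 < g x]) r _ _ r0.
- by move=> n; exact: gt_measurable.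
- move=> m n mn; apply/subsetPset; apply: gt_sub.
  by rewrite lerD2l lef_pV2 ?posrE// ler_nat.
have := h (k + n.+1%:R^-1); rewrite ltrDl invr_gt0 ltr0n => /(_ isT).
lra.
Qed.

Lemma pr_ge_inf (b k : R) : (forall t, t < k -> b <= pr [set x | t < g x]) ->
  b <= pr [set x | k <= g x].
Proof.
move=> h; rewrite -lerN2 -(lerD2l 1) -(prC mu (ge_measurable k)).
have -> : ~` [set x | k <= g x] = \bigcup_n ~` [set x | k - n.+1%:R^-1 < g x].
  apply/seteqP; split=> x /=.
    move=> /negP; rewrite -ltNge => /ltr_add_invr[n hn]; exists n => //.
    by apply/negP; rewrite -leNgt lerBrDr ltW.
  move=> [n _ /= /negP]; rewrite -leNgt => hn /(fun z => le_trans z hn).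
  by rewrite leNgt ltrBlDr ltrDl invr_gt0 ltr0n.
apply/ler_addgt0Pr => r r0.
have [||n] := @pr_bigcup_lim _ _ _ mu (fun n => ~` [set x | k - n.+1%:R^-1 < g x]) r _ _ r0.
- by move=> n; apply: measurableC; exact: gt_measurable.
- move=> m n mn; apply/subsetPset; apply: subsetC; apply: gt_sub.
  by rewrite lerD2l lerN2 lef_pV2 ?posrE// ler_nat.
rewrite [X in _ < X](prC mu (gt_measurable _)) => hn.
have := h (k - n.+1%:R^-1); rewrite gtrDl oppr_lt0 invr_gt0 ltr0n => /(_ isT).
lra.
Qed.

(** Used twice: near 1 to locate the constant close to an almost invariant function, and at 1/2 as a
    median in Cheeger's inequality. *)
Lemma quantile (q : R) : 0 < q -> q < 1 -> exists k,
  (forall t, k < t -> pr [set x | t < g x] < q) /\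
  (forall t, t < k -> q <= pr [set x | t < g x]).
Proof.
move=> q0 q1; pose T := [set t | q <= pr [set x | t < g x]].
have Tdown t u : t <= u -> T u -> T t.
  move=> tu; rewrite /T /= => /le_trans; apply; apply: prS; try exact: gt_measurable.
  exact: gt_sub.
have T0 : T !=set0.
  have [||||n hn] := @pr_bigcap_lim _ _ _ mu (fun n => ~` [set x | - n%:R < g x]) (1 - q).
  - by move=> n; apply: measurableC; exact: gt_measurable.
  - move=> m n mn; apply/subsetPset; apply: subsetC; apply: gt_sub.
    by rewrite lerN2 ler_nat.
  - rewrite -subset0 => x hx; apply: (hx (Num.trunc `|g x|).+1 I) => /=.
    have := truncnS_gt `|g x|; have := ler_norm (- g x); rewrite normrN; lra.
  - lra.
  exists (- n%:R); rewrite /T /=; move: hn; rewrite prC; [lra|exact: gt_measurable].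
have supT : has_sup T.
  split=> //.
  have [||||n hn] := @pr_bigcap_lim _ _ _ mu (fun n => [set x | n%:R < g x]) q.
  - by move=> n; exact: gt_measurable.
  - by move=> m n mn; apply/subsetPset; apply: gt_sub; rewrite ler_nat.
  - rewrite -subset0 => x hx; have := hx (Num.trunc `|g x|).+1 I => /=.
    have := truncnS_gt `|g x|; have := ler_norm (g x); lra.
  - by [].
  exists n%:R => t Tt; rewrite leNgt; apply/negP => nt.
  by have := Tdown _ _ (ltW nt) Tt; rewrite /T /= leNgt hn.
exists (sup T); split=> t tT.
  rewrite ltNge; apply/negP => Tt; have := sup_upper_bound supT Tt.
  by rewrite leNgt tT.
have [|u Tu tu] := sup_adherent (eps := sup T - t) _ supT; first by rewrite subr_gt0.
by apply: Tdown Tu; move: tu; rewrite opprB addrC subrK => /ltW.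
Qed.

End quantile.

Section system.
Context (R : realType) (d : measure_display) (X : measurableType d).
Variables (mu : probability X R) (E : set (X * X)).
Hypothesis nsE : nonsingular_equivalence mu E.
Variable s : involution_system mu E.
Local Notation pr := (Pr mu).
Local Notation i_ := (ivl s).
Local Notation h_ := (height s).

Lemma ivl_measurable n : measurable_fun setT (i_ n).
Proof. by have [] := ivlP s n. Qed.

Lemma ivlK n x : i_ n (i_ n x) = x.
Proof. by have [] := ivlP s n. Qed.

Lemma preim_ivl n (A : set X) : measurable A -> measurable (i_ n @^-1` A).
Proof. exact/preim_measurable/ivl_measurable. Qed.

Lemma ivl_ae (P : X -> Prop) : {ae mu, forall x, P x} ->
  {ae mu, forall x, forall n, P (i_ n x)}.
Proof.
by move=> aP; apply/ae_foralln => n; exact: (involution_ae nsE (ivlP s n)).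
Qed.

(** The family is closed under composition only pointwise: [m] depends on [x]. Hence the cocycle
    identity is stated over triples of indices. *)
Lemma ivl_comp : {ae mu, forall x, forall k l, exists m, i_ k (i_ l x) = i_ m x}.
Proof.
have [[_ Es Et] _ _ _] := nsE.
apply/ae_foralln => k; apply/ae_foralln => l.
apply: (ivl_cover s (f := i_ k \o i_ l) (g := i_ l \o i_ k));
  do ?[by apply: measurableT_comp; exact: ivl_measurable].
apply: aeW => x /=; rewrite !ivlK; split=> //.
by apply: Et; [have [_ _] := ivlP s l; apply|have [_ _] := ivlP s k; apply].
Qed.

Lemma ivl_id : {ae mu, forall x, exists m, i_ m x = x}.
Proof.
have [[Er _ _] _ _ _] := nsE.
have : {ae mu, forall x, exists m, id x = i_ m x}.
  apply: (ivl_cover s (f := id) (g := id)) => //.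
  by apply: aeW => x; split=> //; exact: Er.
by apply: filterS => x [m mx]; exists m; rewrite -mx.
Qed.

Lemma height_change n (A : set X) : measurable A ->
  (\int[mu]_(x in A) (expR (h_ n x))%:E = (pr (i_ n @^-1` A))%:E)%E.
Proof.
by apply: (density_pr (ivlP s n)) => B f mB mf f0; exact: ivl_change.
Qed.

Lemma expR_height_measurable n (A : set X) :
  measurable_fun A (fun x => (expR (h_ n x))%:E).
Proof.
apply: measurable_funTS; apply/measurable_EFinP; apply: measurableT_comp => //.
exact: height_measurable.
Qed.

Lemma expR_height_integrable n (A : set X) : measurable A ->
  mu.-integrable A (fun x => (expR (h_ n x))%:E).
Proof.
move=> mA; apply/integrableP; split; first exact: expR_height_measurable.
under eq_integral => x _ do rewrite gee0_abs ?lee_fin ?expR_ge0//.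
by rewrite height_change// ltry.
Qed.

(** The chain rule for densities, restricted to the set [Q] where the composition coincides with
    [i_ m]: both sides have the same integral over every measurable subset of [Q]. *)
Lemma height_cocycle : {ae mu, forall x, forall k l m, i_ k (i_ l x) = i_ m x ->
  h_ m x = h_ k (i_ l x) + h_ l x}.
Proof.
apply/ae_foralln => k; apply/ae_foralln => l; apply/ae_foralln => m.
pose Q := ~` [set x | (i_ k \o i_ l) x <> i_ m x].
have mQ : measurable Q.
  apply: measurableC; apply: (neq_measurable s); last exact: ivl_measurable.
  by apply: measurableT_comp; exact: ivl_measurable.
have QE x : Q x <-> i_ k (i_ l x) = i_ m x by split=> [/contrapT|? []].
have mkl : measurable_fun setT (fun x => (expR (h_ k (i_ l x)))%:E).
  apply/measurable_EFinP; apply: measurableT_comp => //.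
  by apply: measurableT_comp; [exact: height_measurable|exact: ivl_measurable].
have : ae_eq mu Q (fun x => (expR (h_ m x))%:E)
    (fun x => (expR (h_ k (i_ l x)))%:E * (expR (h_ l x))%:E)%E.
  apply: integral_ae_eq => //.
  - exact: expR_height_integrable.
  - apply: emeasurable_funM; last exact: expR_height_measurable.
    exact: measurable_funTS.
  move=> A AQ mA; rewrite height_change//.
  have -> : i_ m @^-1` A = i_ k @^-1` (i_ l @^-1` A).
    apply/seteqP; split=> y /= Ay.
      by have /AQ/QE := Ay; rewrite ivlK => <-; rewrite !ivlK.
    have /AQ/QE := Ay; rewrite !ivlK => ->.
    by rewrite ivlK.
  rewrite -(height_change _ (preim_ivl l mA)).
  rewrite (ivl_change s l mA (@expR_height_measurable k setT)); first exact: erefl.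
  by move=> x; rewrite lee_fin expR_ge0.
move=> hae; apply: filterS hae => x hx /QE /hx; rewrite -EFinM -expRD => -[].
exact: expR_inj.
Qed.

Definition good x := [/\ forall k l, exists m, i_ k (i_ l x) = i_ m x,
  forall k l m, i_ k (i_ l x) = i_ m x -> h_ m x = h_ k (i_ l x) + h_ l x
  & exists m, i_ m x = x].

Lemma ae_good : {ae mu, forall x, good x /\ forall n, good (i_ n x)}.
Proof.
have g : {ae mu, forall x, good x}.
  by apply: filterS3 ivl_comp height_cocycle ivl_id => x.
by apply: filterS2 g (ivl_ae g) => x.
Qed.

Lemma height_id x m : good x -> i_ m x = x -> h_ m x = 0.
Proof. by move=> [_ co _] mx; have := co m m m; rewrite !mx => /(_ erefl); lra. Qed.

Lemma height_inv x m : good x -> h_ m (i_ m x) = - h_ m x.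
Proof.
move=> gx; have [_ co [e ex]] := gx; have := co m m e; rewrite ivlK ex => /(_ erefl).
by rewrite (height_id gx ex); lra.
Qed.

Lemma height_le_ae n (C : R) : (forall A : set X, measurable A -> pr (i_ n @^-1` A) <= C * pr A) ->
  {ae mu, forall x, expR (h_ n x) <= C}.
Proof.
move=> hC; apply: integral_ub_ae => [||A mA]; last by rewrite height_change// lee_fin hC.
  by apply: measurableT_comp => //; exact: height_measurable.
by move=> x; exact: expR_ge0.
Qed.

Definition hbound n : R := ln (ivl_bound s n).

Lemma height_bound : {ae mu, forall x, forall n, `|h_ n x| <= hbound n}.
Proof.
have h1 : {ae mu, forall x, forall n, expR (h_ n x) <= ivl_bound s n}.
  by apply/ae_foralln => n; apply: height_le_ae => A mA; exact: ivl_bounded.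
have b0 n : 0 < ivl_bound s n by apply: lt_le_trans (ivl_bound_ge1 s n).
apply: filterS3 h1 (ivl_ae h1) ae_good => x hx hix [gx _] n.
have lnle r : expR r <= ivl_bound s n -> r <= hbound n.
  by move=> hr; rewrite -ler_expR lnK ?posrE.
rewrite ler_norml lnle// andbT lerNl -height_inv// lnle//.
Qed.

Lemma hbound_ge0 n : 0 <= hbound n.
Proof. by apply: ln_ge0; exact: ivl_bound_ge1. Qed.

(** The involution exchanges the two halves of the symmetric difference, so controlling one half is
    enough. *)
Lemma preimD_ivl n (A : set X) : measurable A ->
  pr (A `\` i_ n @^-1` A) <= ivl_bound s n * pr (i_ n @^-1` A `\` A).
Proof.
move=> mA; have mD : measurable (i_ n @^-1` A `\` A).
  by apply: measurableD => //; exact: preim_ivl.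
apply: le_trans (ivl_bounded s n mD); have -> // : A `\` i_ n @^-1` A = i_ n @^-1` (i_ n @^-1` A `\` A).
by apply/seteqP; split=> x /=; rewrite ivlK.
Qed.

Lemma preimY_ivl n (A : set X) : measurable A ->
  pr (A `+` i_ n @^-1` A) <= (1 + ivl_bound s n) * pr (i_ n @^-1` A `\` A).
Proof.
move=> mA; have miA := preim_ivl n mA.
apply: le_trans (prU mu (measurableD mA miA) (measurableD miA mA)) _.
by rewrite mulrDl mul1r addrC lerD2l; exact: preimD_ivl.
Qed.

Lemma pr_bigcap_lim0 (F : nat -> set X) e : (forall i, measurable (F i)) ->
  nonincreasing_seq F -> pr (\bigcap_i F i) = 0 -> 0 < e -> exists n, pr (F n) < e.
Proof.
move=> mF niF F0 e0; have mI : measurable (\bigcap_i F i) by exact: bigcapT_measurable.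
have [|||n hn] := @pr_bigcap_lim _ _ _ mu (fun n => F n `\` \bigcap_i F i) e _ _ _ e0.
- by move=> n; exact: measurableD.
- by move=> m n /niF/subsetPset FF; apply/subsetPset; exact: setSD.
- by rewrite -subset0 => x h; have [_] := h 0%N I; apply => k _; have [] := h k I.
exists n; move: hn; rewrite prD//; have -> : F n `&` \bigcap_i F i = \bigcap_i F i.
  by rewrite setIC setIidl// => x; apply.
by rewrite F0 subr0.
Qed.

Hypothesis seE : strongly_ergodic mu E.

Lemma full_group_cover (th : nonsingular_aut mu) : full_group E th ->
  {ae mu, forall x, exists m, aut_inv th x = i_ m x}.
Proof.
have [[_ Es _] _ _ _] := nsE; move=> Eth.
apply: (ivl_cover s (f := aut_inv th) (g := aut_fun th)) => //.
have h : {ae mu, forall y, E (aut_inv th y, aut_fun th (aut_inv th y))}.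
  exact: (@aut_inv_null _ _ _ _ th _ Eth).
apply: filterS2 h (aut_invK th) => y Ey yK; split=> //.
by apply: Es; rewrite yK in Ey.
Qed.

(** A diagonal argument: counterexamples [A n] for [M = n] and [e = 1/(n+1)] would be asymptotically
    invariant under each [i_ m], hence under the full group, against strong ergodicity. *)
Lemma se_uniform (eta : R) : 0 < eta -> exists M (e : R), 0 < e /\
  forall A : set X, measurable A ->
    (forall m, (m < M)%N -> pr (A `+` i_ m @^-1` A) <= e) ->
    pr A * (1 - pr A) <= eta.
Proof.
move=> eta0; apply: contrapT => /forallNP h.
have /choice[A hA] : forall n, exists A : set X, [/\ measurable A,
    (forall m, (m < n)%N -> pr (A `+` i_ m @^-1` A) <= n.+1%:R^-1)
    & eta < pr A * (1 - pr A)].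
  move=> n; apply: contrapT => /forallNP nA; apply: (h n); exists n.+1%:R^-1.
  split; first by rewrite invr_gt0.
  move=> A mA Am; rewrite leNgt; apply/negP => eA; exact: (nA A).
have mA n : measurable (A n) by have [] := hA n.
have : (mu (A n) * (1 - mu (A n)))%E @[n --> \oo] --> 0%E.
  apply: seE => // th Eth.
  have mact n : measurable (act_set th (A n)) by apply: preim_measurable.
  have mY n : measurable (A n `+` act_set th (A n)) by exact: measurableY.
  have -> : (fun n => mu (A n `+` act_set th (A n))) =
      EFin \o (fun n => pr (A n `+` act_set th (A n))).
    by apply/funext => n /=; rewrite -prE.
  apply: cvg_EFin; first exact: nearW; rewrite /comp /=.
  apply/cvgr0Pnorm_lt => e e0.
  (* Off [F M] the automorphism moves points like one of the first [M] involutions, and [F M]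
     decreases to a null set. *)
  pose F M := \bigcap_(m < M) [set x | aut_inv th x <> i_ m x].
  have mne m : measurable [set x | aut_inv th x <> i_ m x].
    by apply: (neq_measurable s) => //; exact: ivl_measurable.
  have mF M : measurable (F M).
    by rewrite /F bigcap_mkord; apply: bigsetI_measurable => i _; exact: mne.
  have [||||M hM] := @pr_bigcap_lim0 F (e / 2).
  - exact: mF.
  - by move=> m n mn; apply/subsetPset => x hx k /= km; apply: hx; exact: leq_trans km mn.
  - apply: ae_pr0; first exact: bigcapT_measurable.
    apply: filterS (full_group_cover Eth) => x [m xm] /(_ m.+1 I) /(_ m) /=.
    by apply.
  - by rewrite divr_gt0.
  have [|n0 hn0] := @ltr_add_invr _ 0 (e / 2 / M.+1%:R); first by rewrite !divr_gt0.
  rewrite add0r in hn0.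
  exists (maxn M n0) => // n /=; rewrite geq_max => /andP[Mn n0n].
  rewrite ger0_norm ?pr_ge0//.
  pose G m := A n `+` i_ m @^-1` A n.
  have mYm m : measurable (G m) by apply: measurableY => //; exact: preim_ivl.
  apply: (@le_lt_trans _ _ (pr (F M `|` \big[setU/set0]_(m < M) G m))).
    apply: prS => //; first by apply: measurableU => //; exact: bigsetU_measurable.
    rewrite -bigcup_mkord => x; rewrite /act_set /= => hx.
    have [[m mM xm]|nx] := pselect (exists2 m, (m < M)%N & aut_inv th x = i_ m x).
      by right; exists m => //; rewrite /G /= -xm.
    by left => m /= mM xm; apply: nx; exists m.
  apply: le_lt_trans (prU mu (mF M) (bigsetU_measurable _ _)) _ => //.
  apply: (@le_lt_trans _ _ (pr (F M) + e / 2)); last lra.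
  rewrite lerD2l; apply: le_trans (pr_bigsetU mu M mYm) _.
  apply: (@le_trans _ _ (\sum_(m < M) e / 2 / M.+1%:R)).
    apply: ler_sum => m _; have [_ hm _] := hA n.
    apply: le_trans (hm m (leq_trans (ltn_ord m) Mn)) _.
    apply: le_trans (ltW hn0); rewrite lef_pV2 ?posrE// ler_nat ltnS//.
  rewrite sumr_const card_ord -[leLHS]mulr_natr -mulrA ler_piMr ?divr_ge0 ?(ltW e0)//.
  by rewrite mulrC ler_pdivrMr// mul1r ler_nat.
have -> : (fun n => mu (A n) * (1 - mu (A n)))%E =
    EFin \o (fun n => pr (A n) * (1 - pr (A n))).
  by apply/funext => n /=; rewrite prE// -EFinB -EFinM.
move=> /fine_cvgP[_] /cvgr0Pnorm_lt /(_ eta eta0)[N _ /(_ N (leqnn N))] /=.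
have [_ _ hN] := hA N; rewrite ger0_norm; last exact: le_trans (ltW eta0) (ltW hN).
by move=> /(lt_trans hN); rewrite ltxx.
Qed.

Lemma se_dichotomy (dl : R) : 0 < dl -> exists M (e : R), 0 < e /\
  forall A : set X, measurable A ->
    (forall m, (m < M)%N -> pr (A `+` i_ m @^-1` A) <= e) ->
    pr A <= dl \/ 1 - dl <= pr A.
Proof.
(* The larger of [pr A] and [1 - pr A] is at least 1/2, so a product of at most [dl / 2] leaves at
   most [dl] for the smaller. *)
move=> dl0; have [|M [e [e0 h]]] := @se_uniform (dl / 2); first by rewrite divr_gt0.
exists M, e; split=> // A mA /(h A mA) hA.
have := pr_ge0 mu A; have := pr_le1 mu mA.
have [le12|gt12] := leP (pr A) (1 / 2) => p1 p0.
  by left; nra.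
by right; nra.
Qed.

(** An invariant set passes every almost-invariance test, so the uniform bound may be taken to be
    half of [pr A * (1 - pr A)]; this product must then vanish. *)
Lemma invariant_trivial (A : set X) : measurable A ->
  (forall m, {ae mu, forall x, A (i_ m x) <-> A x}) -> 0 < pr A -> pr A = 1.
Proof.
move=> mA invA A0; apply/eqP; rewrite eq_le pr_le1//= leNgt; apply/negP => A1.
have pA : 0 < pr A * (1 - pr A) by rewrite mulr_gt0// subr_gt0.
have [|M [e [e0 h]]] := @se_uniform (pr A * (1 - pr A) / 2); first by rewrite divr_gt0.
have : pr A * (1 - pr A) <= pr A * (1 - pr A) / 2.
  apply: h => // m _; rewrite (_ : pr _ = 0) ?ltW//.
  apply: ae_pr0; first by apply: measurableY => //; exact: preim_ivl.
  by apply: filterS (invA m) => x; rewrite /setY /=; tauto.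
lra.
Qed.

(** Every superlevel set is almost invariant, so its measure is within [dl] of 0 or 1, and the
    function is nearly constant at the level where this measure jumps. The pair [(M, e)] does not
    depend on [g]. *)
Lemma almost_invariant_fun_const (dl : R) : 0 < dl -> dl < 1 / 2 ->
  exists M (e : R), 0 < e /\ forall g : X -> R, measurable_fun setT g ->
    (forall m, (m < M)%N -> pr [set x | g (i_ m x) != g x] <= e) ->
    exists k, pr [set x | g x != k] <= 2 * dl.
Proof.
move=> dl0 dl2; have [M [e [e0 h]]] := se_dichotomy dl0.
exists M, e; split=> // g mg gM.
have mgi m : measurable [set x | g (i_ m x) != g x].
  apply: (boolset_measurable (b := fun x => g (i_ m x) != g x)).
  apply: measurable_neg; apply: measurable_fun_eqr => //.
  by apply: measurableT_comp => //; exact: ivl_measurable.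
have dA t : pr [set x | t < g x] <= dl \/ 1 - dl <= pr [set x | t < g x].
  have mA := gt_measurable mg t; apply: h => // m mM.
  apply: le_trans (gM m mM); apply: prS => //.
    by apply: measurableY => //; exact: preim_ivl.
  by move=> x; rewrite /setY /= => hx; apply/negP => /eqP gx; move: hx; rewrite gx; tauto.
have [||k [k1 k2]] := @quantile _ _ _ mu g mg (1 - dl); [lra|lra|].
have gk : pr [set x | k < g x] <= dl.
  by apply: (pr_gt_sup mg) => t /k1; have [//|] := dA t; lra.
have kg : 1 - dl <= pr [set x | k <= g x] by exact: (pr_ge_inf mg).
have mgt := gt_measurable mg k; have mge := ge_measurable mg k.
exists k; apply: (@le_trans _ _ (pr ([set x | k < g x] `|` ~` [set x | k <= g x]))).
  apply: prS; [|by apply: measurableU => //; exact: measurableC|].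
    apply: (boolset_measurable (b := fun x => g x != k)).
    by apply: measurable_neg; exact: measurable_fun_eqr.
  move=> x /=; rewrite neq_lt => /orP[|]; [right|by left].
  by apply/negP; rewrite -ltNge.
by apply: le_trans (prU mu mgt (measurableC mge)) _; rewrite prC//; lra.
Qed.

End system.

(** * Invariant measures from primitives of the height cocycle *)

Section coboundary.
Context (R : realType) (d : measure_display) (X : measurableType d).
Variables (mu : probability X R) (E : set (X * X)).
Hypothesis nsE : nonsingular_equivalence mu E.
Variable s : involution_system mu E.
Local Notation pr := (Pr mu).
Local Notation i_ := (ivl s).
Local Notation h_ := (height s).

(* A primitive of the height cocycle is the logarithm of the density of an
   invariant measure. *)
Lemma coboundary_invariant_measure (r : X -> R) : measurable_fun setT r ->
  (forall m, {ae mu, forall x, r (i_ m x) = r x - h_ m x}) ->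
  exists nu : {measure set X -> \bar R}, [/\ sigma_finite [set: X] nu,
    nu `<< mu, mu `<< nu & preserves mu E nu].
Proof.
move=> mr hr.
pose f x : \bar R := (expR (r x))%:E.
have mf : measurable_fun setT f.
  by apply/measurable_EFinP; apply: measurableT_comp.
have f0 x : (0 <= f x)%E by rewrite lee_fin expR_ge0.
pose nu0 (A : set X) := (\int[mu]_(x in A) f x)%E.
have nu00 : nu0 set0 = 0%E by rewrite /nu0 integral_set0.
have nu0ge A : (0 <= nu0 A)%E by apply: integral_ge0.
have nu0s : semi_sigma_additive nu0 by exact: semi_sigma_additive_nng_induced.
pose nuM := isMeasure.Build _ _ _ nu0 nu00 nu0ge nu0s.
pose nu : {measure set X -> \bar R} := HB.pack nu0 nuM.
have nuE A : nu A = (\int[mu]_(x in A) f x)%E by [].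
have nu_null A : measurable A -> pr A = 0 -> nu A = 0%E.
  move=> mA A0; rewrite nuE; apply: null_set_integral => //.
    by apply: measurable_funTS.
  exact: pr0_mu.
have numu : nu `<< mu.
  by apply/null_content_dominatesP => A mA A0; apply: nu_null => //; rewrite /Pr A0.
have nu_ae_le A B : measurable A -> measurable B -> {ae mu, forall x, A x -> B x} ->
    (nu A <= nu B)%E.
  move=> mA mB AB; have mD := measurableD mA mB.
  apply: (@le_trans _ _ (nu (B `|` (A `\` B)))).
    by apply: le_measure; rewrite ?inE//; [exact: measurableU|rewrite setDE setUIr setUCr setIT => x Ax; right].
  rewrite measureU0// nu_null//; apply: ae_pr0 => //.
  by apply: filterS AB => x h [/h].
have nu_ae_eq A B : measurable A -> measurable B -> {ae mu, forall x, A x <-> B x} ->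
    nu A = nu B.
  move=> mA mB AB; apply/eqP; rewrite eq_le; apply/andP; split; apply: nu_ae_le => //;
    by apply: filterS AB => x [].
have nu_ivl m A : measurable A -> nu (i_ m @^-1` A) = nu A.
  move=> mA; rewrite !nuE ivl_change//; apply: ge0_ae_eq_integral => //.
  - apply: emeasurable_funM; last exact: expR_height_measurable.
    by apply: measurable_funTS; apply: measurableT_comp => //; exact: ivl_measurable.
  - exact: measurable_funTS.
  - by move=> x _; rewrite mule_ge0// lee_fin expR_ge0.
  apply: filterS (hr m) => x rx _; rewrite /f rx -EFinM -expRD.
  by congr (expR _)%:E; lra.
exists nu; split=> //.
- pose F k := [set x | r x <= k%:R].
  exists F; first by apply/seteqP; split=> // x _; exists (Num.trunc `|r x|).+1 => //; rewrite /F /= ltW// (le_lt_trans (ler_norm _))// truncnS_gt.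
  move=> k; have mF : measurable (F k).
    apply: (boolset_measurable (b := fun x => r x <= k%:R)).
    by apply: measurable_fun_ler.
  split=> //; rewrite nuE.
  apply: (@le_lt_trans _ _ (\int[mu]_(x in F k) (cst (expR k%:R)%:E x))%E).
    apply: ge0_le_integral => //; first exact: measurable_funTS.
    by move=> x Fx; rewrite lee_fin ler_expR.
  by rewrite integral_cst_pr// ltry.
- apply/null_content_dominatesP => A mA A0.
  pose F k := A `&` [set x | - k%:R <= r x].
  have mF k : measurable (F k).
    apply: measurableI => //; apply: (boolset_measurable (b := fun x => - k%:R <= r x)).
    by apply: measurable_fun_ler.
  have AF : A = \bigcup_k F k.
    apply/seteqP; split=> [x Ax|x [k _ []]//]; exists (Num.trunc `|r x|).+1 => //.
    split=> //=; have := truncnS_gt `|r x|; have := ler_norm (- r x); rewrite normrN; lra.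
  rewrite AF; apply: pr0_mu; first exact: bigcup_measurable.
  apply: pr0_bigcup => // k.
  have nF0 : nu (F k) = 0%E.
    apply/eqP; rewrite eq_le measure_ge0 andbT -A0; apply: le_measure; rewrite ?inE//.
    exact: subIsetl.
  apply/eqP; rewrite eq_le pr_ge0 andbT.
  have e0 : 0 < expR (- k%:R) :> R by exact: expR_gt0.
  rewrite -(pmulr_rle0 _ e0) -lee_fin -integral_cst_pr//.
  apply: (@le_trans _ _ (nu (F k))); last by rewrite nF0.
  rewrite nuE; apply: ge0_le_integral => // [x _||x [_ /= rx]].
    by rewrite lee_fin expR_ge0.
    exact: measurable_funTS.
  by rewrite lee_fin ler_expR.
move=> th Eth A mA.
pose g := aut_inv th; pose g' := aut_fun th.
have mg : measurable_fun setT g by [].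
have mg' : measurable_fun setT g' by [].
have mact : measurable (act_set th A) by exact: preim_measurable.
have mneq (u v : X -> X) : measurable_fun setT u -> measurable_fun setT v ->
    measurable [set x | u x = v x].
  move=> mu' mv; rewrite (_ : [set x | _] = ~` [set x | u x <> v x]).
    by apply: measurableC; exact: (neq_measurable s).
  by apply/seteqP; split=> x /= => [h []//|/contrapT].
(* Partition by the first involution agreeing with [g], the inverse of [th]. On [F m] the map [g] is
   [i_ m], and [G m] is the image; invariance under each [i_ m] is then summed over the pieces. *)
pose F m := [set x | g x = i_ m x] `&` [set x | (g' \o g) x = x] `&`
  \bigcap_(j < m) ~` [set x | g x = i_ j x].
have mi := ivl_measurable s.
have mF m : measurable (F m).
  apply: measurableI.
    by apply: measurableI; [exact: mneq|apply: (mneq _ id) => //; exact: measurableT_comp].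
  by rewrite bigcap_mkord; apply: bigsetI_measurable => j _; apply: measurableC; exact: mneq.
have FdF m n x : F m x -> F n x -> m = n.
  move=> [[gm _] hm] [[gn _] hn]; have [mn|nm|//] := ltngtP m n.
    by have := hn m mn.
  by have := hm n nm.
have coverF : {ae mu, forall x, exists m, F m x}.
  apply: filterS2 (full_group_cover nsE s Eth) (aut_invK th) => x [m xm] xK.
  have hm : exists m, g x == i_ m x :> {classic X} by exists m; apply/eqP.
  case: (ex_minnP hm) => n /eqP xn nmin; exists n; split; first by split.
  move=> k kn /= gk; have : (n <= k)%N by apply: nmin; apply/eqP.
  by rewrite leqNgt [(k < n)%N]kn.
pose G m := i_ m @^-1` F m.
have mG m : measurable (G m) by exact: preim_ivl.
have GdG m n y : G m y -> G n y -> m = n.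
  move=> Gm Gn; have [[[g1 k1] _] [[g2 k2] _]] := (Gm, Gn).
  rewrite /= ivlK in g1; rewrite /= ivlK in g2; rewrite /= g1 in k1; rewrite /= g2 in k2.
  by apply: (FdF _ _ (g' y)); [rewrite k1|rewrite k2].
have coverG : {ae mu, forall y, exists m, G m y}.
  have h : {ae mu, forall y, exists m, F m (g' y)}.
    exact: (@aut_fun_null _ _ _ _ th _ coverF).
  apply: filterS2 h (aut_funK th) => y [m Fm] yK; exists m.
  have [[gm _] _] := Fm; rewrite /= [g _]yK in gm.
  by rewrite /G /= gm ivlK.
have mP m : measurable (act_set th A `&` F m) by exact: measurableI.
have mQ m : measurable (A `&` G m) by exact: measurableI.
have -> : nu (act_set th A) = nu (\bigcup_m (act_set th A `&` F m)).
  apply: nu_ae_eq => //; first exact: bigcup_measurable.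
  apply: filterS coverF => x [m Fm]; split=> [Ax|[k _ []]//]; by exists m.
have -> : nu A = nu (\bigcup_m (A `&` G m)).
  apply: nu_ae_eq => //; first exact: bigcup_measurable.
  apply: filterS coverG => x [m Fm]; split=> [Ax|[k _ []]//]; by exists m.
rewrite !measure_semi_bigcup//; last 4 first.
- by move=> m n _ _ [x [[_ Gm] [_ Gn]]]; exact: GdG Gm Gn.
- exact: bigcup_measurable.
- by move=> m n _ _ [x [[_ Fm] [_ Fn]]]; exact: FdF Fm Fn.
- exact: bigcup_measurable.
apply: eq_eseriesr => m _; rewrite -[in RHS](nu_ivl m)//; congr (nu _).
apply/seteqP; split=> x [Ax Fx]; split; rewrite /act_set /G /= ?ivlK//.
- by have [[<- _] _] := Fx.
- by move: Fx; rewrite /G /= ivlK => -[[/= gx _] _]; rewrite -/g gx.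
- by move: Fx; rewrite /G /= ivlK.
Qed.

End coboundary.

(** * Coboundaries as limits *)

Lemma sup_shift (R : realType) (A : set R) (c : R) : has_sup A ->
  sup [set a + c | a in A] = sup A + c.
Proof.
move=> hA; have -> : [set a + c | a in A] = [set x + y | x in A & y in [set c]].
  apply/seteqP; split=> [_ [a Aa <-]|_ [a Aa [_ -> <-]]]; first by exists a => //; exists c.
  by exists a.
by rewrite sup_sumE// ?sup1//; exact: has_sup1.
Qed.

Section limit_coboundary.
Context (R : realType) (d : measure_display) (X : measurableType d).
Variables (mu : probability X R) (E : set (X * X)).
Hypothesis nsE : nonsingular_equivalence mu E.
Variable s : involution_system mu E.
Local Notation pr := (Pr mu).
Local Notation i_ := (ivl s).
Local Notation h_ := (height s).

Lemma borel_cantelli (F : nat -> set X) (c : R) : (forall n, measurable (F n)) ->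
  (forall n, pr (F n) <= c / 2 ^+ n) ->
  {ae mu, forall x, \forall n \near \oo, ~ F n x}.
Proof.
move=> mF Fc; pose L := \bigcap_N \bigcup_n F (N + n)%N.
have mU N : measurable (\bigcup_n F (N + n)%N) by exact: bigcup_measurable.
have mL : measurable L by exact: bigcapT_measurable.
have pL N : pr L <= 2 * c / 2 ^+ N.
  apply: (@le_trans _ _ (pr (\bigcup_n F (N + n)%N))).
    by apply: prS => // x; apply.
  rewrite -mulrA; apply: pr_bigcup_le => // n; apply: (le_trans (Fc _)).
  by rewrite exprD invfM mulrA.
have c0 : 0 <= c by have := Fc 0%N; rewrite expr0 divr1; apply: le_trans; exact: pr_ge0.
have L0 : pr L = 0.
  apply/eqP; rewrite eq_le pr_ge0 andbT; apply/ler_addgt0Pr => e e0; rewrite add0r.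
  have [|k hk] := @ltr_add_invr _ 0 (e / (2 * c + 1)).
    by rewrite divr_gt0// ltr_wpDl// mulr_ge0.
  rewrite add0r in hk; apply: (le_trans (pL k)).
  have d0 : 0 < 2 * c + 1 by rewrite ltr_wpDl// mulr_ge0.
  have : (2 ^+ k)^-1 <= e / (2 * c + 1).
    apply: le_trans (ltW hk); rewrite lef_pV2 ?posrE ?exprn_gt0// -natrX ler_nat.
    by rewrite ltn_expl.
  rewrite ler_pdivlMr// => h; apply: le_trans h; rewrite mulrC ler_pM2l ?invr_gt0 ?exprn_gt0//.
  by rewrite lerDl.
apply: filterS (pr0_ae mL L0) => x nL.
apply: contrapT => h; apply: nL => N _; apply: contrapT => nF; apply: h.
by exists N => // n /= Nn Fn; apply: nF; exists (n - N)%N => //=; rewrite subnKC.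
Qed.

Lemma real_measurable_gt (f : X -> R) :
  (forall t, measurable [set x | t < f x]) -> measurable_fun setT f.
Proof.
move=> h; apply: (measurability _ (RGenOInfty.measurableE R)) => _ [_ [t ->] <-].
rewrite setTI; have -> // : f @^-1` `]t, +oo[%classic = [set x | t < f x].
by apply/seteqP; split=> x; rewrite /= in_itv /= andbT.
Qed.

Lemma sup_measurable (Z : nat -> set X) (u : nat -> X -> R) :
  (forall m, measurable (Z m)) -> (forall m, measurable_fun setT (u m)) ->
  measurable_fun setT (fun x => sup [set u m x | m in [set m | Z m x]]).
Proof.
move=> mZ mu'; apply: real_measurable_gt => t.
pose S x := [set u m x | m in [set m | Z m x]].
pose G := \bigcup_m Z m `&` \bigcup_(n : nat) \bigcap_m (~` Z m `|` [set x | u m x <= n%:R]).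
have mle m (a : R) : measurable [set x | u m x <= a].
  by apply: (boolset_measurable (b := fun x => u m x <= a)); exact: measurable_fun_ler.
have mlt m (a : R) : measurable [set x | a < u m x].
  by apply: (boolset_measurable (b := fun x => a < u m x)); exact: measurable_fun_ltr.
have mG : measurable G.
  apply: measurableI; first exact: bigcup_measurable.
  apply: bigcup_measurable => n _; apply: bigcapT_measurable => m.
  by apply: measurableU => //; exact: measurableC.
have GE x : G x <-> has_sup (S x).
  split=> [[[m _ Zm] [n _ h]]|[[_ [m Zm _]] [b hb]]].
    split; first by exists (u m x); exists m.
    by exists n%:R => _ [k Zk <-]; have [//|] := h k I.
  split; first by exists m.
  exists (Num.trunc `|b|).+1 => // k _.
  have [Zk|] := pselect (Z k x); [right|by left].
  have : u k x <= b by apply: hb; exists k.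
  by move=> /le_trans; apply; rewrite ltW// (le_lt_trans (ler_norm _))// truncnS_gt.
(* [G] is where the supremum exists. Elsewhere [sup] takes its default value 0, so the level set is
   everything or nothing according to the sign of [t]. *)
have -> : [set x | t < sup (S x)] = (G `&` \bigcup_m (Z m `&` [set x | t < u m x])) `|`
    (~` G `&` (if t < 0 then setT else set0)).
  apply/seteqP; split=> x /=.
    move=> ts; have [Gx|nG] := pselect (G x).
      left; split=> //; have /GE hs := Gx.
      have [_ [m Zm <-] tu] := sup_adherent (eps := sup (S x) - t) ltac:(by rewrite subr_gt0) hs.
      exists m => //; split=> //=; lra.
    right; split=> //; move: ts; rewrite sup_out; last by move/GE.
    by move=> ->.
  move=> [[/GE hs [m _ [Zm /= tu]]]|[nG]].
    by apply: (lt_le_trans tu); apply: sup_upper_bound => //; exists m.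
  by rewrite sup_out; [case: ifP|move/GE].
apply: measurableU; apply: measurableI => //.
- by apply: bigcup_measurable => m _; apply: measurableI.
- exact: measurableC.
- by case: ifP.
Qed.

Hypothesis seE : strongly_ergodic mu E.

(** Two approximate primitives differ by an almost invariant function, hence by a constant off a
    small set. Along a fast subsequence these constants can be subtracted, and by Borel-Cantelli the
    corrected functions are eventually constant at almost every point. *)
Lemma limit_coboundary (r : nat -> X -> R) : (forall n, measurable_fun setT (r n)) ->
  (forall k, exists n0, forall n, (n0 <= n)%N ->
     pr [set x | r n (i_ k x) != r n x - h_ k x] <= (2 ^+ n)^-1) ->
  exists f : X -> R, measurable_fun setT f /\
    forall k, {ae mu, forall x, f (i_ k x) = f x - h_ k x}.
Proof.
move=> mr /choice[n0 hn0].
pose bad n k := [set x | r n (i_ k x) != r n x - h_ k x].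
have mneq (f1 f2 : X -> R) : measurable_fun setT f1 -> measurable_fun setT f2 ->
    measurable [set x | f1 x != f2 x].
  move=> m1 m2; apply: (boolset_measurable (b := fun x => f1 x != f2 x)).
  by apply: measurable_neg; exact: measurable_fun_eqr.
have mi := ivl_measurable s.
have mbad n k : measurable (bad n k).
  apply: (mneq (fun x => r n (i_ k x)) (fun x => r n x - h_ k x)).
    exact: measurableT_comp.
  by apply: measurable_funB => //; exact: height_measurable.
have dl j : exists N, forall m n, (N <= m)%N -> (N <= n)%N ->
    exists c, pr [set x | r n x - r m x != c] <= 1 / 2 ^+ j.
  pose q : R := (2 ^+ j.+2)^-1.
  have q0 : 0 < q by rewrite invr_gt0 exprn_gt0.
  have q2 : q < 1 / 2.
    rewrite /q !exprS; have : 1 <= 2 ^+ j :> R by rewrite exprn_ege1// ler1n.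
    move=> h1; rewrite invfM mul1r gtr_pMr ?invr_gt0// invf_lt1; lra.
  have [M [e [e0 h]]] := almost_invariant_fun_const nsE s seE q0 q2.
  have [|k hk] := @ltr_add_invr _ 0 (e / 2); first by rewrite divr_gt0.
  rewrite add0r in hk.
  exists (k + \sum_(m < M) n0 m)%N => m n Nm Nn.
  have [||c hc] := h (fun x => r n x - r m x); last first.
  - exists c; apply: (le_trans hc); rewrite /q !exprS !invfM mul1r.
    have : 0 <= (2 ^+ j)^-1 :> R by rewrite invr_ge0 exprn_ge0.
    lra.
  - move=> l lM; have n0l p : (k + \sum_(m < M) n0 m <= p)%N -> pr (bad p l) <= e / 2.
      move=> Np; apply: le_trans (hn0 l p _) _.
        apply: leq_trans Np; rewrite (bigD1 (Ordinal lM))//= addnCA leq_addr//.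
      apply: le_trans (ltW hk); rewrite lef_pV2 ?posrE ?exprn_gt0// -natrX ler_nat.
      apply: leq_ltn_trans (leq_trans (leq_addr _ _) Np) _.
      by rewrite ltn_expl.
    apply: (@le_trans _ _ (pr (bad n l `|` bad m l))).
      apply: prS; [|exact: measurableU|].
        apply: (mneq (fun x => r n (i_ l x) - r m (i_ l x)) (fun x => r n x - r m x)).
          by apply: measurable_funB; exact: measurableT_comp.
        exact: measurable_funB.
      move=> x /=; have [e1|ne1] := eqVneq (r n (i_ l x)) (r n x - h_ l x); last by left.
      have [e2|ne2] := eqVneq (r m (i_ l x)) (r m x - h_ l x); last by right.
      by rewrite e1 e2 => /eqP h'; exfalso; apply: h'; ring.
    apply: le_trans (prU mu (mbad n l) (mbad m l)) _.
    by have := n0l n Nn; have := n0l m Nm; lra.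
  - exact: measurable_funB.
have /choice[N hN] := dl.
(* The sum makes the subsequence nondecreasing and past the threshold [N j]; the summand [j] makes
   the errors summable. *)
pose n_ j := (j + \sum_(i < j.+1) N i)%N.
have Nn j : (N j <= n_ j)%N.
  by rewrite /n_ big_ord_recr /= addnA leq_addl.
have nS j : (n_ j <= n_ j.+1)%N.
  by rewrite /n_ [X in (_ <= _ + X)%N]big_ord_recr/= leq_add// leq_addr.
have jn j : (j <= n_ j)%N by exact: leq_addr.
have /choice[c hc] : forall j, exists c, pr [set x | r (n_ j.+1) x - r (n_ j) x != c] <= 1 / 2 ^+ j.
  by move=> j; apply: hN => //; apply: leq_trans (nS j).
pose s_ j x := r (n_ j) x - \sum_(i < j) c i.
have ms j : measurable_fun setT (s_ j) by apply: measurable_funB.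
have conv : {ae mu, forall x, exists l, \forall j \near \oo, s_ j x = l}.
  have := borel_cantelli (fun j => mneq (fun x => r (n_ j.+1) x - r (n_ j) x) (cst (c j))
    (measurable_funB (mr _) (mr _)) (measurable_cst _)) hc.
  apply: filterS => x [J _ hJ]; exists (s_ J x); exists J => // j /= Jj.
  rewrite -(subnK Jj); elim: (j - J)%N => // k IH; rewrite addSn -IH.
  have /= := hJ (k + J)%N (leq_addl _ _); move=> /negP; rewrite negbK => /eqP h.
  rewrite /s_ big_ord_recr/= -h; ring.
have eqv : {ae mu, forall x, forall k, \forall j \near \oo, s_ j (i_ k x) = s_ j x - h_ k x}.
  apply/ae_foralln => k.
  pose B j := if (n0 k <= n_ j)%N then bad (n_ j) k else set0.
  have mB j : measurable (B j) by rewrite /B; case: ifP.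
  have hB j : pr (B j) <= 1 / 2 ^+ j.
    rewrite /B; case: ifP => [/hn0 h|_]; last by rewrite pr0 divr_ge0// exprn_ge0.
    apply: (le_trans h); rewrite div1r lef_pV2 ?posrE ?exprn_gt0//.
    by rewrite ler_weXn2l// ler1n.
  apply: filterS (borel_cantelli mB hB) => x [J _ hJ].
  exists (maxn J (n0 k)) => // j /=; rewrite geq_max => /andP[Jj kj].
  have := hJ j Jj; rewrite /B (leq_trans kj)// /bad /= => /negP; rewrite negbK => /eqP h.
  rewrite /s_ h; ring.
(* The upper limit is used because it is measurable without any convergence; almost everywhere it is
   the eventual value of [s_ j x]. *)
pose f x := fine (limn_esup (fun j => (s_ j x)%:E)).
have mf : measurable_fun setT f.
  apply: measurableT_comp => //; apply: measurable_fun_limn_esup => j.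
  exact/measurable_EFinP.
exists f; split=> // k.
have fE x l : (\forall j \near \oo, s_ j x = l) -> f x = l.
  move=> hl; have cv : (s_ j x)%:E @[j --> \oo] --> l%:E.
    by apply: cvg_near_cst; apply: filterS hl => j ->.
  rewrite /f is_cvg_limn_esupE; last by apply/cvg_ex; exists l%:E.
  by rewrite (cvg_lim _ cv).
apply: filterS3 conv (ivl_ae nsE s conv) eqv => x [l hl] /(_ k)[l' hl'] /(_ k) he.
rewrite (fE _ _ hl) (fE _ _ hl').
by have [j [[<- <-]]] := near_ex (filterI (filterI hl hl') he).
Qed.

End limit_coboundary.

(** * Connecting non-null sets at bounded height *)

Section involution_aut.
Context (R : realType) (d : measure_display) (X : measurableType d).
Variables (mu : probability X R) (E : set (X * X)).
Hypothesis nsE : nonsingular_equivalence mu E.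
Variables (i : X -> X) (Ii : involution_in E i).

Let mi : measurable_fun setT i. Proof. by have [] := Ii. Qed.

Let im : {mfun X >-> X} := HB.pack i (isMeasurableFun.Build _ _ _ _ _ mi).

Let imK : {ae mu, forall x, im (im x) = x}.
Proof. by apply: aeW => x; have [_ + _] := Ii; apply. Qed.

Let im_null (N : set X) : mu.-negligible N -> mu.-negligible (im @^-1` N).
Proof.
move=> N0; have : {ae mu, forall x, ~ N x}.
  by rewrite /almost_everywhere /=; apply: negligibleS N0 => x /contrapT.
move=> /(involution_ae nsE Ii); rewrite /almost_everywhere /=.
by apply: negligibleS => x Nx; apply.
Qed.

Definition involution_aut : nonsingular_aut mu := NonsingularAut imK imK im_null im_null.

Lemma act_set_involution_aut A : act_set involution_aut A = i @^-1` A.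
Proof. by []. Qed.

Lemma involution_aut_full_group : full_group E involution_aut.
Proof. by apply: aeW => x; have [_ _ h] := Ii; exact: h. Qed.

End involution_aut.

Section connection.
Context (R : realType) (d : measure_display) (X : measurableType d).
Variables (mu : probability X R) (E : set (X * X)).
Hypothesis nsE : nonsingular_equivalence mu E.
Variable s : involution_system mu E.
Hypothesis seE : strongly_ergodic mu E.
Local Notation pr := (Pr mu).
Local Notation i_ := (ivl s).
Local Notation h_ := (height s).
Local Notation good := (good s).

Definition nb (c : R) (W : set X) := [set x | exists m, W (i_ m x) /\ `|h_ m x| <= c].

Lemma height_le_measurable m (c : R) : measurable [set x | `|h_ m x| <= c].
Proof.
apply: (boolset_measurable (b := fun x => `|h_ m x| <= c)).
apply: measurable_fun_ler => //; apply: measurableT_comp => //.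
exact: height_measurable.
Qed.

Lemma nb_measurable c W : measurable W -> measurable (nb c W).
Proof.
move=> mW; have -> : nb c W = \bigcup_m (i_ m @^-1` W `&` [set x | `|h_ m x| <= c]).
  by apply/seteqP; split=> x [m]; [exists m|exists m].
apply: bigcup_measurable => m _; apply: measurableI; first exact: preim_ivl.
exact: height_le_measurable.
Qed.

Lemma nb_le c c' W : c <= c' -> nb c W `<=` nb c' W.
Proof. by move=> cc x [m [Wm hm]]; exists m; split=> //; exact: le_trans cc. Qed.

Lemma nb_shift m c K W x : good x -> `|h_ m x| <= K -> nb c W (i_ m x) -> nb (c + K) W x.
Proof.
move=> [gc gh _] hK [l [Wl hl]]; have [k hk] := gc l m.
exists k; rewrite -hk; split=> //; rewrite (gh _ _ _ hk).
by apply: (le_trans (ler_normD _ _)); rewrite lerD.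
Qed.

(** The saturation of [W] is invariant and non-null, hence conull. *)
Lemma orbit_meets W : measurable W -> 0 < pr W -> {ae mu, forall x, exists m, W (i_ m x)}.
Proof.
move=> mW W0; pose V := \bigcup_m i_ m @^-1` W.
have mV : measurable V by apply: bigcup_measurable => m _; exact: preim_ivl.
have half m x : good x -> V (i_ m x) -> V x.
  by move=> [gc _ _] [k _ /= Wk]; have [l hl] := gc k m; exists l => //=; rewrite -hl.
have V1 : pr V = 1.
  apply: (invariant_trivial nsE (s := s) seE) => //.
    move=> m; apply: filterS (ae_good nsE s) => x [gx gix]; split; first exact: half.
    by move=> Vx; apply: (half m) => //; rewrite ivlK.
  apply: (lt_le_trans W0); apply: pr_ae_le => //.
  by apply: filterS (ivl_id nsE s) => x [m mx] Wx; exists m => //=; rewrite mx.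
have : pr (~` V) = 0 by rewrite prC// V1 subrr.
move=> /(pr0_ae (measurableC mV)); apply: filterS => x /contrapT[m _ Wm].
by exists m.
Qed.

Definition heights W x : set R := [set h_ m x | m in [set m | W (i_ m x)]].

(** By the cocycle identity the return heights translate along the orbit; any
    translation-equivariant choice from them, such as a supremum, is therefore a primitive of the
    height. *)
Lemma heights_shift W k x : good x -> good (i_ k x) ->
  heights W (i_ k x) = [set t + - h_ k x | t in heights W x].
Proof.
move=> gx gix; apply/seteqP; split.
  move=> _ [m /= Wm <-]; have [gc gh _] := gx; have [l hl] := gc m k.
  exists (h_ l x); first by exists l => //=; rewrite -hl.
  by rewrite (gh _ _ _ hl) addrK.
move=> _ [_ [l /= Wl <-] <-]; have [gc gh _] := gix; have [m hm] := gc l k.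
exists m => /=; first by rewrite -hm ivlK.
by rewrite (gh _ _ _ hm) ivlK height_inv.
Qed.

(** Being unbounded above is an invariant property of the return heights. If it failed on a non-null
    set it would fail almost everywhere, and the supremum of the heights would be a primitive,
    giving an invariant measure. *)
Lemma heights_unbounded W : measurable W -> 0 < pr W -> type_III mu E ->
  {ae mu, forall x, forall b : nat, exists2 t, heights W x t & b%:R < t}.
Proof.
move=> mW W0 [_ _ t3].
pose V := \bigcap_(b : nat) \bigcup_m (i_ m @^-1` W `&` [set x | b%:R < h_ m x]).
have mV : measurable V.
  apply: bigcapT_measurable => b; apply: bigcup_measurable => m _.
  apply: measurableI; first exact: preim_ivl.
  apply: (boolset_measurable (b := fun x => b%:R < h_ m x)).
  by apply: measurable_fun_ltr => //; exact: height_measurable.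
have VE x : V x <-> forall b : nat, exists2 t, heights W x t & b%:R < t.
  split=> h b.
    by have [m _ [Wm hm]] := h b I; exists (h_ m x) => //; exists m.
  by move=> _; have [_ [m Wm <-] bm] := h b; exists m.
have half m x : good x -> good (i_ m x) -> V x -> V (i_ m x).
  move=> gx gix /VE Vx; apply/VE => b; rewrite heights_shift//.
  have [t Wt bt] := Vx (b + (Num.trunc `|h_ m x|).+1)%N.
  exists (t - h_ m x); first by exists t.
  move: bt; rewrite natrD; have := truncnS_gt `|h_ m x|; have := ler_norm (h_ m x); lra.
have [V1|nV1] := pselect (pr V = 1).
  have : pr (~` V) = 0 by rewrite prC// V1 subrr.
  by move=> /(pr0_ae (measurableC mV)); apply: filterS => x /contrapT/VE.
exfalso; have V0 : pr V = 0.
  apply/eqP; rewrite eq_le pr_ge0 andbT leNgt; apply/negP => V0; apply: nV1.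
  apply: (invariant_trivial nsE (s := s) seE) => // m.
  apply: filterS (ae_good nsE s) => x [gx gix]; split; last exact: half.
  by move=> Vx; rewrite -(ivlK s m x); apply: half => //; rewrite ivlK.
have hs : {ae mu, forall x, has_sup (heights W x)}.
  apply: filterS2 (orbit_meets mW W0) (pr0_ae mV V0) => x [m Wm] nV.
  split; first by exists (h_ m x); exists m.
  move: nV => /VE/existsNP[b hb]; exists b%:R => t Wt; rewrite leNgt; apply/negP => bt.
  by apply: hb; exists t.
apply: t3; apply: (@coboundary_invariant_measure _ _ _ mu E nsE s (fun x => sup (heights W x))).
  by apply: sup_measurable => m; [exact: preim_ivl|exact: height_measurable].
move=> k; apply: filterS2 hs (ae_good nsE s) => x hx [gx gix].
by rewrite heights_shift// sup_shift.
Qed.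

Definition expanding := exists (c dl : R), [/\ 0 <= c, 0 < dl &
  forall W, measurable W -> 0 < pr W -> dl <= pr (nb c W)].

Lemma preserves_height0 : preserves mu E mu -> {ae mu, forall x, forall n, h_ n x = 0}.
Proof.
move=> pE; have h : {ae mu, forall x, forall n, expR (h_ n x) <= 1}.
  apply/ae_foralln => n; apply: height_le_ae => A mA.
  have := pE _ (involution_aut_full_group nsE (ivlP s n)) A mA.
  rewrite act_set_involution_aut mul1r => pA.
  have -> : pr (i_ n @^-1` A) = pr A by rewrite /Pr pA.
  by [].
apply: filterS3 h (ivl_ae nsE s h) (ae_good nsE s) => x hx hix [gx _] n.
have := hx n; have := hix n n; rewrite height_inv// -expR0 !ler_expR; lra.
Qed.

Lemma preserves_expanding : preserves mu E mu -> expanding.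
Proof.
move=> /preserves_height0 h0; exists 0, 1; split=> // W mW W0.
rewrite -(prT mu); apply: pr_ae_le => //; first exact: nb_measurable.
apply: filterS2 h0 (orbit_meets mW W0) => x hx [m Wm] _; exists m; split=> //.
by rewrite hx normr0.
Qed.

(* Sets [W] with ever smaller height neighbourhoods would make the height of the
   first return above to [W] an approximate primitive of the height cocycle. *)
Lemma type_III_expanding : type_III mu E -> expanding.
Proof.
move=> t3; apply: contrapT => nexp.
have /choice[W hW] : forall n, exists W, [/\ measurable W, 0 < pr W & pr (nb n%:R W) < (2 ^+ n)^-1].
  move=> n; apply: contrapT => h; apply: nexp; exists n%:R, (2 ^+ n)^-1; split=> //.
  by move=> W mW W0; rewrite leNgt; apply/negP => hW; apply: h; exists W.
have mW n : measurable (W n) by have [] := hW n.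
(* Heights are negated so that the least non-negative return height is [- sup], to which
   [sup_measurable] applies. *)
pose up n x : set R := [set - h_ m x | m in [set m | (i_ m @^-1` W n `&` [set x | 0 <= h_ m x]) x]].
have upE n x t : up n x t <-> heights (W n) x (- t) /\ 0 <= - t.
  split=> [[m [Wm h0] <-]|[[m Wm hm] t0]]; first by rewrite opprK; split=> //; exists m.
  by exists m; [split=> //=; rewrite hm|rewrite hm opprK].
pose r n x := sup (up n x).
have mup n m : measurable (i_ m @^-1` W n `&` [set x | 0 <= h_ m x]).
  apply: measurableI; first exact: preim_ivl.
  apply: (boolset_measurable (b := fun x => 0 <= h_ m x)).
  by apply: measurable_fun_ler => //; exact: height_measurable.
have mr n : measurable_fun setT (fun x => - r n x).
  apply: measurableT_comp => //.
  apply: (sup_measurable (Z := fun m => i_ m @^-1` W n `&` [set x | 0 <= h_ m x])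
    (u := fun m x => - h_ m x)) => // m.
  by apply: measurableT_comp => //; exact: height_measurable.
have [_ _ ninv] := t3.
have [f [mf hf]] : exists f : X -> R, measurable_fun setT f /\
    forall k, {ae mu, forall x, f (i_ k x) = f x - h_ k x}.
  apply: (limit_coboundary nsE seE (r := fun n x => - r n x)) => //.
  move=> k; exists (Num.trunc (hbound s k)).+1 => n kn.
  have [_ Wn0 Wn] := hW n; apply: le_trans (ltW Wn).
  apply: pr_ae_le; [|exact: nb_measurable|].
    apply: (boolset_measurable (b := fun x => - r n (i_ k x) != - r n x - h_ k x)).
    apply: measurable_neg; apply: measurable_fun_eqr.
      by apply: (measurableT_comp (mr n)); exact: ivl_measurable.
    by apply: measurable_funB => //; exact: height_measurable.
  apply: filterS3 (ae_good nsE s) (heights_unbounded (mW n) Wn0 t3) (height_bound nsE s).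
  move=> x [gx gix] ub hb /=; move=> /eqP ne; apply: contrapT => nnb; apply: ne.
  have hkn : `|h_ k x| <= n%:R.
    apply: (le_trans (hb k)); apply: ltW; apply: lt_le_trans (truncnS_gt _) _.
    by rewrite ler_nat.
  have gap t : heights (W n) x t -> n%:R < `|t|.
    move=> [m Wm <-]; rewrite ltNge; apply/negP => hm; apply: nnb.
    by exists m.
  (* Off [nb n W] every return height exceeds [n] in absolute value, and [n] bounds the height of
     [i_ k]; the translation by [h_ k x] therefore changes no sign. *)
  have upS : up n (i_ k x) = [set t + h_ k x | t in up n x].
    move: hkn; rewrite ler_norml => /andP[hk1 hk2].
    apply/seteqP; split=> [t|_ [t /upE[Wt t0] <-]].
      move=> /upE[]; rewrite heights_shift// => -[u Wu ut] t0.
      exists (t - h_ k x); last by rewrite subrK.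
      apply/upE; have -> : - (t - h_ k x) = u by rewrite opprB -ut; ring.
      split=> //; rewrite leNgt; apply/negP => u0.
      by have := gap _ Wu; rewrite ltr0_norm//; lra.
    apply/upE; rewrite heights_shift//; split.
      by exists (- t) => //; ring.
    by have := gap _ Wt; rewrite ger0_norm//; lra.
  have hs : has_sup (up n x).
    split; last by exists 0 => t /upE[_]; rewrite oppr_ge0.
    have [t Wt t0] := ub 0%N; exists (- t); apply/upE; rewrite opprK; split=> //.
    exact: ltW.
  by rewrite /r upS sup_shift//; ring.
exact/ninv/(coboundary_invariant_measure nsE mf hf).
Qed.

Definition uniformly_connected (c : R) := forall W Y, measurable W -> measurable Y ->
  0 < pr W -> 1 / 4 <= pr Y ->
  exists m, 0 < pr (W `&` i_ m @^-1` Y `&` [set x | `|h_ m x| <= c]).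

(** Let the height neighbourhoods [U k] of [W] grow. If [Y] stays out of reach they have measure at
    most 3/4, so among [N] steps one gains at most [1/N]. That neighbourhood is almost invariant,
    although its measure is neither near 0 nor near 1. *)
Lemma expanding_connected : expanding -> exists c, 0 <= c /\ uniformly_connected c.
Proof.
move=> [c0 [dl0 [c00 dl00 hexp]]].
(* Less than [dl0] excludes the nearly null alternative of the dichotomy, and less than 1/4 the
   nearly full one. *)
pose dl := Order.min (dl0 / 2) (1 / 8).
have dlp : 0 < dl by rewrite lt_min; apply/andP; split; lra.
have dl1 : dl < dl0 by rewrite gt_min; apply/orP; left; lra.
have dl2 : dl < 1 / 4 by rewrite gt_min; apply/orP; right; lra.
have [M [e [e0 hse]]] := se_dichotomy nsE s seE dlp.
pose K := \sum_(m < M) hbound s m.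
pose B := \sum_(m < M) ivl_bound s m.
have b0 m : 0 <= ivl_bound s m by apply: le_trans (ivl_bound_ge1 s m).
have hK m : (m < M)%N -> hbound s m <= K.
  by move=> mM; rewrite /K (bigD1 (Ordinal mM))//= lerDl sumr_ge0// => i _; exact: hbound_ge0.
have hB m : (m < M)%N -> ivl_bound s m <= B.
  by move=> mM; rewrite /B (bigD1 (Ordinal mM))//= lerDl sumr_ge0// => i _; exact: b0.
have K0 : 0 <= K by apply: sumr_ge0 => i _; exact: hbound_ge0.
have B0 : 0 <= B by apply: sumr_ge0.
(* A one-sided gain of [1/N] becomes a symmetric difference of at most [(1 + B)/N], which must not
   exceed [e]. *)
pose N := (Num.trunc ((1 + B) / e)).+1.
have Np : 0 < N%:R :> R by rewrite ltr0n.
have hN : (1 + B) / N%:R <= e.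
  by rewrite ler_pdivrMr// mulrC -ler_pdivrMr// ltW// truncnS_gt.
pose c := c0 + N%:R * K; exists c; split; first by rewrite addr_ge0// mulr_ge0.
move=> W Y mW mY W0 Y4; apply: contrapT => nm.
have pW : {ae mu, forall x, forall m, ~ (W x /\ Y (i_ m x) /\ `|h_ m x| <= c)}.
  apply/ae_foralln => m; pose Z := W `&` i_ m @^-1` Y `&` [set x | `|h_ m x| <= c].
  have mZ : measurable Z.
    apply: measurableI; last exact: height_le_measurable.
    by apply: measurableI => //; exact: preim_ivl.
  have : pr Z = 0.
    apply/eqP; rewrite eq_le pr_ge0 andbT leNgt; apply/negP => Z0; apply: nm.
    by exists m.
  by move=> /(pr0_ae mZ); apply: filterS => x nZ [? [? ?]]; apply: nZ.
pose U k := nb (c0 + k%:R * K) W.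
have mU k : measurable (U k) by exact: nb_measurable.
have UdY k : (k <= N)%N -> pr (U k) <= 3 / 4.
  move=> kN; have : pr (U k) <= pr (~` Y); last by rewrite prC//; lra.
  apply: pr_ae_le => //; first exact: measurableC.
  apply: filterS2 (ivl_ae nsE s pW) (ae_good nsE s) => x hx [gx _] [m [Wm hm]] Yx.
  apply: (hx m m); rewrite ivlK height_inv// normrN; split=> //; split=> //.
  by apply: (le_trans hm); rewrite lerD2l ler_wpM2r// ler_nat.
have Uge k : dl0 <= pr (U k).
  apply: (le_trans (hexp W mW W0)); apply: prS => //; first exact: nb_measurable.
  by apply: nb_le; rewrite lerDl mulr_ge0.
have Usub k : U k `<=` U k.+1.
  by apply: nb_le; rewrite lerD2l ler_wpM2r// ler_nat.
have [k kN hk] : exists2 k, (k < N)%N & pr (U k.+1) - pr (U k) <= N%:R^-1.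
  apply: contrapT => h.
  have step k : (k <= N)%N -> k%:R / N%:R <= pr (U k).
    elim: k => [|k IH] kN; first by rewrite mul0r pr_ge0.
    have /IH := ltnW kN; have : N%:R^-1 < pr (U k.+1) - pr (U k).
      by rewrite ltNge; apply/negP => hh; apply: h; exists k.
    rewrite -natr1 mulrDl mul1r; lra.
  by have := step N (leqnn N); rewrite divff ?gt_eqF//; have := UdY N (leqnn N); lra.
have small m : (m < M)%N -> pr (i_ m @^-1` U k `\` U k) <= N%:R^-1.
  move=> mM; apply: (le_trans _ hk).
  have -> : pr (U k.+1) - pr (U k) = pr (U k.+1 `\` U k).
    by rewrite prD//; congr (_ - pr _); rewrite setIC setIidl.
  have mp := preim_ivl s m (mU k).
  apply: pr_ae_le; [exact: measurableD|exact: measurableD|].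
  apply: filterS2 (ae_good nsE s) (height_bound nsE s) => x [gx _] hb [Um nU]; split=> //.
  have : nb (c0 + k%:R * K + K) W x.
    by apply: (nb_shift (m := m)) => //; apply: (le_trans (hb m)); exact: hK.
  by rewrite /U -natr1 mulrDl mul1r addrA.
have [||] := hse (U k) (mU k); last 2 first.
- by have := Uge k; lra.
- by have := UdY k (ltnW kN); lra.
move=> m mM; apply: (le_trans (preimY_ivl s m (mU k))); apply: le_trans hN.
apply: ler_pM.
- by rewrite addr_ge0.
- exact: pr_ge0.
- by rewrite lerD2l hB.
- exact: small.
Qed.

End connection.

(** * Expansion of small sets *)

Section exhaustion.
Context (R : realType) (d : measure_display) (X : measurableType d).
Variables (mu : probability X R) (E : set (X * X)).
Hypothesis nsE : nonsingular_equivalence mu E.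
Variable s : involution_system mu E.
Local Notation pr := (Pr mu).
Local Notation i_ := (ivl s).
Local Notation h_ := (height s).

(* Greedily match points of [Z] with points of [Y] along [i_ 0], [i_ 1], ... *)
Lemma maximal_matching (c : R) (Z Y : set X) : measurable Z -> measurable Y ->
  Z `&` Y = set0 ->
  exists sg, [/\ involution_in E sg,
    forall A, measurable A -> pr (sg @^-1` A) <= (expR c + 1) * pr A &
    forall m, pr ((Z `\` sg @^-1` Y) `&` i_ m @^-1` (Y `\` sg @^-1` Z) `&`
      [set x | `|h_ m x| <= c]) = 0].
Proof.
move=> mZ mY ZY; have [[Er _ _] _ _ _] := nsE.
have ZYF x : Z x -> Y x -> False by move=> Zx Yx; rewrite -[False]/(set0 x) -ZY.
(* [U] collects the points already matched. The height is bounded at both ends of each pair, so that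
   the bound holds at every point of [Q m] and not just almost everywhere. *)
pose dom (U : set X) m := (Z `\` U) `&` i_ m @^-1` (Y `\` U) `&`
  [set x | `|h_ m x| <= c] `&` i_ m @^-1` [set x | `|h_ m x| <= c].
pose ex (U : set X) m := dom U m `|` i_ m @^-1` dom U m.
pose fix U m := if m is m'.+1 then U m' `|` ex (U m') m' else set0.
pose D m := dom (U m) m; pose Q m := ex (U m) m.
have mdom V m : measurable V -> measurable (dom V m).
  move=> mV; apply: measurableI; last by apply: preim_ivl; exact: height_le_measurable.
  apply: measurableI; last exact: height_le_measurable.
  by apply: measurableI; [exact: measurableD|apply: preim_ivl; exact: measurableD].
have mU m : measurable (U m).
  elim: m => [|m IH] //=; apply: measurableU => //.
  by apply: measurableU; [exact: mdom|apply: preim_ivl; exact: mdom].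
have mD m : measurable (D m) by exact: mdom.
have mQ m : measurable (Q m) by apply: (measurableU _ _ (mD m)); exact: (preim_ivl s m (mD m)).
have Umono m n : (m <= n)%N -> U m `<=` U n.
  by move=> /subnK <-; elim: (n - m)%N => // k IH x /IH; left.
have QU m n : (m < n)%N -> Q m `<=` U n.
  by move=> mn x Qx; apply: (Umono _ _ mn); right.
have QnU m x : Q m x -> ~ U m x.
  move=> [[[[[_ nU] _] _] _]|[[[_ [_ nU]] _] _]] //.
  by move: nU; rewrite /= ivlK.
have dQ m n x : Q m x -> Q n x -> m = n.
  move=> Qm Qn; have [mn|nm|//] := ltngtP m n.
    by have := QnU _ _ Qn (QU _ _ mn _ Qm).
  by have := QnU _ _ Qm (QU _ _ nm _ Qn).
have iQ m x : Q m x -> Q m (i_ m x).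
  by move=> [Dx|Dx]; [right; rewrite /= ivlK|left].
have [sg [Isg sgQ sgN]] := glue_involutions mQ (ivlP s) dQ iQ Er.
have DZY m x : D m x -> Z x /\ Y (i_ m x) by move=> [[[[Zx _] [Yx _]] _] _].
have Dsg m x : D m x -> Y (sg x).
  by move=> Dx; rewrite (sgQ m); [have [] := DZY _ _ Dx|left].
exists sg; split=> //.
- apply: (glue_bounded (C := expR c) _ mQ (ivlP s) dQ iQ Isg sgQ sgN).
    exact: expR_ge0.
  move=> m A mA AQ; apply: (density_le (D := fun x => expR (h_ m x))) => //.
  + by apply: measurableT_comp => //; exact: height_measurable.
  + by move=> x; exact: expR_gt0.
  + by move=> B mB; exact: height_change.
  + move=> x /AQ Qx; rewrite ler_expR.
    have : `|h_ m x| <= c.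
      by case: Qx => [[[_ +] _]//|[_ /=]]; rewrite ivlK.
    by apply: le_trans; exact: ler_norm.
move=> m; have msg : measurable_fun setT sg by have [] := Isg.
apply: ae_pr0.
  apply: measurableI; last exact: height_le_measurable.
  apply: measurableI; first by apply: measurableD => //; exact: preim_measurable.
  by apply: preim_ivl; apply: measurableD => //; exact: preim_measurable.
apply: filterS (ae_good nsE s) => x [gx _] [[[Zx nYsx] [Yix nZsix]] hx].
have nUx k : ~ Q k x.
  move=> [Dx|/DZY[_]]; first by apply: nYsx; exact: (Dsg k).
  by rewrite ivlK => Yx; exact: (ZYF x).
have nUix k : ~ Q k (i_ m x).
  move=> Qk; case: (Qk) => [/DZY[Zix _]|/DZY[Zk _]]; first exact: (ZYF (i_ m x)).
  by apply: nZsix; rewrite /= (sgQ k).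
have UQ k y : U k y -> exists j, Q j y.
  by elim: k => // k IH [/IH//|Qy]; exists k.
apply: (nUx m); left; split; last by rewrite /= height_inv// normrN.
split=> //; split; split=> //; first by move=> /UQ[k /nUx].
by move=> /UQ[k /nUix].
Qed.

Lemma finite_cover (c : R) (Y : set X) : uniformly_connected s c -> measurable Y ->
  3 / 4 <= pr Y ->
  exists (n : nat) (sg : nat -> X -> X) (C : R), [/\ 0 <= C,
    forall j, involution_in E (sg j),
    forall j A, measurable A -> pr (sg j @^-1` A) <= C * pr A &
    pr (~` Y `\` \bigcup_(j < n) (sg j @^-1` Y)) = 0].
Proof.
move=> con mY Y34.
pose C : R := expR c + 1; pose kp : R := (2 * C)^-1.
have C0 : 0 < C by rewrite addr_gt0 ?expR_gt0.
have kp0 : 0 < kp by rewrite invr_gt0 mulr_gt0.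
have /choice[f hf] : forall Z : set X, exists sg, [/\ involution_in E sg,
    forall A, measurable A -> pr (sg @^-1` A) <= C * pr A &
    measurable Z -> Z `&` Y = set0 -> pr (Z `\` sg @^-1` Y) = 0 \/
      pr (Z `\` sg @^-1` Y) <= pr Z - kp].
  move=> Z; have [[mZ ZY]|h] := pselect (measurable Z /\ Z `&` Y = set0); last first.
    have [[Er _ _] _ _ _] := nsE.
    exists id; split=> [|A mA|mZ ZY]; [by split|by rewrite ler_peMl ?pr_ge0// lerDr expR_ge0|].
    by exfalso; apply: h.
  have [sg [Isg bsg hsg]] := maximal_matching c mZ mY ZY.
  have msg : measurable_fun setT sg by have [] := Isg.
  exists sg; split=> // _ _.
  have msY := preim_measurable msg mY; have msZ := preim_measurable msg mZ.
  have mZ' : measurable (Z `\` sg @^-1` Y) by exact: measurableD.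
  have mY' : measurable (Y `\` sg @^-1` Z) by exact: measurableD.
  have [Z0|Zn0] := eqVneq (pr (Z `\` sg @^-1` Y)) 0; [by left|right].
  have Zp : 0 < pr (Z `\` sg @^-1` Y) by rewrite lt_neqAle eq_sym Zn0 pr_ge0.
  have [Y4|Y4] := leP (1 / 4) (pr (Y `\` sg @^-1` Z)).
    by have [m] := con _ _ mZ' mY' Zp Y4; rewrite hsg ltxx.
  have mZsY : measurable (Z `&` sg @^-1` Y) by exact: measurableI.
  have := bsg _ mZsY; rewrite -/C.
  have -> : sg @^-1` (Z `&` sg @^-1` Y) = Y `&` sg @^-1` Z.
    by have [_ ii _] := Isg; apply/seteqP; split=> x /=; rewrite ii => -[].
  move: Y4; rewrite !prD// => Y4 hC.
  have : 1 / 2 <= C * pr (Z `&` sg @^-1` Y) by lra.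
  rewrite -ler_pdivrMl//; have -> : C^-1 * (1 / 2) = kp by rewrite /kp invfM mul1r mulrC.
  lra.
pose fix Z n := if n is n'.+1 then Z n' `\` f (Z n') @^-1` Y else ~` Y.
pose sg n := f (Z n).
have msg n : measurable_fun setT (sg n) by have [[]] := hf (Z n).
have mZ n : measurable (Z n).
  elim: n => [|n IH] /=; first exact: measurableC.
  by apply: measurableD => //; apply: preim_measurable => //; exact: (msg n).
have ZY n : Z n `&` Y = set0.
  elim: n => [|n IH] /=; first by rewrite setICl.
  by rewrite -subset0 => x [[Zx _] Yx]; rewrite -[set0 x]/(set0 x) -IH.
have [n Zn] : exists n, pr (Z n) = 0.
  apply: contrapT => h.
  have step n : pr (Z n) <= 1 - n%:R * kp.
    elim: n => [|n IH]; first by rewrite mul0r subr0 pr_le1.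
    have [_ _ /(_ (mZ n) (ZY n))[Z0|]] := hf (Z n); first by exfalso; apply: h; exists n.+1.
    move=> /le_trans; apply; rewrite -natr1 mulrDl mul1r; lra.
  have := step (Num.trunc kp^-1).+1; have := pr_ge0 mu (Z (Num.trunc kp^-1).+1).
  have : 1 < (Num.trunc kp^-1).+1%:R * kp by rewrite -ltr_pdivrMr// div1r truncnS_gt.
  lra.
exists n, sg, C; split=> [|j|j A mA|]; [exact: ltW|by have [] := hf (Z j)|by have [_ + _] := hf (Z j); apply|].
suff <- : Z n = ~` Y `\` \bigcup_(j < n) (sg j @^-1` Y) by [].
elim: n {Zn} => [|n IH] /=; first by rewrite bigcup_mkord big_ord0 setD0.
rewrite -/(sg n) IH; apply/seteqP; split=> x.
  move=> [[nY h] nsY]; split=> // -[j /= jn sY].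
  move: jn; rewrite ltnS leq_eqVlt => /predU1P[jn|jn]; first by apply: nsY; rewrite /= -jn.
  by apply: h; exists j.
move=> [nY h]; split; first by split=> // -[j /= jn sY]; apply: h; exists j => //=; rewrite ltnS ltnW.
by move=> sY; apply: h; exists n => //=.
Qed.

(** Extend step by step to within [1/(n+1)] of the largest measure still attainable; the increasing
    union leaves no room for a gain in measure. *)
Lemma maximal_set (K : set (set X)) (A0 : set X) : K A0 ->
  (forall A, K A -> measurable A) ->
  (forall F : nat -> set X, (forall n, K (F n)) -> nondecreasing_seq F -> K (\bigcup_n F n)) ->
  exists2 A, K A & forall A', K A' -> A `<=` A' -> pr A' <= pr A.
Proof.
move=> KA0 mK Kcup.
pose step (u v : nat * set X) := v.1 = u.1.+1 /\ (K u.2 -> [/\ K v.2, u.2 `<=` v.2 &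
  forall A, K A -> u.2 `<=` A -> pr A <= pr v.2 + u.1.+1%:R^-1]).
have step_ex u : exists v, step u v.
  case: u => n A; have [KA|nKA] := pselect (K A); last by exists (n.+1, A).
  pose S : set R := [set pr A' | A' in [set A' | K A' /\ A `<=` A']].
  have hS : has_sup S.
    split; first by exists (pr A), A => //; split.
    by exists 1 => _ [A' [KA' _] <-]; apply: pr_le1; exact: mK.
  have [|_ [A' [KA' AA'] <-] hA'] := sup_adherent (eps := n.+1%:R^-1) _ hS.
    by rewrite invr_gt0.
  exists (n.+1, A'); split=> //= _; split=> // A'' KA'' AA''.
  have : pr A'' <= sup S by apply: sup_upper_bound => //; exists A'' => //; split.
  by move=> h1; rewrite -lerBlDr; apply: le_trans (ltW hA'); rewrite lerD2r.
have [u [u0 uS]] := dependent_choice_ex step_ex (0%N, A0).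
pose F n := (u n).2.
have un n : (u n).1 = n.
  by elim: n => [|n IH]; [rewrite u0|have [-> _] := uS n; rewrite IH].
have KF n : K (F n).
  elim: n => [|n IH]; first by rewrite /F u0.
  by have [_ /(_ IH)[]] := uS n.
have FS n : F n `<=` F n.+1 /\ forall A, K A -> F n `<=` A -> pr A <= pr (F n.+1) + n.+1%:R^-1.
  by have [_ /(_ (KF n))[_ h1]] := uS n; rewrite un.
have ndF : nondecreasing_seq F.
  by apply/nondecreasing_seqP => n; apply/subsetPset; have [] := FS n.
have KU := Kcup F KF ndF.
exists (\bigcup_n F n) => // A KA UA; apply/ler_addgt0Pr => e e0.
have [n] := ltr_add_invr e0; rewrite add0r => hn.
have [_ /(_ A KA) hA] := FS n.
have /hA : F n `<=` A by move=> x Fx; apply: UA; exists n.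
have : pr (F n.+1) <= pr (\bigcup_n F n).
  by apply: prS; [exact: mK|exact: mK|move=> x Fx; exists n.+1].
by move=> h1 h2; apply: (le_trans h2); apply: lerD h1 (ltW hn).
Qed.

Hypothesis seE : strongly_ergodic mu E.

Definition expander := exists (n : nat) (sg : nat -> X -> X) (C dl : R),
  [/\ 0 < dl, forall j, (j < n)%N -> involution_in E (sg j),
    forall j A, (j < n)%N -> measurable A -> pr (sg j @^-1` A) <= C * pr A &
    forall A, measurable A -> 0 < pr A -> pr A <= 1 / 2 ->
      exists2 j, (j < n)%N & dl * pr A < pr (A `+` sg j @^-1` A)].

(* A maximal set of measure at most 1/4 that is almost invariant under the
   finitely many involutions of [se_dichotomy] can be enlarged by the trace [B]
   on its complement [Y] of a set [A'] that is almost invariant under many more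
   involutions. *)
Lemma connected_expander (c : R) : uniformly_connected s c -> expander.
Proof.
move=> con; apply: contrapT => nexp.
have fail n sg C dl : 0 < dl -> (forall j, (j < n)%N -> involution_in E (sg j)) ->
    (forall j A, (j < n)%N -> measurable A -> pr (sg j @^-1` A) <= C * pr A) ->
    exists A, [/\ measurable A, 0 < pr A, pr A <= 1 / 2 &
      forall j, (j < n)%N -> pr (A `+` sg j @^-1` A) <= dl * pr A].
  move=> dl0 Isg bsg; apply: contrapT => h; apply: nexp; exists n, sg, C, dl; split=> //.
  move=> A mA A0 A2; apply: contrapT => h'; apply: h; exists A; split=> // j jn.
  by rewrite leNgt; apply/negP => hj; apply: h'; exists j.
(* The enlarged set has measure at most 1/4 + 1/2, below 4/5, so the dichotomy puts it under 1/5 and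
   it stays admissible for the maximum. *)
have [|M [e [e0 hse]]] := se_dichotomy nsE s seE (dl := 1 / 5); first lra.
pose B0 := \sum_(m < M) ivl_bound s m.
have b0 m : 0 <= ivl_bound s m by apply: le_trans (ivl_bound_ge1 s m).
have hB m : (m < M)%N -> ivl_bound s m <= B0.
  by move=> mM; rewrite /B0 (bigD1 (Ordinal mM))//= lerDl sumr_ge0.
have B00 : 0 <= B0 by apply: sumr_ge0.
pose e' := e / (1 + B0).
have e'0 : 0 < e' by rewrite divr_gt0// ltr_wpDr.
(* The error is relative to the measure of the set, so that it adds up over disjoint unions. *)
pose alm A := forall m, (m < M)%N -> pr (i_ m @^-1` A `\` A) <= e' * pr A.
have dich A : measurable A -> alm A -> pr A <= 1 / 5 \/ 1 - 1 / 5 <= pr A.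
  move=> mA aA; apply: hse => // m mM; apply: (le_trans (preimY_ivl s m mA)).
  have h1 : (1 + ivl_bound s m) * pr (i_ m @^-1` A `\` A) <= (1 + B0) * e'.
    apply: ler_pM; [by rewrite addr_ge0|exact: pr_ge0|by rewrite lerD2l hB|].
    by apply: (le_trans (aA m mM)); rewrite ler_piMr ?pr_le1// ltW.
  by apply: (le_trans h1); rewrite /e' mulrC divfK// gt_eqF// ltr_wpDr.
pose K := [set A | [/\ measurable A, alm A & pr A <= 1 / 4]].
have [A [mA aA A4] maxA] : exists2 A, K A & forall A', K A' -> A `<=` A' -> pr A' <= pr A.
  apply: (@maximal_set K set0); first 1 last.
  - by move=> A [].
  - move=> F KF ndF; have mF n : measurable (F n) by have [] := KF n.
    have mU : measurable (\bigcup_n F n) by exact: bigcup_measurable.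
    have lim r : 0 < r -> exists2 n, pr (\bigcup_n F n) - r < pr (F n) & K (F n).
      by move=> r0; have [n hn] := pr_bigcup_lim mu mF ndF r0; exists n.
    split=> // [m mM|]; apply/ler_addgt0Pr => r r0; last first.
      by have [n hn [_ _ Fn]] := lim r r0; lra.
    have miF n := preim_ivl s m (mF n).
    have ndiF : nondecreasing_seq (fun n => i_ m @^-1` F n).
      by move=> k l kl; apply/subsetPset => x; apply: (subsetPset _ _ (ndF _ _ kl)).
    have [n hn] := pr_bigcup_lim mu miF ndiF r0.
    rewrite -preimage_bigcup in hn.
    have miU := preim_ivl s m mU.
    have FU : F n `<=` \bigcup_n F n by move=> x Fx; exists n.
    have sub : i_ m @^-1` (\bigcup_n F n) `\` \bigcup_n F n `<=`
        (i_ m @^-1` F n `\` F n) `|` (i_ m @^-1` (\bigcup_n F n) `\` i_ m @^-1` F n).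
      move=> x [Ux nUx]; have [Fx|nFx] := pselect (F n (i_ m x)); [left|by right].
      by split=> // /FU.
    have m1 := measurableD (miF n) (mF n).
    have m2 := measurableD miU (miF n).
    have := prS mu (measurableD miU mU) (measurableU _ _ m1 m2) sub.
    have := prU mu m1 m2; have [_ /(_ m mM) aF _] := KF n.
    rewrite [pr (_ `\` i_ m @^-1` F n)]prD//.
    have -> : i_ m @^-1` (\bigcup_n F n) `&` i_ m @^-1` F n = i_ m @^-1` F n.
      by rewrite setIC setIidl// => x; exact: FU.
    have : e' * pr (F n) <= e' * pr (\bigcup_n F n) by rewrite ler_pM2l// prS.
    lra.
  - by split=> // [m mM|]; rewrite ?preimage_set0 ?set0D pr0 ?mulr0//; lra.
pose Y := ~` A.
have mY : measurable Y by exact: measurableC.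
have Y34 : 3 / 4 <= pr Y by rewrite /Y prC//; lra.
have [n [sg [C [C0 Isg bsg cov]]]] := finite_cover con mY Y34.
have nC0 : 0 <= n%:R * C by rewrite mulr_ge0.
(* The first bound lets [n] errors absorb at most half of [A']; the second turns an error relative
   to [A'] into one relative to its trace [B]. *)
pose dl := Order.min (2 * n.+1%:R)^-1 (e' / (2 * (1 + n%:R * C))).
have dl0 : 0 < dl.
  by rewrite lt_min invr_gt0 mulr_gt0//= divr_gt0// mulr_gt0// ltr_wpDr.
pose fam k := if (k < M)%N then i_ k else sg (k - M)%N.
have [|||A' [mA' A'0 A'2 invA']] := @fail (M + n)%N fam (B0 + C) dl.
- exact: dl0.
- by move=> j _; rewrite /fam; case: ifP => _; [exact: ivlP|exact: Isg].
- move=> j A1 _ mA1; rewrite /fam; case: ifP => jM.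
    apply: (le_trans (ivl_bounded s j mA1)); rewrite ler_wpM2r ?pr_ge0//.
    by apply: (le_trans (hB _ jM)); rewrite lerDl.
  by apply: (le_trans (bsg _ _ mA1)); rewrite ler_wpM2r ?pr_ge0// lerDr.
have invi m : (m < M)%N -> pr (A' `+` i_ m @^-1` A') <= dl * pr A'.
  by move=> mM; have := invA' m (ltn_addr _ mM); rewrite /fam mM.
have invs j : (j < n)%N -> pr (A' `+` sg j @^-1` A') <= dl * pr A'.
  move=> jn; have := invA' (M + j)%N; rewrite ltn_add2l => /(_ jn).
  by rewrite /fam ltnNge leq_addr /= addKn.
have msg j : measurable_fun setT (sg j) by have [] := Isg j.
pose B := A' `&` Y.
have mB : measurable B by exact: measurableI.
have ms j (S : set X) : measurable S -> measurable (sg j @^-1` S).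
  by move=> mS; exact: preim_measurable.
(* A point of [A'] outside [Y] is sent into [Y] by some [sg j]; its image either leaves [A'], which
   is rare, or falls into [B]. *)
have A'B : pr A' <= 2 * (1 + n%:R * C) * pr B.
  pose G j := (A' `+` sg j @^-1` A') `|` sg j @^-1` B.
  have mG j : measurable (G j).
    by apply: measurableU; [apply: measurableY => //; exact: ms|exact: ms].
  have pG j : (j < n)%N -> pr (G j) <= dl * pr A' + C * pr B.
    move=> jn; apply: le_trans (prU mu (measurableY mA' (ms j _ mA')) (ms j _ mB)) _.
    by apply: lerD; [exact: invs|exact: bsg].
  have : pr A' <= pr (B `|` \big[setU/set0]_(j < n) G j).
    apply: pr_ae_le => //; first by apply: measurableU => //; exact: bigsetU_measurable.
    have mcov : measurable (~` Y `\` \bigcup_(j < n) (sg j @^-1` Y)).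
      apply: measurableD; first exact: measurableC.
      by apply: bigcup_measurable => j _; exact: ms.
    apply: filterS (pr0_ae mcov cov) => x nc A'x.
    have [Yx|nYx] := pselect (Y x); [by left|right].
    rewrite -bigcup_mkord.
    have [j /= jn sY] : (\bigcup_(j < n) (sg j @^-1` Y)) x.
      by apply: contrapT => h; apply: nc; split.
    exists j => //; have [sA'|nsA'] := pselect (A' (sg j x)); [by right; split|left].
    by left; split.
  have := prU mu mB (bigsetU_measurable (P := xpredT) (index_enum 'I_n) (fun (j : 'I_n) _ => mG j)).
  have : pr (\big[setU/set0]_(j < n) G j) <= n%:R * (dl * pr A' + C * pr B).
    apply: (le_trans (pr_bigsetU mu n mG)).
    apply: (@le_trans _ _ (\sum_(j < n) (dl * pr A' + C * pr B))).
      by apply: ler_sum => j _; exact: pG.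
    by rewrite sumr_const card_ord mulr_natl.
  have : n%:R * dl <= 1 / 2.
    have : dl <= (2 * n.+1%:R)^-1 by rewrite ge_min lexx.
    have n0 : 0 <= n%:R :> R by [].
    have nn : 0 < 2 * n.+1%:R :> R by rewrite mulr_gt0.
    move=> /(ler_wpM2l n0) /le_trans; apply.
    by rewrite ler_pdivrMr// mulrA divrK ?unitfE// mul1r ler_nat.
  move=> h1 h2 h3 h4; have := pr_ge0 mu A'; have := pr_ge0 mu B => pB pA'.
  have : n%:R * dl * pr A' <= 1 / 2 * pr A' by rewrite ler_wpM2r.
  lra.
have B0' : 0 < pr B.
  have q0 : 0 < 2 * (1 + n%:R * C) by rewrite mulr_gt0// ltr_wpDr.
  by rewrite -(pmulr_rgt0 _ q0); apply: lt_le_trans A'B.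
have AB0 : A `&` B = set0 by rewrite -subset0 => x [Ax [_]]; apply.
have pAB : pr (A `|` B) = pr A + pr B by exact: prUD.
have mAB : measurable (A `|` B) by exact: measurableU.
have aAB : alm (A `|` B).
  move=> m mM; have miA := preim_ivl s m mA; have miA' := preim_ivl s m mA'.
  have m1 := measurableD miA mA; have m2 := measurableY mA' miA'.
  apply: (@le_trans _ _ (pr ((i_ m @^-1` A `\` A) `|` (A' `+` i_ m @^-1` A')))).
    apply: prS; [by apply: measurableD => //; exact: preim_ivl|exact: measurableU|].
    move=> x [[Ax|[A'x Yx]] nAB]; first by left; split=> // Ax'; apply: nAB; left.
    right; right; split=> // A'x'; apply: nAB.
    by have [Ax'|nAx'] := pselect (A x); [left|right; split].
  apply: (le_trans (prU mu m1 m2)); rewrite pAB mulrDr; apply: lerD; first exact: aA.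
  apply: (le_trans (invi m mM)).
  have q0 : 0 < 2 * (1 + n%:R * C) by rewrite mulr_gt0// ltr_wpDr.
  have : dl <= e' / (2 * (1 + n%:R * C)) by rewrite ge_min lexx orbT.
  rewrite ler_pdivlMr// => hdl.
  apply: (@le_trans _ _ (dl * (2 * (1 + n%:R * C) * pr B))).
    by rewrite ler_wpM2l// ltW.
  by rewrite mulrA ler_wpM2r// ltW.
have BA' : pr B <= pr A' by apply: prS => //; exact: subIsetl.
have [h|] := dich _ mAB aAB; last by rewrite pAB; lra.
have KAB : K (A `|` B) by split=> //; lra.
by have := maxA _ KAB (@subsetUl _ _ _); rewrite pAB; lra.
Qed.

End exhaustion.

(** * Cheeger's inequality *)

Section cheeger.
Context (R : realType) (d : measure_display) (X : measurableType d).
Variable mu : probability X R.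
Local Notation pr := (Pr mu).

(** Tonelli for the region between two graphs. With the minimum and maximum of [w (sg j x)] and
    [w x] for [a] and [b], it is the co-area formula. *)
Lemma layer_cake (a b : X -> R) : measurable_fun setT a -> measurable_fun setT b ->
  (forall x, a x <= b x) ->
  measurable_fun setT (fun t : R => (pr [set x | a x <= t < b x])%:E) /\
  (\int[mu]_x (b x - a x)%:E =
   \int[lebesgue_measure]_t (pr [set x | a x <= t < b x])%:E)%E.
Proof.
move=> ma mb ab.
pose K : set (X * measurableTypeR R) := [set p | a p.1 <= p.2 < b p.1].
have mK : measurable K.
  apply: (boolset_measurable (b := fun p : X * measurableTypeR R => a p.1 <= p.2 < b p.1)).
  apply: measurable_and.
    by apply: measurable_fun_ler; [exact: measurableT_comp|exact: measurable_snd].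
  by apply: measurable_fun_ltr; [exact: measurable_snd|exact: measurableT_comp].
have m1 t : measurable [set x | a x <= t < b x].
  apply: (boolset_measurable (b := fun x => a x <= t < b x)).
  by apply: measurable_and; [exact: measurable_fun_ler|exact: measurable_fun_ltr].
have GE : (fun t : measurableTypeR R => (pr [set x | a x <= t < b x])%:E) =
    fubini_G mu (EFin \o \1_K).
  rewrite indic_fubini_tonelli_GE//; apply/funext => t /=.
  rewrite -prE//; congr (mu _); apply/seteqP.
  by split=> x; rewrite /ysection /K /= inE.
have FE : (fun x => (b x - a x)%:E) = fubini_F (@lebesgue_measure R) (EFin \o \1_K).
  rewrite indic_fubini_tonelli_FE//; apply/funext => x /=.
  have -> : xsection K x = `[a x, b x[%classic.
    by apply/seteqP; split=> t; rewrite /xsection /K /= inE /= in_itv.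
  rewrite lebesgue_measure_itv /= lte_fin; case: ltP => // ba.
  by rewrite (le_anti (introT andP (conj (ab x) ba))) subrr.
split; first by rewrite GE; exact: indic_measurable_fun_fubini_tonelli_G.
by rewrite FE GE; exact: indic_fubini_tonelli.
Qed.

Definition energy (f : X -> R) : \bar R := (\int[mu]_x ((f x) ^+ 2)%:E)%E.

Lemma energy_ge0 f : (0 <= energy f)%E.
Proof. by apply: integral_ge0 => x _; rewrite lee_fin sqr_ge0. Qed.

Lemma sqr_measurable (f : X -> R) (A : set X) : measurable_fun setT f ->
  measurable_fun A (fun x => ((f x) ^+ 2)%:E).
Proof.
by move=> mf; apply: measurable_funTS; apply/measurable_EFinP; exact: measurable_funX.
Qed.

Lemma energy_le (f g : X -> R) : measurable_fun setT f -> measurable_fun setT g ->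
  (forall x, `|f x| <= `|g x|) -> (energy f <= energy g)%E.
Proof.
move=> mf mg fg; apply: ge0_le_integral => //.
- by move=> x _; rewrite lee_fin sqr_ge0.
- exact: sqr_measurable.
- exact: sqr_measurable.
by move=> x _; rewrite lee_fin -(real_normK (num_real (f x))) -(real_normK (num_real (g x))) lerXn2r ?nnegrE.
Qed.

Lemma energyD_le (f g h : X -> R) : measurable_fun setT f -> measurable_fun setT g ->
  measurable_fun setT h -> (forall x, f x ^+ 2 + g x ^+ 2 <= h x ^+ 2) ->
  (energy f + energy g <= energy h)%E.
Proof.
move=> mf mg mh fgh; rewrite -ge0_integralD//; first last.
- exact: sqr_measurable.
- by move=> x _; rewrite lee_fin sqr_ge0.
- exact: sqr_measurable.
- by move=> x _; rewrite lee_fin sqr_ge0.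
apply: ge0_le_integral => //.
- by move=> x _; rewrite -EFinD lee_fin addr_ge0 ?sqr_ge0.
- by apply: emeasurable_funD; exact: sqr_measurable.
- exact: sqr_measurable.
by move=> x _; rewrite -EFinD lee_fin.
Qed.

Variables (n : nat) (sg : nat -> X -> X) (dl : R).
Hypothesis dl0 : 0 < dl.
Hypothesis msg : forall j, (j < n)%N -> measurable_fun setT (sg j).
Hypothesis exp_sg : forall A : set X, measurable A -> 0 < pr A -> pr A <= 1 / 2 ->
  exists2 j, (j < n)%N & dl * pr A < pr (A `+` sg j @^-1` A).

Lemma expander_sum (A : set X) : measurable A -> pr A <= 1 / 2 ->
  dl * pr A <= \sum_(j < n) pr (A `+` sg j @^-1` A).
Proof.
move=> mA A2; have [A0|nA0] := ltP 0 (pr A).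
  have [j jn hj] := exp_sg mA A0 A2; apply: (le_trans (ltW hj)).
  by rewrite (bigD1 (Ordinal jn))//= lerDl sumr_ge0// => k _; exact: pr_ge0.
have -> : pr A = 0 by apply/le_anti; rewrite nA0 pr_ge0.
by rewrite mulr0 sumr_ge0// => k _; exact: pr_ge0.
Qed.

(** For [t >= 0], the slice of [|w \o sg j - w|] at height [t] is the symmetric difference of the
    superlevel set at [t] and its preimage, and that set has measure at most 1/2; integrate
    expansion over [t]. *)
Lemma expander_L1 (w : X -> R) : measurable_fun setT w -> (forall x, 0 <= w x) ->
  pr [set x | 0 < w x] <= 1 / 2 ->
  (dl%:E * \int[mu]_x (w x)%:E <= \sum_(j < n) \int[mu]_x `|w (sg j x) - w x|%:E)%E.
Proof.
move=> mw w0 pw.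
pose lo (j : 'I_n) x := Order.min (w (sg j x)) (w x).
pose hi (j : 'I_n) x := Order.max (w (sg j x)) (w x).
have mws (j : 'I_n) : measurable_fun setT (fun x => w (sg j x)).
  by apply: measurableT_comp => //; exact: msg.
have mlo j : measurable_fun setT (lo j) by exact: measurable_minr.
have mhi j : measurable_fun setT (hi j) by exact: measurable_maxr.
have lohi j x : lo j x <= hi j x by rewrite /lo /hi ge_min !le_max lexx.
have hilo j x : hi j x - lo j x = `|w (sg j x) - w x|.
  rewrite /hi /lo; have [h|h] := leP (w (sg j x)) (w x).
    by rewrite ler0_norm ?opprB// subr_le0.
  by rewrite gtr0_norm// subr_gt0.
have [m0 e0] := layer_cake (measurable_cst _) mw w0.
have wE : (\int[mu]_x (w x)%:E = \int[mu]_x (w x - cst 0 x)%:E)%E.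
  by apply: eq_integral => x _; rewrite subr0.
have -> : (\sum_(j < n) \int[mu]_x `|w (sg j x) - w x|%:E =
    \sum_(j < n) \int[lebesgue_measure]_t (pr [set x | lo j x <= t < hi j x])%:E)%E.
  apply: eq_bigr => j _; have [_ <-] := layer_cake (mlo j) (mhi j) (lohi j).
  by apply: eq_integral => x _; rewrite hilo.
rewrite wE e0 -ge0_integralZl_EFin//; [|by move=> t _; rewrite lee_fin pr_ge0|exact: ltW].
rewrite -ge0_integral_sum//; first last.
- by move=> j t _; rewrite lee_fin pr_ge0.
- by move=> j; have [] := layer_cake (mlo j) (mhi j) (lohi j).
apply: ge0_le_integral => //.
- by move=> t _; rewrite -EFinM lee_fin mulr_ge0 ?pr_ge0// ltW.
- by apply: emeasurable_funM => //; exact: measurable_cst.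
- by apply: emeasurable_sum => j; exact: (proj1 (layer_cake (mlo j) (mhi j) (lohi j))).
move=> t _; rewrite sumEFin -EFinM lee_fin.
have [t0|t0] := leP 0 t; last first.
  rewrite [X in dl * Pr _ X](_ : _ = set0); last first.
    by rewrite -subset0 => x /andP[].
  by rewrite pr0 mulr0 sumr_ge0// => j _; exact: pr_ge0.
rewrite [X in dl * Pr _ X](_ : _ = [set x | t < w x]); last first.
  by apply/seteqP; split=> [x /andP[]//|x tw]; apply/andP.
have mt := gt_measurable mw t.
apply: le_trans (expander_sum mt _) _.
  by apply: le_trans pw; apply: prS => //; [exact: gt_measurable|move=> x; exact: le_lt_trans].
apply: ler_sum => j _; rewrite le_eqVlt; apply/orP; left; apply/eqP; congr pr.
apply/seteqP; split=> x; rewrite /setY /lo /hi /= ge_min lt_max.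
  by move=> [[-> /negP]|[-> /negP]]; rewrite -leNgt => ->; rewrite ?orbT.
case: (leP (w (sg j x)) t) => h1; case: (leP (w x) t) => h2 //=.
- by left; split=> //; rewrite ltNge h1.
- by right; split=> //; rewrite ltNge h2.
Qed.

(** The parameter [s] is such that [n] error terms [4 s g^2] amount to at most half of the expansion
    constant [dl]; the other half is divided out. *)
Definition gap_const : R := let s := dl / (8 * n.+1%:R) in 2 * ((2 * s)^-1 + s) / dl.

Lemma gap_const_gt0 : 0 < gap_const.
Proof.
by rewrite /gap_const divr_gt0// mulr_gt0// addr_gt0// ?invr_gt0 ?mulr_gt0// divr_gt0// mulr_gt0.
Qed.

(** The L1 inequality for [g^2], with its right-hand side linearized by AM-GM. Finite energy is what
    permits absorbing a multiple of it on the left. *)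
Lemma expander_energy (g : X -> R) : measurable_fun setT g ->
  pr [set x | g x != 0] <= 1 / 2 -> (energy g < +oo)%E ->
  (energy g <= gap_const%:E * \sum_(j < n) energy (fun x => (g (sg j x) - g x)%R))%E.
Proof.
move=> mg pg gfin.
set S := (\sum_(j < n) _)%E.
have S0 : (0 <= S)%E by apply: sume_ge0 => j _; exact: energy_ge0.
have [SE|SN] := eqVneq S +oo%E; first by rewrite SE gt0_muley ?lte_fin ?gap_const_gt0// leey.
have Sfin : S \is a fin_num by rewrite ge0_fin_numE// lt_neqAle SN leey.
have Gfin : energy g \is a fin_num by rewrite ge0_fin_numE// energy_ge0.
pose s := dl / (8 * n.+1%:R).
have s0 : 0 < s by rewrite divr_gt0// mulr_gt0.
have mgs (j : 'I_n) : measurable_fun setT (fun x => g (sg j x)).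
  by apply: measurableT_comp => //; exact: msg.
have h1 := @expander_L1 (fun x => g x ^+ 2) (measurable_funX _ mg) (fun x => sqr_ge0 _).
have {h1} : (dl%:E * energy g <= \sum_(j < n) \int[mu]_x `|g (sg j x) ^+ 2 - g x ^+ 2|%:E)%E.
  apply: h1; apply: le_trans pg; apply: prS.
  - by apply: gt_measurable; exact: measurable_funX.
  - apply: (boolset_measurable (b := fun x => g x != 0)).
    by apply: measurable_neg; exact: measurable_fun_eqr.
  - by move=> x /=; apply: contraTneq => ->; rewrite expr0n ltxx.
move=> /le_trans h1.
pose K := (2 * s)^-1 + s.
have K0 : 0 < K by rewrite addr_gt0// invr_gt0 mulr_gt0.
(* AM-GM: [|a^2 - b^2| = |a - b| |(a - b) + 2 b| <= (1/(2s) + s) (a - b)^2 + 4 s b^2] *)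
have amgm a b : `|a ^+ 2 - b ^+ 2| <= K * (a - b) ^+ 2 + 4 * s * b ^+ 2.
  have -> : a ^+ 2 - b ^+ 2 = (a - b) * ((a - b) + 2 * b) by ring.
  set x := a - b; set y := x + 2 * b; rewrite normrM.
  have h2 : `|x| * `|y| <= (2 * s)^-1 * x ^+ 2 + s / 2 * y ^+ 2.
    have : 0 <= (2 * s)^-1 * (`|x| - s * `|y|) ^+ 2.
      by rewrite mulr_ge0 ?sqr_ge0// invr_ge0 mulr_ge0// ltW.
    rewrite -(real_normK (num_real x)) -(real_normK (num_real y)).
    have -> : (2 * s)^-1 * (`|x| - s * `|y|) ^+ 2 =
      (2 * s)^-1 * `|x| ^+ 2 + s / 2 * `|y| ^+ 2 - `|x| * `|y| by field; rewrite gt_eqF.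
    lra.
  have h3 : y ^+ 2 <= 2 * x ^+ 2 + 8 * b ^+ 2.
    by have := sqr_ge0 (x - 2 * b); rewrite /y; lra.
  have : s / 2 * y ^+ 2 <= s / 2 * (2 * x ^+ 2 + 8 * b ^+ 2).
    by rewrite ler_wpM2l// divr_ge0// ltW.
  rewrite /K; lra.
have : (dl%:E * energy g <= \sum_(j < n) (K%:E * energy (fun x => (g (sg j x) - g x)%R) +
    (4 * s)%:E * energy g))%E.
  apply: h1; apply: lee_sum => j _.
  have mdj : measurable_fun setT (fun x => g (sg j x) - g x) by exact: measurable_funB.
  rewrite -!ge0_integralZl_EFin//; first last.
  - by rewrite ltW.
  - exact: sqr_measurable.
  - by move=> x _; rewrite lee_fin sqr_ge0.
  - by rewrite mulr_ge0// ltW.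
  - exact: sqr_measurable.
  - by move=> x _; rewrite lee_fin sqr_ge0.
  rewrite -ge0_integralD//; first last.
  - by apply: emeasurable_funM; [exact: measurable_cst|exact: sqr_measurable].
  - by move=> x _; rewrite -EFinM lee_fin mulr_ge0 ?sqr_ge0// mulr_ge0// ltW.
  - by apply: emeasurable_funM; [exact: measurable_cst|exact: sqr_measurable].
  - by move=> x _; rewrite -EFinM lee_fin mulr_ge0 ?sqr_ge0// ltW.
  apply: ge0_le_integral => //.
  - apply/measurable_EFinP; apply: measurableT_comp => //.
    by apply: measurable_funB; exact: measurable_funX.
  - apply: emeasurable_funD; apply: emeasurable_funM; do ?[exact: measurable_cst|exact: sqr_measurable].
  - by move=> x _; rewrite -!EFinM -EFinD lee_fin amgm.
rewrite big_split/= -ge0_sume_distrr; last by move=> j _; exact: energy_ge0.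
rewrite -/S -(fineK Gfin) -(fineK Sfin) -!EFinM sumEFin sumr_const card_ord -EFinD !lee_fin.
set G := fine _; set T := fine _ => h2.
have G0 : 0 <= G by rewrite fine_ge0// energy_ge0.
have h4 : 4 * s * G *+ n <= dl / 2 * G.
  rewrite -mulr_natr mulrAC ler_wpM2r//; rewrite /s.
  have n1 : n%:R <= n.+1%:R :> R by rewrite ler_nat.
  have n10 : 0 < n.+1%:R :> R by [].
  have -> : 4 * (dl / (8 * n.+1%:R)) * n%:R = dl / 2 * (n%:R / n.+1%:R) by field; rewrite gt_eqF.
  by rewrite ler_piMr ?divr_ge0 ?(ltW dl0)// ler_pdivrMr// mul1r.
have h5 : dl / 2 * G <= K * T.
  by move: h2 h4; set Z := 4 * s * G *+ n; rewrite /K; lra.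
rewrite /gap_const -/s -/K.
have -> : 2 * K / dl * T = (dl / 2)^-1 * (K * T) by field; rewrite gt_eqF.
by rewrite ler_pdivlMl// divr_gt0.
Qed.

Lemma L2_integrable (u : X -> R) : measurable_fun setT u -> (energy u < +oo)%E ->
  mu.-integrable setT (EFin \o u).
Proof.
move=> mu' ufin; apply/integrableP; split; first exact/measurable_EFinP.
apply: (@le_lt_trans _ _ (\int[mu]_x (cst 1%:E x + ((u x) ^+ 2)%:E))%E).
  apply: ge0_le_integral => //.
  - by apply/measurable_EFinP; exact: measurableT_comp.
  - by apply: emeasurable_funD; [exact: measurable_cst|exact: sqr_measurable].
  - move=> x _; rewrite /= -EFinD lee_fin -(real_normK (num_real (u x))).
    have := sqr_ge0 (`|u x| - 1 / 2); lra.
rewrite ge0_integralD//.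
- by rewrite integral_cst_pr// lte_add_pinfty// ltry.
- by move=> x _; rewrite lee_fin sqr_ge0.
- exact: sqr_measurable.
Qed.

(** The variance is the second moment minus the square of the mean. It allows passing from the
    median to the mean. *)
Lemma energy_mean_le (v : X -> R) : measurable_fun setT v -> (energy v < +oo)%E ->
  (energy (fun x => (v x - Rintegral mu setT v)%R) <= energy v)%E.
Proof.
move=> mv vfin; set m := Rintegral _ _ _.
have iv := L2_integrable mv vfin.
have iv2 : mu.-integrable setT (EFin \o (fun x => v x ^+ 2)).
  apply/integrableP; split; first exact: sqr_measurable.
  by under eq_integral => x _ do rewrite /= ger0_norm ?sqr_ge0//.
have ic (k : R) : mu.-integrable setT (EFin \o cst k).
  by apply: (finite_measure_integrable_cst mu).
have i1 : mu.-integrable setT (EFin \o (fun x => 2 * m * v x)).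
  have -> : EFin \o (fun x => 2 * m * v x) = (fun x => (2 * m)%R%:E * (EFin \o v) x)%E by apply/funext.
  exact: integrableZl.
have i2 : mu.-integrable setT (EFin \o (fun x => 2 * m * v x - cst (m ^+ 2) x)).
  exact: (integrableB measurableT i1 (ic (m ^+ 2))).
have RE : Rintegral mu setT (fun x => (v x - m) ^+ 2) = Rintegral mu setT (fun x => v x ^+ 2) - m ^+ 2.
  have -> : (fun x => (v x - m) ^+ 2) = (fun x => v x ^+ 2 - (2 * m * v x - cst (m ^+ 2) x)).
    by apply/funext => x /=; ring.
  rewrite RintegralB// RintegralB//.
  by rewrite RintegralZl// Rintegral_cst// -/m /= probability_setT /=; ring.
have im : mu.-integrable setT (EFin \o (fun x => (v x - m) ^+ 2)).
  have -> : EFin \o (fun x => (v x - m) ^+ 2) =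
      ((EFin \o (fun x => (v x ^+ 2)%R)) \- (EFin \o (fun x => (2 * m * v x - cst (m ^+ 2) x)%R)))%E.
    by apply/funext => x /=; rewrite -EFinB; congr (_%:E); ring.
  exact: integrableB.
rewrite /energy -(fineK (integrable_fin_num measurableT im)) -(fineK (integrable_fin_num measurableT iv2)).
by rewrite lee_fin [leLHS]RE gerBl sqr_ge0.
Qed.

Lemma real_spectral_gap (u : X -> R) : measurable_fun setT u -> (energy u < +oo)%E ->
  (energy (fun x => (u x - Rintegral mu setT u)%R) <=
   gap_const%:E * \sum_(j < n) energy (fun x => (u (sg j x) - u x)%R))%E.
Proof.
move=> mu' ufin; have iu := L2_integrable mu' ufin.
have [||m [m1 m2]] := @quantile _ _ _ mu u mu' (1 / 2); [lra|lra|].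
have p1 : pr [set x | m < u x] <= 1 / 2 by apply: (pr_gt_sup mu') => t /m1 /ltW.
have p2 : pr (~` [set x | m <= u x]) <= 1 / 2.
  by have := pr_ge_inf mu' m2; rewrite prC; [lra|exact: ge_measurable].
pose v x := u x - m.
have mv : measurable_fun setT v by exact: measurable_funB.
have vfin : (energy v < +oo)%E.
  apply: (@le_lt_trans _ _ (\int[mu]_x (2%:E * ((u x) ^+ 2)%:E + cst (2 * m ^+ 2)%:E x))%E).
    apply: ge0_le_integral => //.
    - by move=> x _; rewrite lee_fin sqr_ge0.
    - exact: sqr_measurable.
    - by apply: emeasurable_funD => //; apply: emeasurable_funM => //; exact: sqr_measurable.
    - move=> x _; rewrite /= -EFinM -EFinD lee_fin /v.
      by have := sqr_ge0 (u x + m); lra.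
  rewrite ge0_integralD//; first last.
  - by move=> x _; rewrite lee_fin mulr_ge0 ?sqr_ge0.
  - by apply: emeasurable_funM => //; exact: sqr_measurable.
  - by move=> x _; rewrite mule_ge0// lee_fin sqr_ge0.
  rewrite ge0_integralZl_EFin//; first last.
  - exact: sqr_measurable.
  - by move=> x _; rewrite lee_fin sqr_ge0.
  rewrite integral_cst_pr// lte_add_pinfty ?ltry//.
  by rewrite lte_mul_pinfty// lee_fin.
pose gp x := Order.max (v x) 0; pose gn x := Order.max (- v x) 0.
have mgp : measurable_fun setT gp by apply: measurable_maxr.
have mgn : measurable_fun setT gn.
  by apply: measurable_maxr => //; exact: measurableT_comp.
(* Since [v = gp - gn] and [gp * gn = 0], the cross term in the square on the right is
   [2 (gp x * gn y + gp y * gn x)], which is non-negative. *)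
have gpn x y : (gp y - gp x) ^+ 2 + (gn y - gn x) ^+ 2 <= (u y - u x) ^+ 2.
  have -> : u y - u x = v y - v x by rewrite /v; ring.
  rewrite /gp /gn; case: (leP (v x) 0) => h1; case: (leP (v y) 0) => h2;
    case: (leP (- v x) 0) => h3; case: (leP (- v y) 0) => h4; nra.
have gv x : `|gp x| <= `|v x| /\ `|gn x| <= `|v x|.
  by split; rewrite ger0_norm ?le_max ?lexx ?orbT// ge_max normr_ge0 andbT ?ler_norm// -normrN ler_norm.
have gpfin : (energy gp < +oo)%E.
  by apply: le_lt_trans vfin; apply: energy_le => // x; have [] := gv x.
have gnfin : (energy gn < +oo)%E.
  by apply: le_lt_trans vfin; apply: energy_le => // x; have [] := gv x.
have mne (f : X -> R) : measurable_fun setT f -> measurable [set x | f x != 0].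
  move=> mf; apply: (boolset_measurable (b := fun x => f x != 0)).
  by apply: measurable_neg; exact: measurable_fun_eqr.
have sp : pr [set x | gp x != 0] <= 1 / 2.
  apply: le_trans p1; apply: prS; [exact: mne|exact: gt_measurable|].
  by move=> x /=; apply: contraR; rewrite -leNgt -subr_le0 => h; rewrite /gp max_r.
have sn : pr [set x | gn x != 0] <= 1 / 2.
  apply: le_trans p2; apply: prS; [exact: mne|apply: measurableC; exact: ge_measurable|].
  move=> x /=; move=> /eqP h1 h2; apply: h1.
  by rewrite /gn max_r// oppr_le0 subr_ge0.
have vE : (energy v <= energy gp + energy gn)%E.
  rewrite -ge0_integralD//; first last.
  - exact: sqr_measurable.
  - by move=> x _; rewrite lee_fin sqr_ge0.
  - exact: sqr_measurable.
  - by move=> x _; rewrite lee_fin sqr_ge0.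
  apply: ge0_le_integral => //.
  - by move=> x _; rewrite lee_fin sqr_ge0.
  - exact: sqr_measurable.
  - by apply: emeasurable_funD; exact: sqr_measurable.
  move=> x _; rewrite -EFinD lee_fin /gp /gn.
  by case: (leP (v x) 0) => h1; case: (leP (- v x) 0) => h3; nra.
have -> : energy (fun x => (u x - Rintegral mu setT u)%R) = energy (fun x => (v x - Rintegral mu setT v)%R).
  have -> : Rintegral mu setT v = Rintegral mu setT u - m.
    rewrite /v RintegralB//; last by apply: (finite_measure_integrable_cst mu).
    by rewrite Rintegral_cst//= probability_setT /= mulr1.
  by apply: eq_integral => x _; congr (_ ^+ 2)%:E; rewrite /v; ring.
apply: (le_trans (energy_mean_le mv vfin)); apply: (le_trans vE).
apply: (le_trans (leeD (expander_energy mgp sp gpfin) (expander_energy mgn sn gnfin))).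
rewrite -ge0_muleDr; first last.
- by apply: sume_ge0 => j _; exact: energy_ge0.
- by apply: sume_ge0 => j _; exact: energy_ge0.
rewrite lee_wpmul2l ?lee_fin ?(ltW gap_const_gt0)// -big_split/=.
have mc (f : X -> R) (j : 'I_n) : measurable_fun setT f -> measurable_fun setT (fun x => f (sg j x) - f x).
  by move=> mf; apply: measurable_funB => //; apply: measurableT_comp => //; exact: msg.
by apply: lee_sum => j _; apply: energyD_le => //; exact: mc.
Qed.

End cheeger.

(** * Spectral gap *)

Section complex_energy.
Context (R : realType) (d : measure_display) (X : measurableType d).
Variable mu : probability X R.

Lemma poweR2 (x : \bar R) : (0 <= x)%E -> (x `^ 2 = x ^+ 2)%E.
Proof.
case: x => [r|_|//]; first by rewrite lee_fin => r0; rewrite poweR_EFin powR_mulrn// EFin_expe.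
by rewrite poweRyr// expe2 mulyy.
Qed.

Lemma normc_sqr (z : R[i]) : Normc.normc z ^+ 2 = complex.Re z ^+ 2 + complex.Im z ^+ 2.
Proof. by case: z => a b; rewrite /= sqr_sqrtr// addr_ge0 ?sqr_ge0. Qed.

Lemma normc_ge0 (z : R[i]) : 0 <= Normc.normc z.
Proof. by case: z => a b; exact: sqrtr_ge0. Qed.

Lemma cLnorm_sqr (f : X -> R[i]) : cmeasurable f ->
  (cLnorm mu 2%:E f ^+ 2 =
   energy mu (fun x => complex.Re (f x)) + energy mu (fun x => complex.Im (f x)))%E.
Proof.
move=> [mr mi]; rewrite -poweR2; last exact: Lnorm_ge0.
rewrite /cLnorm poweR_Lnorm// -ge0_integralD//.
- apply: eq_integral => x _.
  by rewrite poweR2// abse_EFin ger0_norm ?normc_ge0// -EFin_expe normc_sqr EFinD.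
- by move=> x _; rewrite lee_fin sqr_ge0.
- exact: (@sqr_measurable _ _ _ (fun x => complex.Re (f x))).
- by move=> x _; rewrite lee_fin sqr_ge0.
- exact: (@sqr_measurable _ _ _ (fun x => complex.Im (f x))).
Qed.

Lemma ReB (z w : R[i]) : complex.Re (z - w) = complex.Re z - complex.Re w.
Proof. by case: z w => [a b] [a' b']. Qed.

Lemma ImB (z w : R[i]) : complex.Im (z - w) = complex.Im z - complex.Im w.
Proof. by case: z w => [a b] [a' b']. Qed.

Lemma cLnormB_sqr (f g : X -> R[i]) : cmeasurable f -> cmeasurable g ->
  (cLnorm mu 2%:E (fun x => (f x - g x)%R) ^+ 2 =
   energy mu (fun x => (complex.Re (f x) - complex.Re (g x))%R) +
   energy mu (fun x => (complex.Im (f x) - complex.Im (g x))%R))%E.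
Proof.
move=> [mfr mfi] [mgr mgi]; rewrite cLnorm_sqr.
  by congr (_ + _)%E; apply: eq_integral => x _; rewrite ?ReB ?ImB.
split.
  have -> : (@complex.Re R \o (fun x => f x - g x)) =
      ((@complex.Re R \o f) \- (@complex.Re R \o g)) by apply/funext => x /=; rewrite ReB.
  exact: measurable_funB.
have -> : (@complex.Im R \o (fun x => f x - g x)) =
    ((@complex.Im R \o f) \- (@complex.Im R \o g)) by apply/funext => x /=; rewrite ImB.
exact: measurable_funB.
Qed.

Lemma in_L2P (f : X -> R[i]) : cmeasurable f ->
  in_L mu 2%:E f <->
  (energy mu (fun x => complex.Re (f x)) < +oo)%E /\
  (energy mu (fun x => complex.Im (f x)) < +oo)%E.
Proof.
move=> mf; have := cLnorm_sqr mf; set a := energy _ _; set b := energy _ _ => h.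
have a0 : (0 <= a)%E by exact: energy_ge0.
have b0 : (0 <= b)%E by exact: energy_ge0.
have : (0 <= cLnorm mu 2%:E f)%E by exact: Lnorm_ge0.
rewrite /in_L; move: h; case: (cLnorm _ _ _) => [r h _|h _|//].
  split=> [_|_]; last by split=> //; exact: ltry.
  have ab : (a + b < +oo)%E by rewrite -h -EFin_expe ltry.
  split; apply: le_lt_trans ab; first by rewrite leeDl.
  by rewrite leeDr.
split=> [[]//|[aoo boo]].
by have := lte_add_pinfty aoo boo; rewrite -h expe2 mulyy.
Qed.

Lemma energy_indic_mean (A : set X) : measurable A ->
  energy mu (fun x => \1_A x - Pr mu A) = (Pr mu A * (1 - Pr mu A))%:E.
Proof.
move=> mA; have mC : measurable (~` A) by exact: measurableC.
have -> : energy mu (fun x => \1_A x - Pr mu A) =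
    (\int[mu]_x (((1 - Pr mu A) ^+ 2)%:E * (\1_A x)%:E +
      ((Pr mu A) ^+ 2)%:E * (\1_(~` A) x)%:E))%E.
  apply: eq_integral => x _; rewrite -!EFinM -EFinD !indicE in_setC.
  by case: (x \in A) => /=; congr (_%:E); ring.
have m1 (B : set X) (k : R) : measurable B ->
    measurable_fun setT (fun x => (k%:E * (\1_B x)%:E)%E).
  by move=> mB; apply: emeasurable_funM => //; apply/measurable_EFinP.
rewrite ge0_integralD//; [|by move=> x _; rewrite -EFinM lee_fin mulr_ge0 ?sqr_ge0|exact: m1|
  by move=> x _; rewrite -EFinM lee_fin mulr_ge0 ?sqr_ge0|exact: m1].
rewrite !ge0_integralZl_EFin ?sqr_ge0//; do ?[exact/measurable_EFinP|by move=> x _; rewrite lee_fin].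
have i1 (B : set X) : measurable B -> (\int[mu]_x (\1_B x)%:E = (Pr mu B)%:E)%E.
  by move=> mB; rewrite integral_indic// setIT; exact: (prE mu mB).
by rewrite !i1// prC// -!EFinM -EFinD; congr (_%:E); ring.
Qed.

Lemma energy_indicB (A B : set X) : measurable A -> measurable B ->
  energy mu (fun x => \1_B x - \1_A x) = mu (A `+` B).
Proof.
move=> mA mB; rewrite -[in RHS](setIT (A `+` B)) -integral_indic//; last exact: measurableY.
apply: eq_integral => x _; rewrite !indicE /setY in_setU !in_setD.
by case: (x \in A); case: (x \in B) => /=; congr (_%:E); ring.
Qed.

End complex_energy.

Section bounded_involution.
Local Open Scope charge_scope.
Local Open Scope ring_scope.
Context (R : realType) (d : measure_display) (X : measurableType d).
Variables (mu : probability X R) (E : set (X * X)).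
Hypothesis nsE : nonsingular_equivalence mu E.
Local Notation pr := (Pr mu).

(** The upper bound on measures bounds the density by [C]; applied to preimages it also bounds it
    below by [C^-1], because [i] is its own inverse. *)
Lemma involution_mu_bounded i (Ii : involution_in E i) (C : R) :
  (forall A : set X, measurable A -> pr (i @^-1` A) <= C * pr A) ->
  mu_bounded (involution_aut nsE Ii).
Proof.
move=> iC; have [mi ii _] := Ii.
have C0 : 0 < C.
  by have := iC _ measurableT; rewrite preimage_setT prT mulr1; apply: lt_le_trans.
have [D [mD D0 Dchange]] := involution_density nsE Ii.
have Dpr := density_pr Ii Dchange.
have Dub : {ae mu, forall x, D x <= C}.
  apply: integral_ub_ae => // [x|A mA]; first exact: ltW.
  by rewrite Dpr// lee_fin iC.
have Dlb : {ae mu, forall x, C^-1 <= D x}.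
  apply: integral_lb_ae => // [x|A mA]; first exact: ltW.
  rewrite Dpr// lee_fin ler_pdivrMl//.
  have := iC _ (preim_measurable mi mA).
  by rewrite (_ : i @^-1` _ = A)//; apply/seteqP; split=> x /=; rewrite ii.
set nu := charge_of_finite_measure (distribution mu (aut_inv (involution_aut nsE Ii))).
have nuE A : measurable A -> nu A = (pr (i @^-1` A))%:E.
  by move=> mA; rewrite -(prE mu (preim_measurable mi mA)).
have numu : nu `<< mu.
  apply/null_content_dominatesP => A mA A0; rewrite nuE//; congr (_%:E).
  by apply/le_anti; rewrite pr_ge0 andbT; apply: le_trans (iC _ mA) _; rewrite /Pr A0 mulr0.
have gD : {ae mu, forall x, setT x -> ('d nu '/d mu) x = (D x)%:E}.
  apply: integral_ae_eq => //.
  - exact: Radon_Nikodym_integrable.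
  - exact/measurable_EFinP.
  move=> A _ mA; rewrite -Radon_Nikodym_integral// [RHS]Dpr//; exact: nuE.
exists (ln C); near=> x.
have -> : ('d nu '/d mu) x = (D x)%:E by near: x; apply: filterS gD => x; apply.
rewrite lne_EFin//= lee_fin ler_norml; apply/andP; split.
  by rewrite -lnV// ler_ln ?posrE ?invr_gt0//; near: x.
by rewrite ler_ln ?posrE//; near: x.
Unshelve. all: by end_near. Qed.

End bounded_involution.

Section equivalence.
Context (R : realType) (d : measure_display) (X : measurableType d).
Variables (mu : probability X R) (E : set (X * X)).

Definition spectral_gap := exists (kappa : R) (n : nat) (th : 'I_n -> nonsingular_aut mu),
     [/\ 0 < kappa,
         forall k, full_group E (th k),
         forall k, mu_bounded (th k)
       & forall f : X -> R[i], in_L mu 2%:E f ->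
           (cLnorm mu 2%:E (fun x => (f x - mean mu f)%R) ^+ 2 <=
            kappa%:E *
            \sum_(k < n)
              cLnorm mu 2%:E (fun x => (act_fun (th k) f x - f x)%R) ^+ 2)%E].

Lemma expander_spectral_gap : nonsingular_equivalence mu E -> expander mu E -> spectral_gap.
Proof.
move=> nsE [n [sg [C [dl [dl0 Isg sgC sgE]]]]].
pose th (k : 'I_n) := involution_aut nsE (Isg k (ltn_ord k)).
exists (gap_const n dl), n, th; split.
- exact: gap_const_gt0.
- by move=> k; exact: involution_aut_full_group.
- by move=> k; apply: (@involution_mu_bounded _ _ _ _ _ _ _ _ C) => A mA; exact: sgC.
move=> f fL; have [mf _] := fL; have /(in_L2P mu mf)[rfin ifin] := fL.
have msg j : (j < n)%N -> measurable_fun setT (sg j) by move=> /Isg[].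
have [mr mi] := mf.
have mcst (z : R[i]) : cmeasurable (fun _ : X => z) by split; exact: measurable_cst.
have mth k : cmeasurable (act_fun (th k) f).
  have mk := msg k (ltn_ord k).
  by split; [exact: (measurableT_comp mr mk)|exact: (measurableT_comp mi mk)].
(* Squared norms split into real and imaginary energies, so the real inequality applies to each part
   with the same constant. *)
rewrite cLnormB_sqr//.
have -> : (\sum_(k < n) cLnorm mu 2%:E (fun x => (act_fun (th k) f x - f x)%R) ^+ 2 =
  \sum_(k < n) energy mu (fun x => (complex.Re (f (sg k x)) - complex.Re (f x))%R) +
  \sum_(k < n) energy mu (fun x => (complex.Im (f (sg k x)) - complex.Im (f x))%R))%E.
  by rewrite -big_split; apply: eq_bigr => k _; exact: (cLnormB_sqr mu (mth k) mf).
rewrite ge0_muleDr; first last.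
- by apply: sume_ge0 => j _; exact: energy_ge0.
- by apply: sume_ge0 => j _; exact: energy_ge0.
apply: leeD.
  exact: (real_spectral_gap dl0 msg sgE mr rfin).
exact: (real_spectral_gap dl0 msg sgE mi ifin).
Qed.

Lemma spectral_gap_strongly_ergodic : spectral_gap -> strongly_ergodic mu E.
Proof.
move=> [kappa [n [th [k0 thE _ gap]]]] A mA Ath.
pose f m x : R[i] := \1_(A m) x +i* 0.
have mf m : cmeasurable (f m) by split; [exact: measurable_indic|exact: measurable_cst].
have mthA m k : measurable (act_set (th k) (A m)) by exact: preim_measurable.
have e0 : energy mu (fun _ : X => 0 - 0) = 0%E.
  by rewrite /energy integral0_eq// => x _; rewrite subrr expr0n.
have gapA m : (mu (A m) * (1 - mu (A m)) <=
    kappa%:E * \sum_(k < n) mu (A m `+` act_set (th k) (A m)))%E.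
  have fL : in_L mu 2%:E (f m).
    apply/in_L2P => //; rewrite /f/=; split; last first.
      by have := e0; rewrite subrr => ->; exact: ltry.
    have -> : energy mu (fun x => \1_(A m) x) = energy mu (fun x => \1_(A m) x - \1_set0 x).
      by apply: eq_integral => x _; rewrite indic0 subr0.
    by rewrite energy_indicB// (le_lt_trans (probability_le1 _ _)) ?ltry//; exact: measurableY.
  have := gap _ fL; rewrite cLnormB_sqr//; last by split; exact: measurable_cst.
  have -> : (\sum_(k < n) cLnorm mu 2%:E (fun x => (act_fun (th k) (f m) x - f m x)%R) ^+ 2 =
      \sum_(k < n) mu (A m `+` act_set (th k) (A m)))%E.
    apply: eq_bigr => k _; have mk : measurable_fun setT (aut_inv (th k)) by [].
    rewrite cLnormB_sqr//; last first.
      by split; [exact: (measurableT_comp (proj1 (mf m)) mk)|exact: measurable_cst].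
    by rewrite /f /act_fun /= e0 adde0 -energy_indicB.
  apply: le_trans; rewrite /f /mean/=.
  have -> : Rintegral mu setT (@complex.Re R \o (fun x => \1_(A m) x +i* 0)) = Pr mu (A m).
    by rewrite /Rintegral/= integral_indic// setIT.
  have -> : Rintegral mu setT (@complex.Im R \o (fun x => \1_(A m) x +i* 0)) = 0.
    by rewrite /Rintegral integral0_eq.
  by rewrite e0 adde0 energy_indic_mean// prE.
apply: (squeeze_cvge (f := cst 0%E)
  (h := fun m => (kappa%:E * \sum_(k < n) mu (A m `+` act_set (th k) (A m)))%E)).
- near=> m; by rewrite gapA andbT mule_ge0// sube_ge0 ?orbT ?probability_le1.
- exact: cvg_cst.
rewrite -[X in _ --> X](mule0 kappa%:E); apply: cvgeZl => //.
rewrite -[X in _ --> X](_ : (\sum_(k < n) (0 : \bar R) = 0)%E); last by rewrite big1_eq.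
apply: cvg_nnesum => [k _|k _]; first by apply: nearW => m; exact: measure_ge0.
exact: Ath.
Unshelve. all: by end_near. Qed.

End equivalence.

Theorem theorem1 (R : realType) (d : measure_display) (X : measurableType d)
    (mu : probability X R) (E : set (X * X)) :
  standard_borel R X ->
  nonsingular_equivalence mu E ->
  ergodic mu E ->
  preserves mu E mu \/ type_III mu E ->
  (strongly_ergodic mu E <->
   exists (kappa : R) (n : nat) (th : 'I_n -> nonsingular_aut mu),
     [/\ 0 < kappa,
         forall k, full_group E (th k),
         forall k, mu_bounded (th k)
       & forall f : X -> R[i], in_L mu 2%:E f ->
           (cLnorm mu 2%:E (fun x => (f x - mean mu f)%R) ^+ 2 <=
            kappa%:E *
            \sum_(k < n)
              cLnorm mu 2%:E (fun x => (act_fun (th k) f x - f x)%R) ^+ 2)%E]).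
Proof.
move=> sbX nsE _ inv; split=> [seE|]; last exact: spectral_gap_strongly_ergodic.
apply: expander_spectral_gap => //.
have [s _] := involution_system_exists sbX nsE.
have sexp : expanding s.
  by case: inv; [exact: preserves_expanding|exact: type_III_expanding].
by have [c [_ /connected_expander]] := expanding_connected nsE seE sexp; apply.
Qed.
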